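(* Let $\Gamma=\mathrm{PSL}_{2}(\mathbb{Z})$, $k\in\mathbb{N}$, and $Y=16/\sqrt{15}$. Then: (i) if $k\geq 2$ and $z\in\mathcal{F}_{Y}$, then $$S_{2k}^{\Gamma}(z)\leq\frac{31(2k-1)}{4\pi}+72(2k-1)\,1.014^{-(k-2)};$$ (ii) if $2\leq k\leq 25$ and $z\in\mathcal{F}_{1}^{Y}$, then $$S_{2k}^{\Gamma}(z)\leq\frac{31(2k-1)}{4\pi}+72(2k-1)\,1.014^{-(k-2)};$$ (iii) if $k\geq 26$ and $z\in\mathcal{F}_{1}^{Y}$, then $$S_{2k}^{\Gamma}(z)\leq\frac{2k-1}{4\pi}+\frac{3(2k-1)}{2\pi}\bigg(4^{-k+4}\bigg(\frac{k}{2\pi}\bigg)^{4}+\frac{\sqrt{k}\,e^{5/4}}{\sqrt{\pi}}\bigg).$$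
   Context: $\mathbb{H}=\{z=x+iy\mid y>0\}$ with volume form $\mu_{\mathrm{hyp}}(z)=\mathrm{d}x\wedge\mathrm{d}y/y^2$. $\mathcal{F}=\{z=x+iy\in\mathbb{H}\mid |z|\geq 1,\ -1/2\leq x\leq 1/2\}$ is the standard fundamental domain of $\mathrm{PSL}_2(\mathbb{Z})$; its only cusp is $i\infty$ with $\mathcal{F}_1^Y=\{x+iy\mid -1/2\leq x\leq 1/2,\ y\geq Y\}$, and $\mathcal{F}_Y$ is the closure of $\mathcal{F}\setminus\mathcal{F}_1^Y$. $\mathcal{S}_{2k}^{\Gamma}$ is the space of cusp forms of weight $2k$ for $\Gamma$ (holomorphic $f\colon\mathbb{H}\to\mathbb{C}$ with $f(\gamma z)=(cz+d)^{2k}f(z)$ for $\gamma=\begin{pmatrix}a&b\\c&d\end{pmatrix}\in\Gamma$, vanishing at the cusp), with Petersson inner product $\langle f_1,f_2\rangle=\int_{\Gamma\backslash\mathbb{H}}f_1\overline{f_2}\,y^{2k}\mu_{\mathrm{hyp}}$. With an orthonormal basis $\{f_1,\ldots,f_{d_{2k}}\}$ of this space, $S_{2k}^{\Gamma}(z):=\sum_{j=1}^{d_{2k}}|f_j(z)|^2\,\mathrm{Im}(z)^{2k}$. *)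

(* Defs.v *)
From mathcomp Require Import all_boot all_order all_algebra.
From mathcomp Require Import all_classical all_reals all_analysis.
From mathcomp Require Import complex.

Set Implicit Arguments.
Unset Strict Implicit.
Unset Printing Implicit Defensive.

Import Order.TTheory GRing.Theory Num.Theory.
Import numFieldNormedType.Exports.

Local Open Scope classical_set_scope.
Local Open Scope complex_scope.
Local Open Scope ring_scope.

Definition cmod (R : realType) (z : R[i]) : R := ComplexField.Normc.normc z.

Definition upper_half_plane (R : realType) : set R[i] :=
  [set z | 0 < complex.Im z].

(* [R[i]^o] is [R[i]] with its usual topology, as a normed space over itself;
   derivability in the direction [1] over the scalar field [R[i]] is complex
   differentiability. *)
Definition holomorphic_on_H (R : realType) (f : R[i] -> R[i]) : Prop :=
  forall z, upper_half_plane z ->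
    derivable (f : R[i]^o -> R[i]^o) (z : R[i]^o) (1 : R[i]^o).

Definition automorphy_denom (R : realType) (g : 'M[int]_2) (z : R[i]) : R[i] :=
  (g 1 0)%:~R * z + (g 1 1)%:~R.

Definition moebius (R : realType) (g : 'M[int]_2) (z : R[i]) : R[i] :=
  ((g 0 0)%:~R * z + (g 0 1)%:~R) / automorphy_denom g z.

(* Elements of PSL_2(Z) are represented by matrices of SL_2(Z); the condition
   is the same for [g] and [- g], because the weight [2 * k] is even. *)
Definition modular_of_weight_2k (R : realType) (k : nat) (f : R[i] -> R[i])
    : Prop :=
  forall (g : 'M[int]_2) (z : R[i]), \det g = 1 -> upper_half_plane z ->
    f (moebius g z) = automorphy_denom g z ^+ (2 * k) * f z.

(* f(x + iy) tends to 0 as y tends to infinity, uniformly in x *)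
Definition vanishes_at_cusp (R : realType) (f : R[i] -> R[i]) : Prop :=
  forall e : R, 0 < e ->
    \forall y \near +oo, forall x : R, cmod (f (x +i* y)) < e.

(* A form is a function on the upper half-plane; it is encoded as a function
   on [R[i]] whose values elsewhere are irrelevant. *)
Definition cusp_form (R : realType) (k : nat) (f : R[i] -> R[i]) : Prop :=
  [/\ holomorphic_on_H f, modular_of_weight_2k k f & vanishes_at_cusp f].

Definition fund_dom (R : realType) : set R[i] :=
  [set z | [/\ 0 < complex.Im z, 1 <= cmod z & - (1 / 2) <= complex.Re z <= 1 / 2]].

Definition cusp_nbhd (R : realType) (Y : R) : set R[i] :=
  [set z | - (1 / 2) <= complex.Re z <= 1 / 2 /\ Y <= complex.Im z].

Definition fund_dom_trunc (R : realType) (Y : R) : set R[i]^o :=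
  closure (@fund_dom R `\` cusp_nbhd Y : set R[i]^o).

(* integral of a real function against dx dy / y^2 *)
Definition hyp_Rintegral (R : realType) (D : set R[i]) (h : R[i] -> R) : R :=
  (\int[(@lebesgue_measure R \x @lebesgue_measure R)%E]_(p in
      [set p : R * R | D (p.1 +i* p.2)]) (h (p.1 +i* p.2) / p.2 ^+ 2))%R.

Definition hyp_integral (R : realType) (D : set R[i]) (h : R[i] -> R[i])
    : R[i] :=
  hyp_Rintegral D (fun z => complex.Re (h z)) +i*
  hyp_Rintegral D (fun z => complex.Im (h z)).

(* The integral over the quotient by PSL_2(Z) is taken over its standard
   fundamental domain. *)
Definition petersson (R : realType) (k : nat) (f1 f2 : R[i] -> R[i]) : R[i] :=
  hyp_integral (@fund_dom R)
    (fun z => f1 z * (f2 z)^* * (complex.Im z ^+ (2 * k))%:C).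

Definition orthonormal_basis_cusp_forms (R : realType) (k d : nat)
    (f : 'I_d -> R[i] -> R[i]) : Prop :=
  [/\ forall j, cusp_form k (f j),
      forall i j, petersson k (f i) (f j) = (i == j)%:R
    & forall g, cusp_form k g ->
        exists c : 'I_d -> R[i], forall z, upper_half_plane z ->
          g z = \sum_(j < d) c j * f j z].

Definition S2k (R : realType) (k d : nat) (f : 'I_d -> R[i] -> R[i])
    (z : R[i]) : R :=
  \sum_(j < d) cmod (f j z) ^+ 2 * complex.Im z ^+ (2 * k).

(* Main.v *)
Require Import Defs.
From HB Require Import structures.
From mathcomp Require Import all_boot all_order all_algebra.
From mathcomp Require Import all_classical all_reals all_analysis.
From mathcomp Require Import measurable_realfun.
From mathcomp Require Import complex.
From mathcomp Require Import ring lra zify.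

Set Implicit Arguments.
Unset Strict Implicit.
Unset Printing Implicit Defensive.

Import Order.TTheory GRing.Theory Num.Theory.
Import numFieldNormedType.Exports.

Local Open Scope classical_set_scope.
Local Open Scope complex_scope.
Local Open Scope ring_scope.

(** Fix a point z1 and an orthonormal basis f_1, ..., f_d. The form F = sum_j conj (f_j z1) f_j takes at
    z1 the value s = sum_j |f_j z1|^2, and its squared Petersson norm is also s. Hence any estimate

      |F(z1)|^2 y^(2k) <= C * (squared norm of F),

    valid for all cusp forms F, implies S(z1) <= C ([reproducing_form], [S2k_le_reproducing]). It remains
    to bound the height |F|^2 y^(2k) of a cusp form by its norm.

    The first tool is a mean value inequality on the disc of radius rho y0 about x0 + i y0. There
    y^(2k) is, up to a radial factor of the form 1 - c r^2, the squared modulus of the holomorphic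
    function (1 - i w / (2 y0))^(2k), so the height at the centre is at most its mean over the disc, up to
    a factor close to 1 when k rho^2 is small ([height_submean]). The integral over the disc is compared
    with the norm by unfolding: a disc above height 1 is covered by integer translates of the
    fundamental domain, and one of width at most m uses each point at most m times ([interior_bound]).
    Lower discs are handled at a point where the height is maximal over a strip. Such a point exists in
    the fundamental domain ([strip_max]), the third of its disc that points upwards is covered by
    translates, and on the other two thirds the height does not exceed the maximum ([corner_bound]).
    With rho = 1/10 for k <= 57 and rho^2 = 29 / (50 k) for larger k this gives the first bound for all
    3/4 <= y <= 15 ([strip_bound_small_weight], [strip_bound_large_weight]); with rho^2 = 13 / (50 k) it
    gives the last bound for 4 <= y <= k/4 + 1 ([middle_bound_large_weight]).

    The second tool controls the cusp. Integrating f(w) - f(z) against the kernel q / (1 - q), where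
    q = exp (2 pi i (z - w)), over a row and moving the row up into the cusp shows that f decays above
    the row at least like exp (-2 pi y) ([cusp_decay]). As 2 k <= 4 pi Y when Y >= k/4, the decay outweighs
    the growth of y^(2k) above height Y, and the height one unit or more above that row is at most
    256/225 times its supremum on the row ([bound_above_row]). The row is taken at height 7 when
    k <= 25 and at height k/4 when k >= 26.

    Both tools rest on the theorem of Goursat for rectangles ([goursat]): mean values over circles come from
    row means of periodic functions ([row_mean_Re], [circle_mean_Re]), and mean values over discs from those
    together with the invariance of area under rotations, which are products of shears. *)

(** * Modulus and topology of the complex numbers *)

Section Modulus.
Variable R : realType.
Implicit Types z w : R[i].

Lemma cmod_ge0 z : 0 <= cmod z.
Proof. by case: z => a b; exact: sqrtr_ge0. Qed.

Lemma cmod0 : cmod (0 : R[i]) = 0.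
Proof. exact: ComplexField.Normc.normc0. Qed.

Lemma cmod1 : cmod (1 : R[i]) = 1.
Proof. exact: ComplexField.Normc.normc1. Qed.

Lemma cmodM z w : cmod (z * w) = cmod z * cmod w.
Proof. exact: ComplexField.Normc.normcM. Qed.

Lemma cmodV z : cmod z^-1 = (cmod z)^-1.
Proof. exact: ComplexField.Normc.normcV. Qed.

Lemma cmodX z n : cmod (z ^+ n) = cmod z ^+ n.
Proof. by elim: n => [|n IH]; rewrite ?cmod1 // !exprS cmodM IH. Qed.

Lemma cmodN z : cmod (- z) = cmod z.
Proof. by case: z => a b; rewrite /cmod /= !sqrrN. Qed.

Lemma cmodD z w : cmod (z + w) <= cmod z + cmod w.
Proof. exact: le_normcD. Qed.

Lemma cmodB z w : cmod (z - w) = cmod (w - z).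
Proof. by rewrite -cmodN opprB. Qed.

Lemma cmod_sqr z : cmod z ^+ 2 = complex.Re z ^+ 2 + complex.Im z ^+ 2.
Proof. by case: z => a b; rewrite /cmod /= sqr_sqrtr // addr_ge0 // sqr_ge0. Qed.

Lemma cmod_eq0 z : (cmod z == 0) = (z == 0).
Proof.
apply/eqP/eqP => [|->]; last exact: cmod0.
exact: ComplexField.Normc.eq0_normc.
Qed.

Lemma cmod_gt0 z : (0 < cmod z) = (z != 0).
Proof. by rewrite lt_def cmod_eq0 cmod_ge0 andbT. Qed.

Lemma normr_cmod z : `|z| = (cmod z)%:C.
Proof. by rewrite normc_def; case: z. Qed.

Lemma le_Re_cmod z : `|complex.Re z| <= cmod z.
Proof.
rewrite -(@ler_pXn2r _ 2) ?nnegrE ?cmod_ge0 // cmod_sqr real_normK ?num_real //.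
by rewrite lerDl sqr_ge0.
Qed.

Lemma le_Im_cmod z : `|complex.Im z| <= cmod z.
Proof.
rewrite -(@ler_pXn2r _ 2) ?nnegrE ?cmod_ge0 // cmod_sqr real_normK ?num_real //.
by rewrite lerDr sqr_ge0.
Qed.

Lemma cmod_le_ReIm z : cmod z <= `|complex.Re z| + `|complex.Im z|.
Proof.
rewrite -(@ler_pXn2r _ 2) ?nnegrE ?cmod_ge0 ?addr_ge0 // cmod_sqr sqrrD.
rewrite !real_normK ?num_real // addrAC lerDl.
by rewrite mulrn_wge0 // mulr_ge0.
Qed.

Lemma cmod_real (x : R) : cmod x%:C = `|x|.
Proof. by rewrite /cmod /= expr0n addr0 sqrtr_sqr. Qed.

Lemma cReD z w : complex.Re (z + w) = complex.Re z + complex.Re w.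
Proof. by case: z; case: w. Qed.
Lemma cImD z w : complex.Im (z + w) = complex.Im z + complex.Im w.
Proof. by case: z; case: w. Qed.
Lemma cReN z : complex.Re (- z) = - complex.Re z.
Proof. by case: z. Qed.
Lemma cImN z : complex.Im (- z) = - complex.Im z.
Proof. by case: z. Qed.
Lemma cReM z w : complex.Re (z * w) =
  complex.Re z * complex.Re w - complex.Im z * complex.Im w.
Proof. by case: z; case: w. Qed.
Lemma cImM z w : complex.Im (z * w) =
  complex.Re z * complex.Im w + complex.Im z * complex.Re w.
Proof. by case: z => a b; case: w => c d /=; rewrite (mulrC b). Qed.
Lemma ReIm_eq z w : complex.Re z = complex.Re w -> complex.Im z = complex.Im w ->
  z = w.
Proof. by case: z => a b; case: w => c d /= -> ->. Qed.

End Modulus.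

Section Topology.
Variable R : realType.
Local Notation C := (R[i]^o).

Lemma cvgC_P (T : Type) (F : set_system T) {FF : Filter F} (f : T -> C) (l : C) :
  f @ F --> l <-> forall e : R, 0 < e -> \forall x \near F, cmod (f x - l) < e.
Proof.
split=> [/cvgrPdist_lt h e e0|h].
  have e0' : 0 < e%:C by rewrite ltcR.
  have := h _ e0'; apply: filterS => x.
  by rewrite normr_cmod ltcR cmodB.
apply/cvgrPdist_lt => -[e e'] /=; rewrite ltcE /= => /andP[/eqP -> e0].
have := h _ e0; apply: filterS => x.
by rewrite normr_cmod cmodB (ltcR _ e).
Qed.

Lemma nbhsC_P (z : C) (P : C -> Prop) :
  (\forall w \near z, P w) <->
  exists2 d : R, 0 < d & forall w : C, cmod (w - z) < d -> P w.
Proof.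
split.
  move=> /nbhs_ballP[[e e'] /=]; rewrite ltcE /= => /andP[/eqP -> e0] h.
  exists e => // w wz; apply: h; rewrite -ball_normE /ball_ /=.
  by rewrite normr_cmod cmodB (ltcR _ e).
move=> [d d0 h]; apply/nbhs_ballP; exists d%:C => /=; first by rewrite ltcR.
move=> w; rewrite -ball_normE /ball_ /= normr_cmod cmodB ltcR; exact: h.
Qed.

Lemma contC_P (f : C -> C) (z : C) : {for z, continuous f} <->
  forall e : R, 0 < e -> exists2 d : R, 0 < d &
    forall w, cmod (w - z) < d -> cmod (f w - f z) < e.
Proof.
split=> [/(@cvgC_P _ (nbhs z) _ f (f z)) h e e0|h].
  by have /nbhsC_P := h _ e0.
by apply/(@cvgC_P _ (nbhs z) _ f (f z)) => e e0; apply/nbhsC_P; exact: h.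
Qed.

Lemma contCR_P (f : C -> R^o) (z : C) : {for z, continuous f} <->
  forall e : R, 0 < e -> exists2 d : R, 0 < d &
    forall w, cmod (w - z) < d -> `|f w - f z| < e.
Proof.
split=> [/(@cvgrPdist_lt _ _ _ (nbhs z) _ f (f z)) h e e0|h].
  have /nbhsC_P [d d0 hd] := h _ e0.
  by exists d => // w /hd; rewrite distrC.
apply/(@cvgrPdist_lt _ _ _ (nbhs z) _ f (f z)) => e e0; apply/nbhsC_P.
by have [d d0 hd] := h _ e0; exists d => // w /hd; rewrite distrC.
Qed.

Lemma continuous_mkC :
  continuous (fun p : R^o * R^o => (p.1 +i* p.2) : C).
Proof.
move=> [x y].
apply/(@cvgC_P _ (nbhs (x, y)) _ (fun p : R^o * R^o => (p.1 +i* p.2) : C)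
  (x +i* y)) => e e0.
have e2 : 0 < e / 2 by rewrite divr_gt0.
exists (ball (x : R^o) (e / 2), ball (y : R^o) (e / 2)).
  by split; exact: nbhsx_ballx.
move=> [a b] [] /=; rewrite -!ball_normE /ball_ /= => h1 h2.
have := cmod_le_ReIm ((a +i* b) - (x +i* y)) => /= /le_lt_trans; apply.
by rewrite distrC (distrC b) [e]splitr ltrD.
Qed.

Lemma cmod_dist (z w : R[i]) : `|cmod z - cmod w| <= cmod (z - w).
Proof.
rewrite ler_norml; apply/andP; split.
  by rewrite lerNl opprB lerBlDr cmodB; have := cmodD (w - z) z; rewrite subrK.
by rewrite lerBlDr; have := cmodD (z - w) w; rewrite subrK.
Qed.

Lemma continuous_cmod : continuous (@cmod R : C -> R^o).
Proof.
move=> z; apply/contCR_P => e e0; exists e => // w.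
by apply: le_lt_trans; exact: cmod_dist.
Qed.

End Topology.

(** * Integrals over segments and bisection of rectangles *)

Section SegmentIntegral.
Variable R : realType.
Implicit Types (f g : R -> R) (a b : R).
Local Notation mu := (@lebesgue_measure R).

Definition cont_on a b f := forall x, a <= x <= b -> {for x, continuous (f : R^o -> R^o)}.

Definition cint a b f : R := \int[mu]_(x in `[a, b]) f x.

Lemma cont_on_sub a b c d f : a <= c -> d <= b -> cont_on a b f -> cont_on c d f.
Proof. by move=> ac db h x /andP[cx xd]; apply: h; rewrite (le_trans ac cx) (le_trans xd). Qed.

Lemma cont_on_within a b f : cont_on a b f -> {within `[a, b], continuous f}.
Proof.
move=> h; apply: continuous_in_subspaceT => x /set_mem /=.
by rewrite in_itv /=; exact: h.
Qed.

Lemma cont_on_int a b f : cont_on a b f -> mu.-integrable `[a, b] (EFin \o f).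
Proof.
by move=> /cont_on_within; apply: continuous_compact_integrable; exact: segment_compact.
Qed.

Lemma cintB a b f g : cont_on a b f -> cont_on a b g ->
  cint a b (fun x => f x - g x) = cint a b f - cint a b g.
Proof. by move=> hf hg; rewrite /cint RintegralB //; exact: cont_on_int. Qed.

Lemma cintZ a b f k : cont_on a b f ->
  cint a b (fun x => k * f x) = k * cint a b f.
Proof. by move=> hf; rewrite /cint RintegralZl //; exact: cont_on_int. Qed.

Lemma cint_cst a b k : a <= b -> cint a b (fun=> k) = k * (b - a).
Proof.
move=> ab; rewrite /cint Rintegral_cst //=.
by rewrite lebesgue_measure_itv /= lte_fin; case: ltP => // ba /=; rewrite (@le_anti _ _ a b) ?subrr // ab ba.
Qed.

Lemma eq_cint a b f g : (forall x, a <= x <= b -> f x = g x) -> cint a b f = cint a b g.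
Proof. by move=> h; apply: eq_Rintegral => x /set_mem /=; rewrite in_itv; exact: h. Qed.

Lemma le_cint a b f g : cont_on a b f -> cont_on a b g ->
  (forall x, a <= x <= b -> f x <= g x) -> cint a b f <= cint a b g.
Proof.
move=> /cont_on_int hf /cont_on_int hg h; exact: le_Rintegral.
Qed.

Lemma cont_on_cst a b k : cont_on a b (fun=> k).
Proof. by move=> x _; exact: cvg_cst. Qed.

Lemma cont_onN a b f : cont_on a b f -> cont_on a b (fun x => - f x).
Proof. by move=> h x /h hx; exact: cvgN. Qed.

Lemma cont_onD a b f g : cont_on a b f -> cont_on a b g -> cont_on a b (fun x => f x + g x).
Proof. by move=> h1 h2 x xab; apply: cvgD; [exact: h1|exact: h2]. Qed.

Lemma cont_onZ a b f k : cont_on a b f -> cont_on a b (fun x => k * f x).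
Proof. by move=> h x /h hx; apply: cvgM => //; exact: cvg_cst. Qed.

Lemma cint_bound a b f k : a <= b -> cont_on a b f ->
  (forall x, a <= x <= b -> `|f x| <= k) -> `|cint a b f| <= k * (b - a).
Proof.
move=> ab hf h; rewrite ler_norml -mulNr -!cint_cst //; apply/andP; split.
  by apply: le_cint => //; [exact: cont_on_cst|move=> x /h; rewrite ler_norml => /andP[]].
by apply: le_cint => //; [exact: cont_on_cst|move=> x /h; rewrite ler_norml => /andP[]].
Qed.

Lemma cint_split a b c f : a <= c -> c <= b -> cont_on a b f ->
  cint a b f = cint a c f + cint c b f.
Proof.
move=> ac cb h; have h2 := cont_on_int h.
have hcb : cont_on c b f by apply: cont_on_sub h.
rewrite /cint -(@Rintegral_itv_obnd_cbnd _ c (BRight b)); last first.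
  apply: integrableS (cont_on_int hcb) => //.
  by apply: subset_itvr; rewrite bnd_simp.
rewrite -(@Rintegral_itvB _ f (BLeft a) (BRight b) c) ?bnd_simp //.
by rewrite addrC subrK.
Qed.

Lemma cint_FTC (F : R -> R) f a b : a <= b ->
  (forall x : R, is_derive x (1 : R) F (f x)) -> cont_on a b f ->
  cint a b f = F b - F a.
Proof.
rewrite le_eqVlt => /predU1P[->|ab] dF cf.
  by rewrite /cint set_itv1 Rintegral_set1 subrr.
rewrite /cint /Rintegral (@continuous_FTC2 _ _ F) //=.
- exact: cont_on_within.
- split.
  + by move=> x _; have [] := dF x.
  + apply: cvg_at_right_filter; apply: differentiable_continuous.
    by apply/derivable1_diffP; have [] := dF a.
  + apply: cvg_at_left_filter; apply: differentiable_continuous.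
    by apply/derivable1_diffP; have [] := dF b.
- by move=> x _; rewrite derive1E; have [_ ->] := dF x.
Qed.

Lemma cint_affine a b (k l : R) : a <= b ->
  cint a b (fun x => k + l * x) = k * (b - a) + l * (b ^+ 2 - a ^+ 2) / 2.
Proof.
move=> ab; pose F x : R := k * x + l / 2 * x ^+ 2.
have dF (x : R) : is_derive x (1 : R) F (k + l * x).
  by apply: is_derive_eq; rewrite /GRing.scale /=; field.
rewrite (cint_FTC ab dF); first by rewrite /F; field.
by apply: cont_onD; [exact: cont_on_cst | apply: cont_onZ => x _; exact: cvg_id].
Qed.

End SegmentIntegral.

Section Bisection.
Variable R : realType.

Lemma quarter_norm (A B C D k : R) : 4 * k <= `|(A + B) + (C + D)| ->
  [\/ k <= `|A|, k <= `|B|, k <= `|C| | k <= `|D| ].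
Proof.
move=> h.
have := ler_normD (A + B) (C + D); have := ler_normD A B; have := ler_normD C D.
have [?|?] := leP k `|A|; first by constructor 1.
have [?|?] := leP k `|B|; first by constructor 2.
have [?|?] := leP k `|C|; first by constructor 3.
have [?|?] := leP k `|D|; first by constructor 4.
lra.
Qed.

(** If the value were not 0, some quarter of the rectangle would carry at least a fourth of it, some
    quarter of that one again, and so on: the nested rectangles shrink to a point, where the local
    hypothesis makes the value smaller than any multiple of the area. *)
Lemma rect_null (I : R -> R -> R -> R -> R) a b c d :
  a <= b -> c <= d ->
  (forall x1 x x2 y1 y2, a <= x1 -> x1 <= x -> x <= x2 -> x2 <= b ->
     c <= y1 -> y1 <= y2 -> y2 <= d ->
     I x1 x2 y1 y2 = I x1 x y1 y2 + I x x2 y1 y2) ->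
  (forall x1 x2 y1 y y2, a <= x1 -> x1 <= x2 -> x2 <= b ->
     c <= y1 -> y1 <= y -> y <= y2 -> y2 <= d ->
     I x1 x2 y1 y2 = I x1 x2 y1 y + I x1 x2 y y2) ->
  (forall p q, a <= p <= b -> c <= q <= d -> forall e, 0 < e ->
     exists2 t, 0 < t & forall s x y, 0 < s -> s < t ->
       a <= x -> x <= p -> p <= x + s * (b - a) -> x + s * (b - a) <= b ->
       c <= y -> y <= q -> q <= y + s * (d - c) -> y + s * (d - c) <= d ->
       `|I x (x + s * (b - a)) y (y + s * (d - c))| <= e * s ^+ 2) ->
  I a b c d = 0.
Proof.
move=> ab cd hx hy hloc.
apply/eqP; rewrite -normr_eq0; apply/eqP; apply/le_anti; rewrite normr_ge0 andbT.
rewrite leNgt; apply/negP => k0.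
set k := `|I a b c d| in k0.
pose s n : R := 2^-1 ^+ n.
have s0 n : 0 < s n by rewrite exprn_gt0 // invr_gt0.
have sS n : s n = s n.+1 + s n.+1 by rewrite /s exprSr; field.
pose w := b - a; pose l := d - c.
have w0 : 0 <= w by rewrite subr_ge0.
have l0 : 0 <= l by rewrite subr_ge0.
(* the rectangle at corner p, 2^-n times the given one, keeps at least the share k / 4^n *)
pose P n (p : R * R) := [/\ a <= p.1, p.1 + s n * w <= b, c <= p.2,
   p.2 + s n * l <= d & k * (s n) ^+ 2 <= `|I p.1 (p.1 + s n * w) p.2 (p.2 + s n * l)|].
pose Q n (p q : R * R) := [/\ p.1 <= q.1, q.1 + s n.+1 * w <= p.1 + s n * w,
   p.2 <= q.2 & q.2 + s n.+1 * l <= p.2 + s n * l].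
have step (np : nat * (R * R)) : exists q, P np.1 np.2 -> P np.1.+1 q /\ Q np.1 np.2 q.
  case: np => n [x y] /=.
  case: (pselect (P n (x, y))) => [|nP]; last by exists (x, y).
  move=> [/= h1 h2 h3 h4 h5].
  have sw0 : 0 <= s n.+1 * w by rewrite mulr_ge0 // ltW.
  have sl0 : 0 <= s n.+1 * l by rewrite mulr_ge0 // ltW.
  have ew : s n * w = s n.+1 * w + s n.+1 * w by rewrite sS mulrDl.
  have el : s n * l = s n.+1 * l + s n.+1 * l by rewrite sS mulrDl.
  set dw := s n.+1 * w in sw0 ew *; set dl := s n.+1 * l in sl0 el *.
  have ek : k * s n ^+ 2 = 4 * (k * s n.+1 ^+ 2) by rewrite sS; ring.
  set kk := k * s n.+1 ^+ 2 in ek *.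
  rewrite ek ew el in h5; rewrite ew in h2; rewrite el in h4.
  rewrite !addrA in h2 h4 h5.
  have e1 : a <= x + dw by clear -h1 sw0; lra.
  have e2 : x <= x + dw by clear -sw0; lra.
  have e3 : x + dw <= x + dw + dw by clear -sw0; lra.
  have e4 : x + dw <= b by clear -h2 e3; lra.
  have f1 : c <= y + dl by clear -h3 sl0; lra.
  have f2 : y <= y + dl by clear -sl0; lra.
  have f3 : y + dl <= y + dl + dl by clear -sl0; lra.
  have f4 : y + dl <= d by clear -h4 f3; lra.
  have f5 : y <= y + dl + dl by exact: le_trans f2 f3.
  rewrite (hx x (x + dw)) // (hy x (x + dw) y (y + dl)) // in h5.
  rewrite (hy (x + dw) (x + dw + dw) y (y + dl)) // in h5.
  rewrite /P /Q /= -/dw -/dl -/kk ew el !addrA.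
  case: (quarter_norm h5) => g.
  - by exists (x, y).
  - by exists (x, y + dl).
  - by exists (x + dw, y).
  - by exists (x + dw, y + dl).
have [st hst] := choice step.
pose u := fix u n := if n is m.+1 then st (m, u m) else (a, c).
have Pu n : P n (u n).
  elim: n => [|n IH] /=; last by have [] := hst (n, u n) IH.
  by rewrite /P /= /s expr0 expr1n !mul1r mulr1 /w /l !subrKC !lexx.
have Qu n : Q n (u n) (u n.+1) by have [] := hst (n, u n) (Pu n).
have mono m n : (m <= n)%N -> [/\ (u m).1 <= (u n).1,
    (u n).1 + s n * w <= (u m).1 + s m * w, (u m).2 <= (u n).2 &
    (u n).2 + s n * l <= (u m).2 + s m * l].
  move=> /subnK <-; elim: (n - m)%N => [|i [i1 i2 i3 i4]]; first by rewrite add0n.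
  rewrite addSn; have [j1 j2 j3 j4] := Qu (i + m)%N; split.
  - exact: le_trans j1.
  - exact: le_trans j2 _.
  - exact: le_trans j3.
  - exact: le_trans j4 _.
have sw n : 0 <= s n * w by rewrite mulr_ge0 // ltW.
have sl n : 0 <= s n * l by rewrite mulr_ge0 // ltW.
have cross m n : (u m).1 <= (u n).1 + s n * w /\ (u m).2 <= (u n).2 + s n * l.
  have [m1 m2 m3 m4] := mono m (maxn m n) (leq_maxl _ _).
  have [n1 n2 n3 n4] := mono n (maxn m n) (leq_maxr _ _).
  have := sw (maxn m n); have := sl (maxn m n).
  by clear -m1 m3 n2 n4; split; lra.
pose X := [set (u n).1 | n in [set: nat]]; pose Y := [set (u n).2 | n in [set: nat]].
have X0 : X !=set0 by exists (u 0%N).1, 0%N.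
have Y0 : Y !=set0 by exists (u 0%N).2, 0%N.
have ubX n : ubound X ((u n).1 + s n * w) by move=> _ [m _ <-]; have [] := cross m n.
have ubY n : ubound Y ((u n).2 + s n * l) by move=> _ [m _ <-]; have [] := cross m n.
have hX : has_sup X by split=> //; exists ((u 0%N).1 + s 0%N * w).
have hY : has_sup Y by split=> //; exists ((u 0%N).2 + s 0%N * l).
have p1 n : (u n).1 <= sup X by apply: sup_upper_bound => //; exists n.
have q1 n : (u n).2 <= sup Y by apply: sup_upper_bound => //; exists n.
have p2 n : sup X <= (u n).1 + s n * w by apply: ge_sup.
have q2 n : sup Y <= (u n).2 + s n * l by apply: ge_sup.
have e0 : 0 < k / 2 by rewrite divr_gt0.
have [||t t0 ht] := hloc (sup X) (sup Y) _ _ _ e0.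
- have [h1 h2 h3 h4 _] := Pu 0%N; apply/andP; split.
    exact: le_trans (p1 0%N).
  exact: le_trans (p2 0%N) _.
- have [h1 h2 h3 h4 _] := Pu 0%N; apply/andP; split.
    exact: le_trans (q1 0%N).
  exact: le_trans (q2 0%N) _.
have [n nt] : exists n, s n < t.
  have h : (fun n => 2^-1 ^+ n : R) @ \oo --> (0 : R).
    by apply: cvg_expr; rewrite ger0_norm ?invr_ge0 // invf_lt1 // ltr1n.
  have /cvgrPdist_lt /(_ _ t0) [N _ hN] := h.
  exists N; have := hN N (leqnn N); rewrite /= sub0r normrN ger0_norm //.
have [h1 h2 h3 h4 h5] := Pu n.
have := ht (s n) _ _ (s0 n) nt h1 (p1 n) (p2 n) h2 h3 (q1 n) (q2 n) h4.
move=> /(le_trans h5); rewrite ler_pM2r ?exprn_gt0 // => h; clear -k0 h; lra.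
Qed.

End Bisection.

(** * Complex differentiability *)

Section ComplexDifferentiability.
Variable R : realType.
Local Notation C := (R[i]^o).
Implicit Types (f g : R[i] -> R[i]) (z w : R[i]).

(** Neighbourhoods are expressed with the real number [cmod]; the norm of the topology on the
    complex numbers is itself complex-valued. *)
Definition cnear z (P : R[i] -> Prop) :=
  exists2 d : R, 0 < d & forall w, cmod (w - z) < d -> P w.

Lemma cnearS z (P Q : R[i] -> Prop) : (forall w, P w -> Q w) -> cnear z P -> cnear z Q.
Proof. by move=> PQ [d d0 h]; exists d => // w /h /PQ. Qed.

Lemma cnearS2 z (P Q S : R[i] -> Prop) : (forall w, P w -> Q w -> S w) ->
  cnear z P -> cnear z Q -> cnear z S.
Proof.
move=> PQS [d d0 h] [e e0 k]; exists (Num.min d e); first by rewrite lt_min d0.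
by move=> w; rewrite lt_min => /andP[/h hp /k hq]; exact: PQS.
Qed.

Lemma cnearW z (P : R[i] -> Prop) : (forall w, P w) -> cnear z P.
Proof. by move=> h; exists 1. Qed.

Lemma cnear_self z (P : R[i] -> Prop) : cnear z P -> P z.
Proof. by move=> [d d0 h]; apply: h; rewrite subrr cmod0. Qed.

Definition ccont f z := {for z, continuous (f : C -> C)}.

Lemma ccont_cst k z : ccont (fun=> k) z.
Proof. exact: (@cvg_cst C k C (nbhs (z : C)) _). Qed.

Lemma ccont_id z : ccont id z.
Proof. exact: (@cvg_id C (nbhs (z : C))). Qed.

Arguments ccont_cst k z : clear implicits.
Arguments ccont_id z : clear implicits.

Lemma ccontD f g z : ccont f z -> ccont g z -> ccont (fun w => f w + g w) z.
Proof. by move=> cf cg; exact: (@cvgD _ C _ (nbhs (z : C)) _ f g _ _ cf cg). Qed.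

Lemma ccontN f z : ccont f z -> ccont (fun w => - f w) z.
Proof. by move=> cf; exact: (@cvgN _ C _ (nbhs (z : C)) _ f _ cf). Qed.

Lemma ccontM f g z : ccont f z -> ccont g z -> ccont (fun w => f w * g w) z.
Proof. by move=> cf cg; exact: (@cvgM R[i] _ (nbhs (z : C)) _ f g _ _ cf cg). Qed.

Lemma ccontV f z : f z != 0 -> ccont f z -> ccont (fun w => (f w)^-1) z.
Proof. by move=> f0 cf; exact: (@cvgV R[i] _ (nbhs (z : C)) _ f _ f0 cf). Qed.

Lemma ccont_comp f g z : ccont g z -> ccont f (g z) -> ccont (fun w => f (g w)) z.
Proof. by move=> cg cf; exact: (@continuous_comp _ _ _ (g : C -> C) (f : C -> C) z cg cf). Qed.

Lemma ccont_near f g z : cnear z (fun w => f w = g w) -> ccont f z -> ccont g z.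
Proof.
move=> fg cf; have e := cnear_self fg; apply/contC_P => t t0.
move/contC_P : cf => /(_ _ t0) hd; move: fg hd; apply: cnearS2 => w <-.
by rewrite e.
Qed.

Lemma ccont_neq0 f z : f z != 0 -> ccont f z -> cnear z (fun w => f w != 0).
Proof.
move=> fz /contC_P h.
have := h _ (etrans (cmod_gt0 _) fz); apply: cnearS => w; apply: contraTneq => ->.
by rewrite sub0r cmodN ltxx.
Qed.

(** Differentiability in the form of Caratheodory: the difference quotient extends continuously.
    Sums, products, inverses and composites are then settled by algebra on the witnesses. *)
Definition cdiff f z := exists2 phi : R[i] -> R[i], ccont phi z &
  cnear z (fun w => f w = f z + phi w * (w - z)).

Lemma cdiff_continuous f z : cdiff f z -> ccont f z.
Proof.
move=> [phi cphi h].
apply: (@ccont_near (fun w => f z + phi w * (w - z))); first by apply: cnearS h => w ->.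
exact: (ccontD (ccont_cst (f z) z) (ccontM cphi (ccontD (ccont_id z) (ccont_cst (- z) z)))).
Qed.

Lemma cdiff_near f g z : cnear z (fun w => f w = g w) -> cdiff f z -> cdiff g z.
Proof.
move=> fg [phi cphi h]; exists phi => //.
have fgz : f z = g z := cnear_self fg.
by apply: cnearS2 fg h => w <-; rewrite fgz.
Qed.

Lemma cdiff_cst k z : cdiff (fun=> k) z.
Proof.
exists (fun=> 0); first exact: ccont_cst.
by apply: cnearW => w; rewrite mul0r addr0.
Qed.

Lemma cdiff_id z : cdiff id z.
Proof.
exists (fun=> 1); first exact: ccont_cst.
by apply: cnearW => w; rewrite mul1r subrKC.
Qed.

Arguments cdiff_cst k z : clear implicits.
Arguments cdiff_id z : clear implicits.

Lemma cdiffD f g z : cdiff f z -> cdiff g z -> cdiff (fun w => f w + g w) z.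
Proof.
move=> [p cp hp] [q cq hq]; exists (fun w => p w + q w); first exact: (ccontD cp cq).
by apply: cnearS2 hp hq => w -> ->; ring.
Qed.

Lemma cdiffM f g z : cdiff f z -> cdiff g z -> cdiff (fun w => f w * g w) z.
Proof.
move=> df dg; have cg := cdiff_continuous dg.
case: df => p cp hp; case: dg => q cq hq.
exists (fun w => p w * g w + f z * q w).
  exact: (ccontD (ccontM cp cg) (ccontM (ccont_cst (f z) z) cq)).
by apply: cnearS2 hp hq => w -> ->; ring.
Qed.

Lemma cdiffN f z : cdiff f z -> cdiff (fun w => - f w) z.
Proof.
move=> [p cp hp]; exists (fun w => - p w); first exact: (ccontN cp).
by apply: cnearS hp => w ->; ring.
Qed.

Lemma cdiffX f z n : cdiff f z -> cdiff (fun w => f w ^+ n) z.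
Proof.
move=> df; elim: n => [|n IH]; first exact: cdiff_cst.
apply: (@cdiff_near (fun w => f w * f w ^+ n)); last exact: (cdiffM df IH).
by apply: cnearW => w; rewrite exprS.
Qed.

Lemma cdiffV f z : f z != 0 -> cdiff f z -> cdiff (fun w => (f w)^-1) z.
Proof.
move=> fz df; have cf := cdiff_continuous df; case: df => p cp hp.
exists (fun w => - (p w * (f w)^-1 * (f z)^-1)).
  exact: (ccontN (ccontM (ccontM cp (ccontV fz cf)) (ccont_cst (f z)^-1 z))).
apply: cnearS2 hp (ccont_neq0 fz cf) => w h fw.
have -> : p w * (f w)^-1 * (f z)^-1 = p w / (f w * f z) by rewrite invfM mulrA.
apply/eqP; rewrite -subr_eq0; apply/eqP.
have -> : (f w)^-1 - ((f z)^-1 + - (p w / (f w * f z)) * (w - z))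
   = ((f z + p w * (w - z)) - f w) / (f w * f z) by field; rewrite fw fz.
by rewrite -h subrr mul0r.
Qed.

Lemma cdiff_comp f g z : cdiff g z -> cdiff f (g z) -> cdiff (fun w => f (g w)) z.
Proof.
move=> dg; have cg := cdiff_continuous dg.
case: dg => q cq hq [p cp hp].
exists (fun w => p (g w) * q w).
  exact: (ccontM (ccont_comp cg cp) cq).
have hp' : cnear z (fun w => f (g w) = f (g z) + p (g w) * (g w - g z)).
  case: hp => d d0 hd; move/contC_P: cg => /(_ _ d0); apply: cnearS => w; exact: hd.
by apply: cnearS2 hp' hq => w -> ->; ring.
Qed.

Lemma cdiff_eps f z L :
  (forall e : R, 0 < e -> exists2 d : R, 0 < d & forall h, cmod h < d ->
     cmod (f (z + h) - f z - L * h) <= e * cmod h) -> cdiff f z.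
Proof.
move=> H.
pose phi w := if w == z then L else (f w - f z) / (w - z).
exists phi; last first.
  apply: cnearW => w; rewrite /phi; have [->|wz] := eqVneq w z; first by rewrite subrr mulr0 addr0.
  by rewrite divfK ?subrKC // subr_eq0.
apply/contC_P => e e0; have e2 : 0 < e / 2 by rewrite divr_gt0.
have [d d0 hd] := H _ e2; exists d => // w wz.
rewrite /phi eqxx; have [_|nwz] := eqVneq w z; first by rewrite subrr cmod0.
have h0 : w - z != 0 by rewrite subr_eq0.
have := hd _ wz; rewrite subrKC => h.
have -> : (f w - f z) / (w - z) - L = (f w - f z - L * (w - z)) / (w - z) by field.
rewrite cmodM cmodV ltr_pdivrMr ?cmod_gt0 //; apply: le_lt_trans h _.
by rewrite ltr_pM2r ?cmod_gt0 // ltr_pdivrMr // ltr_pMr // ltr1n.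
Qed.

Lemma derivable_cdiff f z : derivable (f : C -> C) (z : C) (1 : C) -> cdiff f z.
Proof.
move=> /cvg_ex [/= L /cvgC_P H].
apply: (@cdiff_eps _ _ L) => e e0.
have := H _ e0; rewrite near_withinE => /nbhsC_P [d d0 hd].
exists d => // h hlt; have [->|h0] := eqVneq h 0.
  by rewrite addr0 subrr mulr0 subr0 cmod0 mulr0.
have := hd h; rewrite subr0 => /(_ hlt h0) /ltW.
have -> : h^-1 *: (f (h *: (1 : C) + z) - f z) - L = (f (z + h) - f z - L * h) / h.
  by rewrite /GRing.scale /= mulr1 (addrC h); field.
by rewrite cmodM cmodV ler_pdivrMr ?cmod_gt0.
Qed.

End ComplexDifferentiability.

Arguments ccont_cst {R} k z.
Arguments ccont_id {R} z.
Arguments cdiff_cst {R} k z.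
Arguments cdiff_id {R} z.

(** * The theorem of Goursat and row means of periodic functions *)

Section Goursat.
Variable R : realType.
Implicit Types (G : R[i] -> R[i]).

Lemma contRP (f : R^o -> R^o) (x : R) : {for x, continuous f} <->
  forall e : R, 0 < e -> exists2 d : R, 0 < d & forall t, `|t - x| < d -> `|f t - f x| < e.
Proof.
split=> [h e e0|h].
  have /(_ e e0) := (proj1 (@cvgrPdist_lt _ _ _ (nbhs (x : R^o)) (nbhs_filter (x : R^o)) f (f x))) h.
  move=> [d /= d0 hd]; exists d => // t tx; rewrite distrC; apply: hd.
  by rewrite /= distrC.
apply: (proj2 (@cvgrPdist_lt _ _ _ (nbhs (x : R^o)) (nbhs_filter (x : R^o)) f (f x))) => e e0.
have [d d0 hd] := h e e0; exists d => //= t; rewrite /= distrC => /hd.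
by rewrite distrC.
Qed.

Lemma cont_path G (p : R -> R[i]) x : (forall s t, cmod (p s - p t) <= `|s - t|) ->
  ccont G (p x) -> {for x, continuous (fun t : R^o => complex.Re (G (p t)) : R^o)} /\
    {for x, continuous (fun t : R^o => complex.Im (G (p t)) : R^o)}.
Proof.
move=> hp /contC_P h; split; apply/contRP => e e0; have [d d0 hd] := h e e0;
  exists d => // t tx; have /hd := le_lt_trans (hp t x) tx; apply: le_lt_trans.
  by rewrite -cReN -cReD le_Re_cmod.
by rewrite -cImN -cImD le_Im_cmod.
Qed.

Lemma row_dist (y s t : R) : cmod ((s +i* y) - (t +i* y)) <= `|s - t|.
Proof. by apply: le_trans (cmod_le_ReIm _) _; rewrite /= subrr normr0 addr0. Qed.

Lemma col_dist (x s t : R) : cmod ((x +i* s) - (x +i* t)) <= `|s - t|.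
Proof. by apply: le_trans (cmod_le_ReIm _) _; rewrite /= subrr normr0 add0r. Qed.

Lemma cont_row G y a b : (forall x, a <= x <= b -> ccont G (x +i* y)) ->
  cont_on a b (fun x => complex.Re (G (x +i* y))) /\
  cont_on a b (fun x => complex.Im (G (x +i* y))).
Proof.
by move=> h; split=> x /h /(@cont_path G (fun t => t +i* y) x (row_dist y)) [].
Qed.

Lemma cont_col G x a b : (forall y, a <= y <= b -> ccont G (x +i* y)) ->
  cont_on a b (fun y => complex.Re (G (x +i* y))) /\
  cont_on a b (fun y => complex.Im (G (x +i* y))).
Proof.
by move=> h; split=> y /h /(@cont_path G (fun t => x +i* t) y (col_dist x)) [].
Qed.

(** The real part of the integral of [G] along the boundary of a rectangle, run through
    counterclockwise; on vertical sides dz = i dy turns real parts into imaginary ones. *)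
Definition rect_int G x1 x2 y1 y2 : R :=
  cint x1 x2 (fun x => complex.Re (G (x +i* y1)))
  - cint x1 x2 (fun x => complex.Re (G (x +i* y2)))
  - cint y1 y2 (fun y => complex.Im (G (x2 +i* y)))
  + cint y1 y2 (fun y => complex.Im (G (x1 +i* y))).

Definition rect_cont G a b c d := forall x y, a <= x <= b -> c <= y <= d ->
  ccont G (x +i* y).

Lemma rect_intB G H a b c d : a <= b -> c <= d -> rect_cont G a b c d -> rect_cont H a b c d ->
  rect_int (fun w => G w - H w) a b c d = rect_int G a b c d - rect_int H a b c d.
Proof.
move=> ab cd hG hH; rewrite /rect_int.
have rG y : c <= y <= d -> _ := fun h => @cont_row G y a b (fun x hx => hG x y hx h).
have rH y : c <= y <= d -> _ := fun h => @cont_row H y a b (fun x hx => hH x y hx h).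
have cG x : a <= x <= b -> _ := fun h => @cont_col G x c d (fun y hy => hG x y h hy).
have cH x : a <= x <= b -> _ := fun h => @cont_col H x c d (fun y hy => hH x y h hy).
have ca : a <= a <= b by rewrite lexx. have cb : a <= b <= b by rewrite lexx ab.
have cc : c <= c <= d by rewrite lexx. have cD : c <= d <= d by rewrite lexx cd.
have eR y : c <= y <= d -> cint a b (fun x => complex.Re (G (x +i* y) - H (x +i* y))) =
   cint a b (fun x => complex.Re (G (x +i* y))) - cint a b (fun x => complex.Re (H (x +i* y))).
  move=> hy; rewrite -cintB; [|exact: (rG y hy).1|exact: (rH y hy).1].
  by apply: eq_cint => x _; rewrite cReD cReN.
have eI x : a <= x <= b -> cint c d (fun y => complex.Im (G (x +i* y) - H (x +i* y))) =
   cint c d (fun y => complex.Im (G (x +i* y))) - cint c d (fun y => complex.Im (H (x +i* y))).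
  move=> hx; rewrite -cintB; [|exact: (cG x hx).2|exact: (cH x hx).2].
  by apply: eq_cint => y _; rewrite cImD cImN.
by rewrite !eR // !eI //; ring.
Qed.

Lemma rect_int_affine (A L : R[i]) a b c d : a <= b -> c <= d ->
  rect_int (fun w => A + L * w) a b c d = 0.
Proof.
move=> ab cd; rewrite /rect_int.
have eR y : cint a b (fun x => complex.Re (A + L * (x +i* y))) =
   (complex.Re A - complex.Im L * y) * (b - a) + complex.Re L * (b ^+ 2 - a ^+ 2) / 2.
  by rewrite -cint_affine //; apply: eq_cint => x _; rewrite cReD cReM /=; ring.
have eI x : cint c d (fun y => complex.Im (A + L * (x +i* y))) =
   (complex.Im A + complex.Im L * x) * (d - c) + complex.Re L * (d ^+ 2 - c ^+ 2) / 2.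
  by rewrite -cint_affine //; apply: eq_cint => y _; rewrite cImD cImM /=; ring.
by rewrite !eR !eI; ring.
Qed.

Lemma rect_int_bound G a b c d k : a <= b -> c <= d ->
  (forall x y, a <= x <= b -> c <= y <= d -> [|| x == a, x == b, y == c | y == d] ->
     ccont G (x +i* y) /\ cmod (G (x +i* y)) <= k) ->
  `|rect_int G a b c d| <= 2 * k * ((b - a) + (d - c)).
Proof.
move=> ab cd hG.
have ca : a <= a <= b by rewrite lexx. have cb : a <= b <= b by rewrite lexx ab.
have cc : c <= c <= d by rewrite lexx. have cD : c <= d <= d by rewrite lexx cd.
have bR y : c <= y <= d -> (y == c) || (y == d) ->
    `|cint a b (fun x => complex.Re (G (x +i* y)))| <= k * (b - a).
  move=> hy yb; apply: cint_bound => //.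
    by apply: (cont_row _).1 => x hx; apply: (hG _ _ hx hy _).1; rewrite yb !orbT.
  move=> x hx; apply: le_trans (le_Re_cmod _) (hG _ _ hx hy _).2.
  by rewrite yb !orbT.
have bI x : a <= x <= b -> (x == a) || (x == b) ->
    `|cint c d (fun y => complex.Im (G (x +i* y)))| <= k * (d - c).
  move=> hx xb; have hb y : [|| x == a, x == b, y == c | y == d] by rewrite orbA xb.
  apply: cint_bound => //; first by apply: (cont_col _).2 => y hy; apply: (hG _ _ hx hy _).1.
  by move=> y hy; apply: le_trans (le_Im_cmod _) (hG _ _ hx hy _).2.
rewrite /rect_int.
have := bR _ cc; have := bR _ cD; have := bI _ ca; have := bI _ cb.
rewrite !eqxx ?orbT => /(_ isT) + /(_ isT) + /(_ isT) + /(_ isT).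
set A := cint _ _ _; set B := cint _ _ _; set D := cint _ _ _; set E := cint _ _ _.
rewrite !ler_norml => /andP[? ?] /andP[? ?] /andP[? ?] /andP[? ?].
by apply/andP; split; lra.
Qed.

Lemma rect_int_splitx G a x b c d : a <= x -> x <= b ->
  (forall t, a <= t <= b -> ccont G (t +i* c) /\ ccont G (t +i* d)) ->
  rect_int G a b c d = rect_int G a x c d + rect_int G x b c d.
Proof.
move=> ax xb h; rewrite /rect_int.
have e y : (y == c) || (y == d) -> cint a b (fun x => complex.Re (G (x +i* y))) =
    cint a x (fun x => complex.Re (G (x +i* y))) + cint x b (fun x => complex.Re (G (x +i* y))).
  move=> yb; apply: cint_split => //; apply: (cont_row _).1 => t /h [hc hd].
  by case/orP: yb => /eqP ->.
by rewrite !e ?eqxx ?orbT //; ring.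
Qed.

Lemma rect_int_splity G a b c y d : c <= y -> y <= d ->
  (forall t, c <= t <= d -> ccont G (a +i* t) /\ ccont G (b +i* t)) ->
  rect_int G a b c d = rect_int G a b c y + rect_int G a b y d.
Proof.
move=> cy yd h; rewrite /rect_int.
have e x : (x == a) || (x == b) -> cint c d (fun y => complex.Im (G (x +i* y))) =
    cint c y (fun y => complex.Im (G (x +i* y))) + cint y d (fun y => complex.Im (G (x +i* y))).
  move=> xb; apply: cint_split => //; apply: (cont_col _).2 => t /h [ha hb].
  by case/orP: xb => /eqP ->.
by rewrite !e ?eqxx ?orbT //; ring.
Qed.

(** Near a point, [G] differs by little o of the distance from an affine function, whose integral
    vanishes by [rect_int_affine]; [rect_null] does the bisection. *)
Theorem goursat G a b c d : a <= b -> c <= d ->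
  (forall x y, a <= x <= b -> c <= y <= d -> cdiff G (x +i* y)) ->
  rect_int G a b c d = 0.
Proof.
move=> ab cd hG.
have cG : rect_cont G a b c d by move=> x y hx hy; apply: cdiff_continuous; exact: hG.
apply: (@rect_null _ (rect_int G)) => //.
- move=> x1 x x2 y1 y2 h1 h2 h3 h4 h5 h6 h7.
  by apply: rect_int_splitx => // t /andP[t1 t2]; split; apply: cG; apply/andP; split; lra.
- move=> x1 x2 y1 y y2 h1 h2 h3 h4 h5 h6 h7.
  by apply: rect_int_splity => // t /andP[t1 t2]; split; apply: cG; apply/andP; split; lra.
move=> p q hp hq e e0; have [phi cphi hphi] := hG p q hp hq.
pose m := (b - a) + (d - c).
have m0 : 0 <= m by rewrite /m; lra.
pose e' := e / (2 * (m + 1) ^+ 2).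
have e'0 : 0 < e' by rewrite divr_gt0 // mulr_gt0 // exprn_gt0 //; lra.
have /contC_P /(_ _ e'0) [t1 t10 ht1] := cphi.
move: hphi => [t2 t20 ht2].
pose t := Num.min t1 t2 / (m + 1).
have t0 : 0 < t by rewrite divr_gt0 ?lt_min ?t10 //; lra.
exists t => // s x y s0 st h1 h2 h3 h4 h5 h6 h7 h8.
set x2 := x + s * (b - a); set y2 := y + s * (d - c).
have xx2 : x <= x2 by rewrite lerDl mulr_ge0 ?subr_ge0 // ltW.
have yy2 : y <= y2 by rewrite lerDl mulr_ge0 ?subr_ge0 // ltW.
pose A w := (G (p +i* q) - phi (p +i* q) * (p +i* q)) + phi (p +i* q) * w.
have cA : rect_cont A x x2 y y2.
  move=> u v _ _; apply: cdiff_continuous.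
  exact: (cdiffD (cdiff_cst (G (p +i* q) - phi (p +i* q) * (p +i* q)) _)
    (cdiffM (cdiff_cst (phi (p +i* q)) _) (cdiff_id _))).
have cG' : rect_cont G x x2 y y2.
  move=> u v /andP[u1 u2] /andP[v1 v2]; apply: cG.
    by rewrite (le_trans h1 u1) (le_trans u2 h4).
  by rewrite (le_trans h5 v1) (le_trans v2 h8).
have <- : rect_int (fun w => G w - A w) x x2 y y2 = rect_int G x x2 y y2.
  by rewrite rect_intB // rect_int_affine // subr0.
have sm : s * m < Num.min t1 t2.
  apply: le_lt_trans (_ : s * (m + 1) < _); last by rewrite -ltr_pdivlMr //; lra.
  by rewrite ler_pM2l //; lra.
move: (sm); rewrite lt_min => /andP[sm1 sm2].
apply: (@le_trans _ _ (2 * (e' * (s * m)) * ((x2 - x) + (y2 - y)))).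
  apply: (@rect_int_bound (fun w => G w - A w)); [exact: xx2|exact: yy2|].
  move=> u v hu hv _; split; first exact: (ccontD (cG' u v hu hv) (ccontN (cA u v hu hv))).
  case/andP: hu => u1 u2; case/andP: hv => v1 v2.
  have duv : cmod ((u +i* v) - (p +i* q)) <= s * m.
    have := cmod_le_ReIm ((u +i* v) - (p +i* q)) => /= /le_trans; apply.
    have -> : s * m = (x2 - x) + (y2 - y) by rewrite /m /x2 /y2; ring.
    rewrite -/x2 -/y2 in h3 h7; clear -u1 u2 v1 v2 h2 h3 h6 h7.
    by apply: lerD; rewrite ler_norml; apply/andP; split; lra.
  have -> : G (u +i* v) - A (u +i* v) =
     (phi (u +i* v) - phi (p +i* q)) * ((u +i* v) - (p +i* q)).
    by rewrite ht2 ?(le_lt_trans duv) // /A; ring.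
  rewrite cmodM ler_pM ?cmod_ge0 // ltW // ht1 //.
  exact: le_lt_trans duv _.
have -> : x2 - x + (y2 - y) = s * m by rewrite /x2 /y2 /m; ring.
have -> : 2 * (e' * (s * m)) * (s * m) = e * s ^+ 2 * (m ^+ 2 / (m + 1) ^+ 2).
  by rewrite /e'; field; lra.
rewrite ler_piMr //; first by rewrite mulr_ge0 ?ltW // exprn_gt0.
rewrite ler_pdivrMr ?mul1r ?exprn_gt0 ?ler_pXn2r ?nnegrE //; lra.
Qed.

(** A puncture near which the function stays bounded is harmless: only the integral round a
    small square about it survives the subdivision, and that one tends to 0 with the square. *)
Lemma goursat_puncture G a b c d x0 y0 k e0 : a < x0 -> x0 < b -> c < y0 -> y0 < d -> 0 < e0 ->
  (forall x y, a <= x <= b -> c <= y <= d -> (x != x0) || (y != y0) -> cdiff G (x +i* y)) ->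
  (forall w, w != (x0 +i* y0) -> cmod (w - (x0 +i* y0)) < e0 -> cmod (G w) <= k) ->
  rect_int G a b c d = 0.
Proof.
move=> ax xb cy yd e00 dG bG.
have cG x y : a <= x <= b -> c <= y <= d -> (x != x0) || (y != y0) -> ccont G (x +i* y).
  by move=> hx hy h; apply: cdiff_continuous; exact: dG.
have k0 : 0 <= k.
  apply: le_trans (cmod_ge0 (G ((x0 + e0 / 2) +i* y0))) (bG _ _ _).
    apply/eqP => -[/eqP]; rewrite -subr_eq0 addrAC subrr add0r => /eqP; lra.
  apply: le_lt_trans (cmod_le_ReIm _) _ => /=.
  by rewrite subrr normr0 addr0 addrAC subrr add0r ger0_norm; lra.
have small e : 0 < e -> e <= x0 - a -> e <= b - x0 -> e <= y0 - c -> e <= d - y0 -> 2 * e < e0 ->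
    `|rect_int G a b c d| <= 8 * k * e.
  move=> ep h1 h2 h3 h4 h5.
  set x1 := x0 - e; set x2 := x0 + e; set y1 := y0 - e; set y2 := y0 + e.
  have n1 : x1 != x0 by rewrite /x1; apply/eqP; lra.
  have n2 : x2 != x0 by rewrite /x2; apply/eqP; lra.
  have n3 : y1 != y0 by rewrite /y1; apply/eqP; lra.
  have n4 : y2 != y0 by rewrite /y2; apply/eqP; lra.
  have i1 : a <= x1 by rewrite /x1; lra. have i2 : x1 <= x2 by rewrite /x1 /x2; lra.
  have i3 : x2 <= b by rewrite /x2; lra. have j1 : c <= y1 by rewrite /y1; lra.
  have j2 : y1 <= y2 by rewrite /y1 /y2; lra. have j3 : y2 <= d by rewrite /y2; lra.
  have [na nb] : a != x0 /\ b != x0 by split; apply/eqP; lra.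
  have [nc nd] : c != y0 /\ d != y0 by split; apply/eqP; lra.
  have lx : x1 < x0 < x2 by rewrite /x1 /x2; lra.
  have ly : y1 < y0 < y2 by rewrite /y1 /y2; lra.
  have [bx1 bx2] : x0 - e <= x1 /\ x2 <= x0 + e by [].
  have [by1 by2] : y0 - e <= y1 /\ y2 <= y0 + e by [].
  clearbody x1 x2 y1 y2.
  have zero p q r s : a <= p -> p <= q -> q <= b -> c <= r -> r <= s -> s <= d ->
      [|| q < x0, x0 < p, s < y0 | y0 < r] -> rect_int G p q r s = 0.
    move=> u1 u2 u3 u4 u5 u6 out; apply: goursat => // x y /andP[v1 v2] /andP[w1 w2].
    apply: dG.
    - by rewrite (le_trans u1 v1) (le_trans v2 u3).
    - by rewrite (le_trans u4 w1) (le_trans w2 u6).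
    - case/or4P: out => o.
      + by rewrite (lt_eqF (le_lt_trans v2 o)).
      + by rewrite (gt_eqF (lt_le_trans o v1)).
      + by rewrite (lt_eqF (le_lt_trans w2 o)) orbT.
      + by rewrite (gt_eqF (lt_le_trans o w1)) orbT.
  have hrow y : c <= y <= d -> y != y0 -> forall t, a <= t <= b -> ccont G (t +i* y).
    by move=> hy ny t ht; apply: cG => //; rewrite ny orbT.
  have hcol x : a <= x <= b -> x != x0 -> forall t, c <= t <= d -> ccont G (x +i* t).
    by move=> hx nx t ht; apply: cG => //; rewrite nx.
  case/andP: lx => lx1 lx2; case/andP: ly => ly1 ly2.
  have x1b := le_trans i2 i3; have y1d := le_trans j2 j3; have cd := le_trans j1 y1d.
  have cc : c <= c <= d by rewrite lexx.
  have dd : c <= d <= d by rewrite lexx cd.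
  have hx1 : a <= x1 <= b by rewrite i1.
  have hx2 : a <= x2 <= b by rewrite (le_trans i1 i2).
  rewrite (@rect_int_splitx G a x1) //; last by move=> t ht; split; apply: hrow.
  rewrite (@zero a x1 c d) ?lx1 ?add0r //.
  rewrite (@rect_int_splitx G x1 x2) //; last first.
    by move=> t /andP[t1 t2]; split; apply: hrow => //; rewrite (le_trans i1 t1).
  rewrite (@zero x2 b c d) ?lx2 ?orbT ?addr0 // ?(le_trans i1 i2) //.
  rewrite (@rect_int_splity G x1 x2 c y1) //; last by move=> t ht; split; apply: hcol.
  rewrite (@zero x1 x2 c y1) ?ly1 ?orbT ?add0r //.
  rewrite (@rect_int_splity G x1 x2 y1 y2) //; last first.
    by move=> t /andP[t1 t2]; split; apply: hcol => //; rewrite (le_trans j1 t1).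
  rewrite (@zero x1 x2 y2 d) ?ly2 ?orbT ?addr0 // ?(le_trans j1 j2) //.
  apply: (@le_trans _ _ (2 * k * ((x2 - x1) + (y2 - y1)))).
    apply: rect_int_bound => // x y /andP[u1 u2] /andP[v1 v2] bdry.
    have ne : (x != x0) || (y != y0).
      case/or4P: bdry => /eqP ->; first by rewrite n1.
      - by rewrite n2.
      - by rewrite n3 orbT.
      - by rewrite n4 orbT.
    split.
      apply: cG => //; first by rewrite (le_trans i1 u1) (le_trans u2 i3).
      by rewrite (le_trans j1 v1) (le_trans v2 j3).
    apply: bG.
      apply/eqP => -[ex ey]; move: ne; by rewrite ex ey !eqxx.
    have := cmod_le_ReIm ((x +i* y) - (x0 +i* y0)) => /= /le_lt_trans; apply.
    apply: le_lt_trans h5; clear -u1 u2 v1 v2 bx1 bx2 by1 by2.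
    have -> : 2 * e = e + e by ring.
    by apply: lerD; rewrite ler_norml; apply/andP; split; lra.
  have -> : 8 * k * e = 2 * k * (4 * e) by ring.
  by rewrite ler_wpM2l ?mulr_ge0 //; clear -bx1 bx2 by1 by2; lra.
apply/eqP; rewrite -normr_eq0; apply/eqP/le_anti; rewrite normr_ge0 andbT leNgt.
apply/negP => I0; set I := `|_| in small I0.
have k16 : 0 < 16 * (k + 1) by rewrite mulr_gt0 //; lra.
pose e := Num.min (Num.min (Num.min (x0 - a) (b - x0)) (Num.min (y0 - c) (d - y0)))
  (Num.min (e0 / 4) (I / (16 * (k + 1)))).
have [h1 h2 h3 h4] : [/\ e <= x0 - a, e <= b - x0, e <= y0 - c & e <= d - y0].
  by split; rewrite /e !ge_min lexx ?orbT.
have h5 : e <= e0 / 4 by rewrite /e !ge_min lexx ?orbT.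
have h6 : e <= I / (16 * (k + 1)) by rewrite /e !ge_min lexx ?orbT.
have ep : 0 < e by rewrite /e !lt_min !subr_gt0 ax xb cy yd !divr_gt0.
clearbody e.
have := small e ep h1 h2 h3 h4 ltac:(lra).
have : 8 * k * e <= 8 * (k + 1) * (I / (16 * (k + 1))).
  by apply: ler_pM => //; rewrite ?mulr_ge0 ?(ltW ep) //; lra.
have -> : 8 * (k + 1) * (I / (16 * (k + 1))) = I / 2 by field; lra.
by clear -I0; lra.
Qed.

(** Cauchy for a horizontal period: the two vertical sides of the rectangle cancel. *)
Lemma rect_int_period G a y1 y2 : y1 <= y2 ->
  (forall y, y1 <= y <= y2 -> G ((a + 1) +i* y) = G (a +i* y)) ->
  rect_int G a (a + 1) y1 y2 = cint a (a + 1) (fun x => complex.Re (G (x +i* y1)))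
    - cint a (a + 1) (fun x => complex.Re (G (x +i* y2))).
Proof.
move=> y12 pG; rewrite /rect_int (_ : cint _ _ (fun y => complex.Im (G ((a + 1) +i* y))) =
   cint y1 y2 (fun y => complex.Im (G (a +i* y)))); first by rewrite addrNK.
by apply: eq_cint => y hy; rewrite pG.
Qed.

(** The mean over a period is the zeroth Fourier coefficient of [G], and the zeroth Fourier mode
    does not depend on the height. *)
Lemma row_mean_Re G a b1 b2 :
  (forall w, b1 < complex.Im w -> complex.Im w < b2 -> cdiff G w) ->
  (forall w, b1 < complex.Im w -> complex.Im w < b2 -> G (w + 1) = G w) ->
  forall y1 y2, b1 < y1 -> y1 < b2 -> b1 < y2 -> y2 < b2 ->
  cint a (a + 1) (fun x => complex.Re (G (x +i* y1))) =
  cint a (a + 1) (fun x => complex.Re (G (x +i* y2))).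
Proof.
move=> dG pG.
suff H y1 y2 : b1 < y1 -> y1 <= y2 -> y2 < b2 ->
  cint a (a + 1) (fun x => complex.Re (G (x +i* y1))) =
  cint a (a + 1) (fun x => complex.Re (G (x +i* y2))).
  move=> y1 y2 h1 h2 h3 h4; have [h|h] := leP y1 y2; first exact: H.
  by symmetry; apply: H => //; exact: ltW.
move=> h1 h12 h2.
have inb y : y1 <= y <= y2 -> b1 < y /\ y < b2.
  by move=> /andP[? ?]; split; [exact: lt_le_trans h1 _|exact: le_lt_trans h2].
have : rect_int G a (a + 1) y1 y2 = 0.
  by apply: goursat => //; [rewrite lerDl|move=> x y _ /inb [? ?]; exact: dG].
rewrite rect_int_period // => [/eqP|y /inb [? ?]]; first by rewrite subr_eq0 => /eqP.
rewrite -[in RHS]pG //; congr (G _); apply: ReIm_eq; rewrite /= ?addr0 //.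
Qed.

End Goursat.

(** * The exponential and mean values on circles *)

Section ComplexExponential.
Variable R : realType.
Implicit Types (z w : R[i]).

Definition cexp z : R[i] :=
  (expR (complex.Re z) * cos (complex.Im z)) +i* (expR (complex.Re z) * sin (complex.Im z)).

Lemma cexpD z w : cexp (z + w) = cexp z * cexp w.
Proof.
by apply: ReIm_eq; rewrite ?cReM ?cImM /= cReD cImD expRD ?cosD ?sinD; ring.
Qed.

Lemma cmod_cexp z : cmod (cexp z) = expR (complex.Re z).
Proof.
apply: (@pexpIrn _ 2) => //; rewrite ?nnegrE ?cmod_ge0 ?expR_ge0 //.
by rewrite cmod_sqr /= !exprMn -mulrDr cos2Dsin2 mulr1.
Qed.

Lemma deriv0_eps (f : R -> R) (l : R) : is_derive (0 : R) (1 : R) f l ->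
  forall e : R, 0 < e -> exists2 d : R, 0 < d & forall h, `|h| < d ->
    `|f h - f 0 - l * h| <= e * `|h|.
Proof.
move=> [df <-] e e0.
have : (fun h : R => h^-1 *: (f (h *: (1 : R) + 0) - f 0)) @ 0^' --> 'D_1 f (0 : R).
  exact: df.
move/cvgrPdist_lt => /(_ e e0) [d /= d0 hd]; exists d => // h hlt.
have [->|h0] := eqVneq h 0; first by rewrite subrr mulr0 subrr normr0 mulr0.
have /= := hd h; rewrite sub0r normrN => /(_ hlt h0) /ltW.
rewrite /GRing.scale /= mulr1 addr0.
have -> : f h - f 0 - 'D_1 f 0 * h = - ('D_1 f 0 - h^-1 * (f h - f 0)) * h by field.
by rewrite normrM normrN => H; rewrite ler_wpM2r.
Qed.

(** By [cexpD] the derivative at 0 is the only one to compute. *)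
Lemma cexp_near0 (e : R) : 0 < e -> exists2 d : R, 0 < d & forall h : R[i], cmod h < d ->
  cmod (cexp h - 1 - h) <= e * cmod h.
Proof.
move=> e0.
have [e1 [e10 e11 e18]] : exists e1 : R, [/\ 0 < e1, e1 <= 1 & e1 <= e / 8].
  exists (Num.min (e / 8) 1); split; rewrite ?ge_min ?lexx ?orbT //.
  by rewrite lt_min ltr01 andbT divr_gt0.
have dexp : is_derive (0 : R) (1 : R) (@expR R) 1.
  by have := is_derive_expR (0 : R); rewrite expR0.
have dcos : is_derive (0 : R) (1 : R) (@cos R) 0.
  by have := is_derive_cos (0 : R); rewrite sin0 oppr0.
have dsin : is_derive (0 : R) (1 : R) (@sin R) 1.
  by have := is_derive_sin (0 : R); rewrite cos0.
have [d1 d10 h1] := deriv0_eps dexp e10.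
have [d2 d20 h2] := deriv0_eps dcos e10.
have [d3 d30 h3] := deriv0_eps dsin e10.
pose d := Num.min (Num.min d1 d2) (Num.min d3 e1).
exists d; first by rewrite !lt_min d10 d20 d30 e10.
case=> x y hlt; rewrite !lt_min in hlt; case/andP: hlt => /andP[l1 l2] /andP[l3 l4].
set m := cmod (x +i* y) in l1 l2 l3 l4 *.
have xm : `|x| <= m := le_Re_cmod (x +i* y).
have ym : `|y| <= m := le_Im_cmod (x +i* y).
have := h1 x (le_lt_trans xm l1); have := h2 y (le_lt_trans ym l2); have := h3 y (le_lt_trans ym l3).
rewrite expR0 cos0 sin0 mul0r !mul1r !subr0.
set A := sin y - y; set B := cos y - 1; set D := expR x - 1 - x => hA hB hD.
have m0 : 0 <= m := cmod_ge0 _.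
have bA : `|A| <= e1 * m by apply: le_trans hA _; rewrite ler_pM2l.
have bB : `|B| <= e1 * m by apply: le_trans hB _; rewrite ler_pM2l.
have bD : `|D| <= e1 * m by apply: le_trans hD _; rewrite ler_pM2l.
have m1 : m <= 1 by apply: le_trans (ltW l4) _.
have em : e1 * m <= m by rewrite ler_piMl.
have cosle : `|cos y| <= 1 by rewrite ler_norml cos_geN1 cos_le1.
have sinle : `|sin y| <= 2 * m.
  have -> : sin y = A + y by rewrite /A subrK.
  by apply: le_trans (ler_normD _ _) _; lra.
have ex : `|expR x - 1| <= 2 * m.
  have -> : expR x - 1 = D + x by rewrite /D subrK.
  by apply: le_trans (ler_normD _ _) _; lra.
apply: le_trans (cmod_le_ReIm _) _ => /=.
have -> : expR x * cos y - 1 - x = D * cos y + (1 + x) * B by rewrite /D /B; ring.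
have -> : expR x * sin y - 0 - y = (expR x - 1) * sin y + A by rewrite /A; ring.
have i1 : `|D * cos y| <= e1 * m.
  by rewrite normrM -[leRHS]mulr1 ler_pM.
have i2 : `|(1 + x) * B| <= 2 * (e1 * m).
  rewrite normrM ler_pM //; apply: le_trans (ler_normD _ _) _; rewrite normr1; lra.
have i3 : `|(expR x - 1) * sin y| <= 4 * (e1 * m).
  rewrite normrM; apply: le_trans (_ : (2 * m) * (2 * m) <= _); first by rewrite ler_pM.
  have -> : 2 * m * (2 * m) = 4 * (m * m) by ring.
  by rewrite ler_pM2l // ler_wpM2r // ltW.
have := ler_normD (D * cos y) ((1 + x) * B).
have := ler_normD ((expR x - 1) * sin y) A.
have : e1 * m <= e / 8 * m by rewrite ler_wpM2r.
lra.
Qed.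

Lemma cdiff_cexp z : cdiff cexp z.
Proof.
apply: (@cdiff_eps _ _ _ (cexp z)) => e e0.
have c0 : 0 < cmod (cexp z) by rewrite cmod_cexp expR_gt0.
have [d d0 hd] := cexp_near0 (divr_gt0 e0 c0).
exists d => // h /hd hh.
have -> : cexp (z + h) - cexp z - cexp z * h = cexp z * (cexp h - 1 - h).
  by rewrite cexpD; ring.
by rewrite cmodM -ler_pdivlMl // mulrA [X in _ <= X * _]mulrC.
Qed.

(** The nome exp(2 pi i z). *)
Definition qexp z := cexp ((0 +i* (2 * pi)) * z).

Lemma qexpD z w : qexp (z + w) = qexp z * qexp w.
Proof. by rewrite /qexp mulrDr cexpD. Qed.

Lemma qexp1 : qexp 1 = 1.
Proof.
by apply: ReIm_eq; rewrite /qexp /cexp /= !mul0r !mulr0 !mulr1 subr0 expR0 !mul1r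
  add0r mulr_natl ?cos2pi ?sin2pi.
Qed.

Lemma qexp_period z : qexp (z + 1) = qexp z.
Proof. by rewrite qexpD qexp1 mulr1. Qed.

Lemma cmod_qexp z : cmod (qexp z) = expR (- (2 * pi * complex.Im z)).
Proof. by rewrite cmod_cexp cReM /= mul0r sub0r. Qed.

Lemma qexp_real (t : R) : qexp t%:C = cos (2 * pi * t) +i* sin (2 * pi * t).
Proof.
by rewrite /qexp /cexp /= !mul0r mulr0 subr0 expR0 !mul1r add0r.
Qed.

Lemma cdiff_qexp z : cdiff qexp z.
Proof.
apply: (@cdiff_comp _ cexp (fun z => (0 +i* (2 * pi)) * z)); last exact: cdiff_cexp.
exact: (cdiffM (cdiff_cst _ z) (cdiff_id z)).
Qed.

End ComplexExponential.

Section CircleMean.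
Variable R : realType.
Implicit Types (g : R[i] -> R[i]) (z w : R[i]).

Lemma cint01_near (f : R -> R) l e : cont_on 0 1 f ->
  (forall x, 0 <= x <= 1 -> `|f x - l| <= e) -> `|cint 0 1 f - l| <= e.
Proof.
move=> cf h.
have -> : cint 0 1 f - l = cint 0 1 (fun x => f x - l).
  rewrite (@cintB _ 0 1 f (fun=> l)) // ?cint_cst ?subr0 ?mulr1 //; exact: cont_on_cst.
rewrite -[leRHS]mulr1 -{2}[1]subr0; apply: cint_bound => //.
exact: (cont_onD cf (@cont_on_cst _ 0 1 (- l))).
Qed.

Lemma expRN_small (c d : R) : 0 <= c -> 0 < d -> exists2 y0 : R, 0 <= y0 &
  forall y, y0 <= y -> c * expR (- (2 * pi * y)) < d.
Proof.
move=> c0 d0; have p1 : 1 <= 2 * pi :> R by have := @pi_ge2 R; lra.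
exists (c / d); first by rewrite divr_ge0 // ltW.
move=> y hy; rewrite expRN ltr_pdivrMr ?expR_gt0 // mulrC -ltr_pdivrMr //.
apply: le_lt_trans hy _; have y0 : 0 <= y \/ y < 0 by case: (leP 0 y); auto.
case: y0 => y0; last by apply: lt_trans y0 (expR_gt0 _).
have := expR_ge1Dx (2 * pi * y); have : y <= 2 * pi * y by rewrite ler_peMl.
lra.
Qed.

(** The function t |-> g (z q(t)), with q the nome, has period 1 and is holomorphic above a negative
    height; the circle is its row at height 0. Its row means do not depend on the height, and q
    tends to 0 high up. *)
Lemma circle_mean_Re g (r : R) z :
  (forall w, cmod w < r -> cdiff g w) -> cmod z < r ->
  cint 0 1 (fun t => complex.Re (g (z * qexp t%:C))) = complex.Re (g 0).
Proof.
move=> dg zr.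
have [->|z0] := eqVneq z 0.
  rewrite (_ : cint _ _ _ = cint 0 1 (fun=> complex.Re (g 0))).
    by rewrite cint_cst // subr0 mulr1.
  by apply: eq_cint => t _; rewrite mul0r.
have cz : 0 < cmod z by rewrite cmod_gt0.
have r0 : 0 < r := lt_trans cz zr.
pose G t := g (z * qexp t).
pose b := ln (cmod z / r) / (2 * pi) : R.
have p0 : 0 < 2 * pi :> R by rewrite mulr_gt0 // pi_gt0.
have b0 : b < 0.
  rewrite /b pmulr_llt0 ?invr_gt0 // ln_lt0 //; apply/andP; split; first exact: divr_gt0.
  by rewrite ltr_pdivrMr // mul1r.
have ins w : b < complex.Im w -> cmod (z * qexp w) < r.
  move=> bw; rewrite cmodM cmod_qexp expRN ltr_pdivrMr ?expR_gt0 // mulrC -ltr_pdivrMr //.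
  rewrite -ltr_ln ?posrE ?divr_gt0 ?expR_gt0 // expRK.
  by rewrite [ltRHS]mulrC -ltr_pdivrMr.
have dG w : b < complex.Im w -> cdiff G w.
  move=> bw; apply: (@cdiff_comp _ g (fun t => z * qexp t)).
    exact: (cdiffM (cdiff_cst z w) (cdiff_qexp w)).
  exact: dg (ins _ bw).
have pG w : G (w + 1) = G w by rewrite /G qexp_period.
have row y : 0 <= y -> cint 0 1 (fun x => complex.Re (G (x +i* 0))) =
   cint 0 1 (fun x => complex.Re (G (x +i* y))).
  move=> y0; rewrite -[X in cint _ X](add0r 1).
  apply: (@row_mean_Re _ G 0 b (y + 1)) => //; try by lra.
  by move=> w bw _; exact: dG.
apply/eqP; rewrite -subr_eq0 -normr_eq0; apply/eqP/le_anti; rewrite normr_ge0 andbT.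
apply/ler_addgt0Pl => e e0; rewrite addr0.
have /cdiff_continuous /contC_P /(_ _ e0) [d d0 hd] : cdiff g 0 by apply: dg; rewrite cmod0.
have [y y0 hy] := expRN_small (ltW cz) d0.
rewrite (row y) //; apply: cint01_near.
  apply: (cont_row _).1 => x _; apply: cdiff_continuous; apply: dG => /=; lra.
move=> x _; rewrite -cReN -cReD; apply: le_trans (le_Re_cmod _) _; apply/ltW/hd.
by rewrite subr0 cmodM cmod_qexp; apply: hy.
Qed.

Lemma cont_on_circle g (r : R) z :
  (forall w, cmod w < r -> cdiff g w) -> cmod z < r ->
  cont_on 0 1 (fun t => cmod (g (z * qexp t%:C))).
Proof.
move=> dg zr.
move=> t _.
have c1 : ccont (fun t => g (z * qexp t)) t%:C.
  apply: (@ccont_comp _ g (fun t => z * qexp t)).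
    exact: (ccontM (ccont_cst z _) (cdiff_continuous (cdiff_qexp _))).
  apply: cdiff_continuous; apply: dg; rewrite cmodM cmod_qexp /= mulr0 oppr0 expR0 mulr1 //.
move/contC_P: c1 => H; apply/contRP => e /H [d d0 hd]; exists d => // s st.
apply: le_lt_trans (cmod_dist _ _) (hd _ _).
exact: le_lt_trans (row_dist 0 s t) st.
Qed.

(** Applied to a rotated copy of [g], the mean value property bounds the modulus. *)
Lemma circle_mean_le g (r : R) z :
  (forall w, cmod w < r -> cdiff g w) -> cmod z < r ->
  cmod (g 0) <= cint 0 1 (fun t => cmod (g (z * qexp t%:C))).
Proof.
move=> dg zr.
have cp := cont_on_circle dg zr.
have [g0|g0] := eqVneq (g 0) 0.
  rewrite g0 cmod0 -[leLHS](_ : cint 0 1 (fun=> 0) = 0); last by rewrite cint_cst // mul0r.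
  apply: le_cint => //; first exact: cont_on_cst.
  by move=> t _; exact: cmod_ge0.
pose u := (cmod (g 0))%:C / g 0.
have cu : cmod u = 1.
  by rewrite cmodM cmodV cmod_real ger0_norm ?cmod_ge0 // mulfV // gt_eqF // cmod_gt0.
have dh w : cmod w < r -> cdiff (fun w => u * g w) w.
  by move=> /dg; apply: cdiffM; exact: cdiff_cst.
have := circle_mean_Re dh zr; rewrite /u divfK //= => <-.
apply: le_cint => //; last first.
  by move=> t _; apply: le_trans (ler_norm _) _; apply: le_trans (le_Re_cmod _) _; rewrite cmodM cu mul1r.
move=> t _.
have c1 : ccont (fun t => u * g (z * qexp t)) t%:C.
  apply: (@ccont_comp _ (fun w => u * g w) (fun t => z * qexp t)).
    exact: (ccontM (ccont_cst z _) (cdiff_continuous (cdiff_qexp _))).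
  apply: cdiff_continuous; apply: dh; rewrite cmodM cmod_qexp /= mulr0 oppr0 expR0 mulr1 //.
exact: (@cont_path _ (fun t => u * g (z * qexp t)) (fun t => t%:C) t (row_dist 0) c1).1.
Qed.

End CircleMean.

(** * Area-preserving maps of the plane *)

Section PlaneMeasure.
Variable R : realType.
Local Notation mu := (@lebesgue_measure R).
Local Notation RR := (measurableTypeR R * measurableTypeR R)%type.

Local Notation mu2 := (mu \x mu)%E.

(** Openness and continuity are phrased with boxes to match the product sigma-algebra: a box-open
    set is a countable union of rational rectangles. *)
Definition box_open (O : set RR) := forall p, O p -> exists2 d : R, 0 < d &
  forall q : RR, `|q.1 - p.1| < d -> `|q.2 - p.2| < d -> O q.

Lemma box_open_measurable (O : set RR) : box_open O -> measurable O.
Proof.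
move=> hO.
pose rect (a : (rat * rat) * (rat * rat)) : set RR :=
  `]ratr a.1.1, ratr a.1.2[%classic `*` `]ratr a.2.1, ratr a.2.2[%classic.
pose F a := [set p | rect a p /\ rect a `<=` O].
have -> : O = \bigcup_a F a.
  apply/seteqP; split=> [[x y] Oxy|p [a _ [ra raO]]]; last exact: raO.
  have [d d0 hd] := hO _ Oxy; have d2 : 0 < d / 2 by rewrite divr_gt0.
  have [|a1 ha1] := @rat_in_itvoo R (x - d / 2) x; first by lra.
  have [|a2 ha2] := @rat_in_itvoo R x (x + d / 2); first by lra.
  have [|b1 hb1] := @rat_in_itvoo R (y - d / 2) y; first by lra.
  have [|b2 hb2] := @rat_in_itvoo R y (y + d / 2); first by lra.
  rewrite !in_itv /= in ha1 ha2 hb1 hb2.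
  move/andP: ha1 => [? ?]; move/andP: ha2 => [? ?].
  move/andP: hb1 => [? ?]; move/andP: hb2 => [? ?].
  exists ((a1, a2), (b1, b2)) => //; split.
    by split; rewrite /= in_itv /=; apply/andP; split.
  move=> [u v] [/=]; rewrite !in_itv /= => /andP[? ?] /andP[? ?].
  by apply: hd; rewrite /= ltr_norml; apply/andP; split; lra.
apply: countable_bigcupT_measurable; first exact: countableP.
move=> a; case: (pselect (rect a `<=` O)) => h.
  rewrite (_ : F a = rect a); first by apply: measurableX; exact: measurable_itv.
  by apply/seteqP; split=> [p []|p].
by rewrite (_ : F a = set0); [exact: measurable0|apply/seteqP; split=> p // []].
Qed.

Definition box_cont (F : RR -> R) (p : RR) := forall e, 0 < e -> exists2 d : R, 0 < d &
  forall q : RR, `|q.1 - p.1| < d -> `|q.2 - p.2| < d -> `|F q - F p| < e.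

Lemma box_cont_measurable (O : set RR) (F : RR -> R) : box_open O ->
  (forall p, O p -> box_cont F p) -> measurable_fun O F.
Proof.
move=> oO cF; apply: (measurability _ (RGenOInfty.measurableE R)) => //.
move=> _ [_ [a ->] <-]; apply: box_open_measurable => p [Op /=].
rewrite in_itv /= andbT => aF.
have [d d0 hd] := oO _ Op.
have [|e e0 he] := cF p Op (F p - a); first by rewrite subr_gt0.
exists (Num.min d e); first by rewrite lt_min d0.
move=> q; rewrite !lt_min => /andP[q1 q2] /andP[q3 q4]; split; first exact: hd.
rewrite /= in_itv /= andbT; have := he q q2 q4; rewrite ltr_norml => /andP[+ _].
by clear; lra.
Qed.

(** The translate of Lebesgue measure agrees with it on intervals. *)
Lemma integral_line_shift (f : R -> \bar R) (c : R) : measurable_fun setT f -> (forall x, 0 <= f x)%E ->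
  (\int[mu]_x f (x + c)%R = \int[mu]_x f x)%E.
Proof.
move=> mf f0.
pose phi (x : measurableTypeR R) : measurableTypeR R := x + c.
have ms : measurable_fun setT phi.
  apply: measurable_funD; [exact: measurable_id|exact: measurable_cst].
have := ge0_integral_pushforward ms mu measurableT mf (fun x _ => f0 x).
rewrite preimage_setT => <-.
apply: eq_measure_integral => A mA _ /=; symmetry.
apply: (@lebesgue_measure_unique _ (pushforward mu phi)) => //.
move=> X [[a b] /= ab <-]; rewrite /pushforward.
rewrite (_ : _ @^-1` _ = `](a - c), (b - c)]%classic); last first.
  by apply/seteqP; split=> x /=; rewrite !in_itv /= /phi ltrBlDr lerBrDr.
by rewrite !lebesgue_measure_itv /= !lte_fin ltrD2r -!EFinB; case: ifP => // _; congr (_%:E); ring.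
Qed.

(** Invariance is stated on integrals of nonnegative functions, so that Tonelli proves it for shears
    and composites need no images of sets. *)
Definition area_preserving (T : RR -> RR) := measurable_fun setT T /\
  forall F : RR -> \bar R, measurable_fun setT F -> (forall p, 0 <= F p)%E ->
  (\int[mu2]_p F (T p) = \int[mu2]_p F p)%E.

Lemma area_preserving_comp S T : area_preserving S -> area_preserving T -> area_preserving (fun p => S (T p)).
Proof.
move=> [mS hS] [mT hT]; split; first exact: (measurableT_comp mS mT).
move=> F mF F0; rewrite (hT (fun p => F (S p))) ?hS //.
exact: (measurableT_comp mF mS).
Qed.

Lemma eq_area_preserving S T : (forall p, S p = T p) -> area_preserving S -> area_preserving T.
Proof. by move=> ST; rewrite (_ : T = S) // funeqE. Qed.

Lemma hshear_area_preserving (phi : R -> R) : measurable_fun setT phi ->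
  area_preserving (fun p : RR => (p.1 + phi p.2, p.2)).
Proof.
move=> mphi.
have mT : measurable_fun setT (fun p : RR => (p.1 + phi p.2, p.2) : RR).
  apply/measurable_fun_pairP; split; last exact: measurable_snd.
  apply: measurable_funD; first exact: measurable_fst.
  exact: (measurableT_comp mphi measurable_snd).
split=> // F mF F0; rewrite fubini_tonelli2 //; last exact: (measurableT_comp mF mT).
rewrite [RHS]fubini_tonelli2 //; apply: eq_integral => y _.
rewrite /fubini_G /=; apply: (@integral_line_shift (fun x => F (x, y)) (phi y)) => //.
exact: (measurableT_comp mF (measurable_pair2 y)).
Qed.

Lemma vshear_area_preserving (phi : R -> R) : measurable_fun setT phi ->
  area_preserving (fun p : RR => (p.1, p.2 + phi p.1)).
Proof.
move=> mphi.
have mT : measurable_fun setT (fun p : RR => (p.1, p.2 + phi p.1) : RR).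
  apply/measurable_fun_pairP; split; first exact: measurable_fst.
  apply: measurable_funD; first exact: measurable_snd.
  exact: (measurableT_comp mphi measurable_fst).
split=> // F mF F0; rewrite fubini_tonelli1 //; last exact: (measurableT_comp mF mT).
rewrite [RHS]fubini_tonelli1 //; apply: eq_integral => x _.
rewrite /fubini_F /=; apply: (@integral_line_shift (fun y => F (x, y)) (phi x)) => //.
exact: (measurableT_comp mF (measurable_pair1 x)).
Qed.

Lemma shift_area_preserving (a b : R) : area_preserving (fun p : RR => (p.1 + a, p.2 + b)).
Proof.
exact: (area_preserving_comp (hshear_area_preserving (@measurable_cst _ _ _ _ setT a))
  (vshear_area_preserving (@measurable_cst _ _ _ _ setT b))).
Qed.

(** A rotation other than the half-turn is a product of three shears. *)
Lemma rot_area_preserving (c s : R) : c ^+ 2 + s ^+ 2 = 1 ->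
  area_preserving (fun p : RR => (p.1 * c - p.2 * s, p.1 * s + p.2 * c)).
Proof.
have mlin (k : R) : measurable_fun setT (fun x : measurableTypeR R => x * k).
  by apply: measurable_funM; [exact: measurable_id|exact: measurable_cst].
have gen (c' s' : R) : c' ^+ 2 + s' ^+ 2 = 1 -> c' != -1 ->
    area_preserving (fun p : RR => (p.1 * c' - p.2 * s', p.1 * s' + p.2 * c')).
  move=> cs cN; have c1 : 1 + c' != 0 by rewrite addrC -subr_eq0 opprK in cN *.
  pose t := - (s' / (1 + c')).
  have h := area_preserving_comp (hshear_area_preserving (mlin t)) (area_preserving_comp (vshear_area_preserving (mlin s')) (hshear_area_preserving (mlin t))).
  have e1 : 1 + t * s' = c'.
    have : s' ^+ 2 = (1 - c') * (1 + c') by rewrite -subr_sqr expr1n -cs addrC addKr.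
    by rewrite /t mulNr mulrAC -expr2 => ->; rewrite mulfK // opprB subrKC.
  have e2 : t * (1 + c') = - s' by rewrite /t mulNr divfK.
  apply: eq_area_preserving h => -[x y] /=; congr (_, _).
    have -> : x + y * t + (y + (x + y * t) * s') * t = x * (1 + t * s') + y * (t * (1 + (1 + t * s'))) by ring.
    by rewrite e1 e2 mulrN.
  have -> : y + (x + y * t) * s' = x * s' + y * (1 + t * s') by ring.
  by rewrite e1.
move=> cs; have [cN|cN] := eqVneq c (-1); last exact: gen.
have s0 : s = 0.
  move: cs; rewrite cN sqrrN expr1n => /eqP; rewrite -subr_eq0 addrAC subrr add0r.
  by rewrite expf_eq0 /= => /eqP.
(* the half-turn is the square of the quarter-turn *)
have q : area_preserving (fun p : RR => (p.1 * 0 - p.2 * 1, p.1 * 1 + p.2 * 0)).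
  apply: gen; first by rewrite expr0n expr1n add0r.
  by rewrite eq_sym oppr_eq0 oner_eq0.
by apply: eq_area_preserving (area_preserving_comp q q) => -[x y] /=; rewrite cN s0; congr (_, _); ring.
Qed.

End PlaneMeasure.

(** * Radial integrals over discs *)

Section DiscIntegrals.
Variable R : realType.
Local Notation mu := (@lebesgue_measure R).
Local Notation RR := (measurableTypeR R * measurableTypeR R)%type.

Lemma cont_on_EFin (f : R -> R) a b : cont_on a b f ->
  (\int[mu]_(x in `[a, b]) (f x)%:E = (cint a b f)%:E)%E.
Proof.
move=> cf; rewrite /cint /Rintegral fineK //.
by apply: integrable_fin_num => //; exact: cont_on_int.
Qed.

Definition disc (r : R) : set RR := [set p | p.1 ^+ 2 + p.2 ^+ 2 < r ^+ 2].

Lemma box_contD (F G : RR -> R) p : box_cont F p -> box_cont G p ->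
  box_cont (fun q => F q + G q) p.
Proof.
move=> cF cG e e0; have e2 : 0 < e / 2 by rewrite divr_gt0.
have [d d0 hd] := cF _ e2; have [d' d'0 hd'] := cG _ e2.
exists (Num.min d d'); first by rewrite lt_min d0.
move=> q; rewrite !lt_min => /andP[q1 q2] /andP[q3 q4].
have -> : F q + G q - (F p + G p) = (F q - F p) + (G q - G p) by ring.
by apply: le_lt_trans (ler_normD _ _) _; rewrite [e]splitr ltrD ?hd ?hd'.
Qed.

Lemma box_cont_fun (f : R -> R) (p : RR) : {for p.1, continuous (f : R^o -> R^o)} ->
  box_cont (fun q => f q.1) p.
Proof. by move=> /contRP h e /h [d d0 hd]; exists d => // q /hd. Qed.

Lemma box_cont_fun2 (f : R -> R) (p : RR) : {for p.2, continuous (f : R^o -> R^o)} ->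
  box_cont (fun q => f q.2) p.
Proof. by move=> /contRP h e /h [d d0 hd]; exists d => // q _ /hd. Qed.

Lemma box_cont_cmod (g : R[i] -> R[i]) (p : RR) : ccont g (p.1 +i* p.2) ->
  box_cont (fun q => cmod (g (q.1 +i* q.2))) p.
Proof.
move=> /contC_P h e /h [d d0 hd]; exists (d / 2); first by rewrite divr_gt0.
move=> q q1 q2; apply: le_lt_trans (cmod_dist _ _) (hd _ _).
have := cmod_le_ReIm ((q.1 +i* q.2) - (p.1 +i* p.2)) => /= /le_lt_trans; apply.
by rewrite [d]splitr ltrD.
Qed.

Lemma cont_sqr (x : R) : {for x, continuous (fun x : R^o => x ^+ 2 : R^o)}.
Proof. exact: exprn_continuous. Qed.

Lemma box_cont_norm2 (p : RR) : box_cont (fun q => q.1 ^+ 2 + q.2 ^+ 2) p.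
Proof.
exact: (@box_contD (fun q => q.1 ^+ 2) (fun q => q.2 ^+ 2) p
  (@box_cont_fun (fun x => x ^+ 2) p (@cont_sqr p.1))
  (@box_cont_fun2 (fun x => x ^+ 2) p (@cont_sqr p.2))).
Qed.

Lemma disc_open (r : R) : box_open (disc r).
Proof.
move=> p pr; have [|d d0 hd] := @box_cont_norm2 p (r ^+ 2 - (p.1 ^+ 2 + p.2 ^+ 2)).
  by rewrite subr_gt0.
exists d => // q q1 q2; have := hd q q1 q2; rewrite ltr_norml => /andP[_].
by rewrite ltrBlDr subrK.
Qed.

Lemma measurable_disc (r : R) : measurable (disc r).
Proof. exact: box_open_measurable (@disc_open r). Qed.

Lemma measurable_weight k (D : set RR) :
  measurable_fun D (fun p : RR => 1 - k * (p.1 ^+ 2 + p.2 ^+ 2)).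
Proof.
apply: (@measurable_funS _ _ _ _ setT) => //.
apply: measurable_funB; first exact: measurable_cst.
apply: measurable_funM; first exact: measurable_cst.
apply: box_cont_measurable; first by move=> p _; exists 1.
by move=> p _; exact: box_cont_norm2.
Qed.

Lemma slice_sqrt (r x y : R) :
  (x ^+ 2 + y ^+ 2 < r ^+ 2) = (y \in `](- Num.sqrt (r ^+ 2 - x ^+ 2)), Num.sqrt (r ^+ 2 - x ^+ 2)[).
Proof.
rewrite in_itv /= -ltr_norml -sqrtr_sqr addrC -ltrBrDr.
have [h|h] := ltP 0 (r ^+ 2 - x ^+ 2); first by rewrite ltr_sqrt.
rewrite [in RHS](ler0_sqrtr h) ltNge (le_trans h) ?sqr_ge0 //=.
by apply/esym/negbTE; rewrite -leNgt sqrtr_ge0.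
Qed.

(** The angular integral that the substitution x = r sin t leaves from the slices of a disc. *)
Lemma sin_cos_integral (r k : R) :
  cint (- (pi / 2)) (pi / 2) (fun t => (2 * r ^+ 2 - 2 * k * r ^+ 4) * cos t ^+ 2 +
    4 / 3 * k * r ^+ 4 * cos t ^+ 4) = pi * r ^+ 2 * (1 - k * r ^+ 2 / 2).
Proof.
pose F t : R := (2 * r ^+ 2 - k * r ^+ 4) / 2 * (sin t * cos t + t) +
   k * r ^+ 4 / 3 * (sin t * cos t ^+ 3).
have dF (t : R) : is_derive t (1 : R) F ((2 * r ^+ 2 - 2 * k * r ^+ 4) * cos t ^+ 2 +
    4 / 3 * k * r ^+ 4 * cos t ^+ 4).
  apply: is_derive_eq; rewrite /GRing.scale /=.
  have e : sin t ^+ 2 = 1 - cos t ^+ 2 by rewrite -(cos2Dsin2 t) addrC addKr.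
  rewrite -[sin t * - sin t]/(sin t * - sin t).
  transitivity ((2 * r ^+ 2 - k * r ^+ 4) / 2 * (cos t ^+ 2 - sin t ^+ 2 + 1) +
    k * r ^+ 4 / 3 * (cos t ^+ 4 - 3 * sin t ^+ 2 * cos t ^+ 2)); first by ring.
  by rewrite e; field.
have ctc : continuous (@cos R) := @continuous_cos R.
rewrite (@cint_FTC _ F).
- by rewrite /F sinN cosN sin_pihalf cos_pihalf; field; rewrite ?pnatr_eq0.
- by have := @pi_ge0 R; lra.
- have cX n t : {for t, continuous (fun t : R^o => cos t ^+ n : R^o)}.
    exact: (@continuous_comp _ _ _ (@cos R : R^o -> R^o) (fun x => x ^+ n) t (ctc t) (@exprn_continuous _ n _)).
  by apply: cont_onD; apply: cont_onZ => t _; exact: cX.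
Qed.

End DiscIntegrals.

Section DiscWeight.
Variable R : realType.
Local Notation mu := (@lebesgue_measure R).
Local Notation mu2 := (mu \x mu)%E.

Lemma disc_slice (k r x : R) :
  (\int[mu]_(y in `](- Num.sqrt (r ^+ 2 - x ^+ 2))%R, (Num.sqrt (r ^+ 2 - x ^+ 2))%R[)
     (1 - k * (x ^+ 2 + y ^+ 2))%:E =
   (2 * Num.sqrt (r ^+ 2 - x ^+ 2) * (1 - k * x ^+ 2) -
      2 / 3 * k * Num.sqrt (r ^+ 2 - x ^+ 2) ^+ 3)%:E)%E.
Proof.
set s := Num.sqrt _; have s0 : 0 <= s by exact: sqrtr_ge0.
have cf : cont_on (- s) s (fun y => 1 - k * (x ^+ 2 + y ^+ 2)).
  apply: cont_onD; first exact: cont_on_cst.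
  apply: cont_onN; apply: cont_onZ; apply: cont_onD; first exact: cont_on_cst.
  by move=> y _; exact: cont_sqr.
have mf (A : set (measurableTypeR R)) : measurable_fun A (fun y : measurableTypeR R => (1 - k * (x ^+ 2 + y ^+ 2))).
  apply: measurable_funTS; apply: measurable_funB; first exact: measurable_cst.
  apply: measurable_funM; first exact: measurable_cst.
  apply: measurable_funD; first exact: measurable_cst.
  by apply: measurable_funX; exact: measurable_id.
rewrite integral_itv_bndo_bndc; last by apply/measurable_EFinP; apply: mf.
rewrite integral_itv_obnd_cbnd; last by apply/measurable_EFinP; apply: mf.
rewrite cont_on_EFin //.
pose F y : R := y * (1 - k * x ^+ 2) - k / 3 * y ^+ 3.
have dF (y : R) : is_derive y (1 : R) F (1 - k * (x ^+ 2 + y ^+ 2)).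
  by apply: is_derive_eq; rewrite /GRing.scale /=; field.
rewrite (@cint_FTC _ F) //; first by congr (_%:E); rewrite /F; field.
by lra.
Qed.

Lemma half_disc_substitution (k r : R) : 0 < r ->
  (\int[mu]_(x in `[(- r)%R, r]) (2 * Num.sqrt (r ^+ 2 - x ^+ 2) * (1 - k * x ^+ 2) -
      2 / 3 * k * Num.sqrt (r ^+ 2 - x ^+ 2) ^+ 3)%:E =
   (pi * r ^+ 2 * (1 - k * r ^+ 2 / 2))%:E)%E.
Proof.
move=> r0; set G := fun x : R => 2 * Num.sqrt (r ^+ 2 - x ^+ 2) * (1 - k * x ^+ 2) -
      2 / 3 * k * Num.sqrt (r ^+ 2 - x ^+ 2) ^+ 3.
pose F (t : R) : R := r * sin t.
have dF (t : R) : is_derive t (1 : R) F (r * cos t) by apply: is_derive_eq.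
have dF' : derive1 F = (fun t => r * cos t).
  by apply/funext => t; rewrite derive1E; have [_ ->] := dF t.
have cF : continuous (F : R^o -> R^o).
  by move=> t; apply: differentiable_continuous; apply/derivable1_diffP; have [] := dF t.
have cF' : continuous ((fun t => r * cos t) : R^o -> R^o).
  by move=> t; apply: cvgM; [exact: cvg_cst|exact: continuous_cos].
have cS : continuous ((fun x => Num.sqrt (r ^+ 2 - x ^+ 2)) : R^o -> R^o).
  move=> x; apply: (@continuous_comp _ _ _ (fun x : R^o => r ^+ 2 - x ^+ 2 : R^o) Num.sqrt x).
    by apply: cvgB; [exact: cvg_cst|exact: cont_sqr].
  exact: sqrt_continuous.
have cG : continuous (G : R^o -> R^o).
  move=> x; apply: cvgB.
    apply: cvgM; first by apply: cvgM; [exact: cvg_cst|exact: cS].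
    by apply: cvgB; [exact: cvg_cst|apply: cvgM; [exact: cvg_cst|exact: cont_sqr]].
  apply: cvgM; first exact: cvg_cst.
  exact: (@continuous_comp _ _ _ (fun x : R^o => Num.sqrt (r ^+ 2 - x ^+ 2) : R^o) (fun y => y ^+ 3) x (cS x) (@exprn_continuous _ 3 _)).
have Fa : F (- (pi / 2)) = - r by rewrite /F sinN sin_pihalf mulrN1.
have Fb : F (pi / 2) = r by rewrite /F sin_pihalf mulr1.
have pp : - (pi / 2) <= pi / 2 :> R by have := @pi_ge0 R; lra.
have := @integration_by_substitution_increasing R F G (- (pi / 2)) (pi / 2) pp.
rewrite Fa Fb dF' => ->.
- rewrite -sin_cos_integral -cont_on_EFin; last first.
    have cX n t : {for t, continuous (fun t : R^o => cos t ^+ n : R^o)}.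
      exact: (@continuous_comp _ _ _ (@cos R : R^o -> R^o) (fun x => x ^+ n) t (@continuous_cos R t) (@exprn_continuous _ n _)).
    by apply: cont_onD; apply: cont_onZ => t _; exact: cX.
  apply: eq_integral => t /set_mem /=; rewrite in_itv /= => tI; congr (_%:E).
  transitivity (G (F t) * (r * cos t)); first by [].
  have c0 : 0 <= cos t by apply: cos_ge0_pihalf.
  rewrite /G /F; have -> : r ^+ 2 - (r * sin t) ^+ 2 = (r * cos t) ^+ 2.
    by rewrite !exprMn -{1}[r ^+ 2]mulr1 -(cos2Dsin2 t); ring.
  rewrite sqrtr_sqr ger0_norm ?mulr_ge0 ?(ltW r0) //.
  have e : sin t ^+ 2 = 1 - cos t ^+ 2 by rewrite -(cos2Dsin2 t) addrC addKr.
  by rewrite !exprMn e; field.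
- move=> x y xI yI xy; rewrite /F ltr_pM2l // ltr_sin //.
- by move=> x _; exact: cF'.
- by apply: (cvgP (r * cos (- (pi / 2)))); apply: cvg_at_right_filter; exact: cF'.
- by apply: (cvgP (r * cos (pi / 2))); apply: cvg_at_left_filter; exact: cF'.
- split.
  + by move=> x _; have [] := dF x.
  + by apply: cvg_at_right_filter; exact: cF.
  + by apply: cvg_at_left_filter; exact: cF.
- exact: continuous_subspaceT.
Qed.

(** Vertical slices, then x = r sin t. The bound on [k * r ^+ 2] makes the weight nonnegative, as
    Tonelli requires. *)
Lemma disc_weight (k r : R) : 0 < r -> 0 <= k -> k * r ^+ 2 <= 1 ->
  (\int[mu2]_(p in @disc R r) (1 - k * (p.1 ^+ 2 + p.2 ^+ 2))%:E =
   (pi * r ^+ 2 * (1 - k * r ^+ 2 / 2))%:E)%E.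
Proof.
move=> r0 k0 kr.
have mD := @measurable_disc R r.
rewrite integral_mkcond fubini_tonelli1.
- rewrite -half_disc_substitution // [RHS]integral_mkcond.
  apply: eq_integral => x _; rewrite /fubini_F.
  transitivity ((2 * Num.sqrt (r ^+ 2 - x ^+ 2) * (1 - k * x ^+ 2) -
      2 / 3 * k * Num.sqrt (r ^+ 2 - x ^+ 2) ^+ 3)%:E : \bar R).
    rewrite -disc_slice [RHS]integral_mkcond; apply: eq_integral => y _.
    rewrite /patch; congr (if _ then _ else _).
    apply/idP/idP => /set_mem h; apply/mem_set; move: h; rewrite /disc /=.
      by rewrite slice_sqrt.
    by rewrite -slice_sqrt.
  rewrite /patch; case: ifPn => // /negP xI.
  have : r ^+ 2 - x ^+ 2 <= 0.
    rewrite subr_le0 leNgt; apply/negP => h; apply: xI; apply/mem_set.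
    rewrite /= in_itv /= -ler_norml; apply: ltW.
    by rewrite -(@ltr_pXn2r _ 2) ?nnegrE ?(ltW r0) // real_normK ?num_real.
  by move=> /ler0_sqrtr ->; rewrite expr0n /= !mulr0 mul0r subrr.
- apply/(measurable_restrictT _ mD)/measurable_EFinP; exact: measurable_weight.
- move=> p; rewrite /patch; case: ifPn => // /set_mem; rewrite /disc /= lee_fin => h.
  rewrite subr_ge0; apply: le_trans kr; rewrite ler_wpM2l //; exact: ltW.
Qed.

End DiscWeight.

(** * Mean values over discs *)

Section AreaMean.
Variable R : realType.
Local Notation mu := (@lebesgue_measure R).
Local Notation RR := (measurableTypeR R * measurableTypeR R)%type.
Local Notation mu2 := (mu \x mu)%E.

Definition plane_rot (c s : R) (p : RR) : RR := (p.1 * c - p.2 * s, p.1 * s + p.2 * c).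

Lemma rot_norm2 (c s : R) (p : RR) : c ^+ 2 + s ^+ 2 = 1 ->
  (plane_rot c s p).1 ^+ 2 + (plane_rot c s p).2 ^+ 2 = p.1 ^+ 2 + p.2 ^+ 2.
Proof.
move=> cs; rewrite /plane_rot /=.
transitivity ((p.1 ^+ 2 + p.2 ^+ 2) * (c ^+ 2 + s ^+ 2)); first by ring.
by rewrite cs mulr1.
Qed.

Lemma rot_disc (c s r : R) (p : RR) : c ^+ 2 + s ^+ 2 = 1 ->
  (plane_rot c s p \in @disc R r) = (p \in @disc R r).
Proof.
move=> cs; apply/idP/idP => /set_mem h; apply/mem_set; move: h; rewrite /disc /mkset.
  by rewrite rot_norm2.
by rewrite rot_norm2.
Qed.

Lemma rot_mulC (c s : R) (p : RR) :
  ((plane_rot c s p).1 +i* (plane_rot c s p).2) = (p.1 +i* p.2) * (c +i* s).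
Proof. by apply: ReIm_eq; rewrite ?cReM ?cImM. Qed.

Lemma measurable_rot : measurable_fun setT
  (fun q : RR * measurableTypeR R => plane_rot (cos (2 * pi * q.2)) (sin (2 * pi * q.2)) q.1).
Proof.
have mlin : measurable_fun setT (fun t : measurableTypeR R => 2 * pi * t).
  by apply: measurable_funM; [exact: measurable_cst|exact: measurable_id].
have mc : measurable_fun setT (fun q : RR * measurableTypeR R => cos (2 * pi * q.2)).
  apply: (measurableT_comp (f := fun t => cos (2 * pi * t))); last exact: measurable_snd.
  apply: (measurableT_comp (f := @cos R)) => //.
  exact: (continuous_measurable_fun (@continuous_cos R)).
have ms : measurable_fun setT (fun q : RR * measurableTypeR R => sin (2 * pi * q.2)).
  apply: (measurableT_comp (f := fun t => sin (2 * pi * t))); last exact: measurable_snd.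
  apply: (measurableT_comp (f := @sin R)) => //.
  exact: (continuous_measurable_fun (@continuous_sin R)).
have m1 : measurable_fun setT (fun q : RR * measurableTypeR R => q.1.1).
  exact: (measurableT_comp measurable_fst measurable_fst).
have m2 : measurable_fun setT (fun q : RR * measurableTypeR R => q.1.2).
  exact: (measurableT_comp measurable_snd measurable_fst).
apply/measurable_fun_pairP; split.
  by apply: measurable_funB; apply: measurable_funM.
by apply: measurable_funD; apply: measurable_funM.
Qed.

(** [H] along the orbit of a point under one full turn, as a function on the product of the plane
    with the line of angles. *)
Definition rot_fun (H : RR -> \bar R) (q : RR * measurableTypeR R) : \bar R :=
  if q.2 \in `[0%R, 1%R] then H (plane_rot (cos (2 * pi * q.2)) (sin (2 * pi * q.2)) q.1) else 0%E.

Lemma measurable_rot_fun H : measurable_fun setT H -> measurable_fun setT (rot_fun H).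
Proof.
move=> mH; apply: measurable_fun_if => //.
- apply: (measurable_fun_bool true).
  rewrite setTI (_ : _ @^-1` _ = setT `*` `[0%R, 1%R]); first exact: measurableX.
  by apply/seteqP; split=> [[p t]|[p t] []] //=.
- apply: measurable_funTS; exact: (measurableT_comp mH measurable_rot).
Qed.

Lemma rot_funE H p : (\int[mu]_(t in `[0%R, 1%R]) H (plane_rot (cos (2 * pi * t)) (sin (2 * pi * t)) p)
  = fubini_F mu (rot_fun H) p)%E.
Proof.
rewrite integral_mkcond; apply: eq_integral => t _.
by rewrite /patch /rot_fun mem_setE.
Qed.

(** A name for the product measure that carries the structure of a sigma-finite measure, so that
    Tonelli applies to the product of the plane with the line of angles. *)
Definition plane_measure : set RR -> \bar R := mu2.

HB.instance Definition _ := Measure.on plane_measure.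

Lemma plane_sigma_finite : sigma_finite setT plane_measure.
Proof.
pose sq (n : nat) : set (measurableTypeR R) := `[(- n%:R)%R, n%:R]%classic.
have mS n : measurable (sq n) by exact: measurable_itv.
exists (fun n => sq n `*` sq n).
  apply/esym/seteqP; split => // -[x y] _.
  pose n := Num.truncn (`|x| + `|y|).
  have h : `|x| + `|y| < n.+1%:R by apply: truncnS_gt.
  have := normr_ge0 x; have := normr_ge0 y => y0 x0.
  exists n.+1 => //=; rewrite /sq /= !in_itv /= -!ler_norml.
  by split; apply: ltW; apply: le_lt_trans h; rewrite ?lerDl ?lerDr.
move=> n; split; first exact: measurableX.
have -> : plane_measure (sq n `*` sq n) = (mu (sq n) * mu (sq n))%E by exact: product_measure1E.
have -> : mu (sq n) = if (- n%:R < n%:R :> R) then (n%:R - - n%:R)%:E else 0%E.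
  by rewrite /sq lebesgue_measure_itv /= lte_fin.
by case: ifP => _; rewrite ?mule0 -?EFinM ?ltry.
Qed.

HB.instance Definition _ := Measure_isSigmaFinite.Build _ _ _ plane_measure plane_sigma_finite.

(** For each fixed angle the rotation preserves area. *)
Lemma average_rot (H : RR -> \bar R) : measurable_fun setT H -> (forall p, 0 <= H p)%E ->
  (\int[mu2]_p \int[mu]_(t in `[0%R, 1%R]) H (plane_rot (cos (2 * pi * t)) (sin (2 * pi * t)) p)
   = \int[mu2]_p H p)%E.
Proof.
move=> mH H0.
have Phi0 q : (0 <= rot_fun H q)%E by rewrite /rot_fun; case: ifP.
transitivity (\int[mu2]_p \int[mu]_t rot_fun H (p, t))%E.
  by apply: eq_integral => p _; rewrite rot_funE.
rewrite (@fubini_tonelli _ _ _ _ _ plane_measure mu (rot_fun H) (measurable_rot_fun mH) Phi0).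
transitivity (\int[mu]_(t in `[0%R, 1%R]) cst (\int[mu2]_p H p) t)%E.
  rewrite [RHS]integral_mkcond; apply: eq_integral => t _.
  rewrite /patch /rot_fun mem_setE /=; case: ifP => _; last by rewrite integral0.
  by apply: (rot_area_preserving (cos2Dsin2 _)).2.
by rewrite integral_cst //= lebesgue_measure_itv /= lte_fin ltr01 sube0 mule1.
Qed.

(** Averaging over all rotations replaces the modulus of [g] by its means over circles, which are at
    least its value at the centre; the invariant weight passes through the average. *)
Lemma disc_mean (g : R[i] -> R[i]) (w : RR -> R) (r : R) : 0 < r ->
  (forall z, cmod z < r -> cdiff g z) ->
  measurable_fun setT w -> (forall p, @disc R r p -> 0 <= w p) ->
  (forall c s p, c ^+ 2 + s ^+ 2 = 1 -> w (plane_rot c s p) = w p) ->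
  ((cmod (g 0))%:E * \int[mu2]_(p in @disc R r) (w p)%:E <=
   \int[mu2]_(p in @disc R r) (w p * cmod (g (p.1 +i* p.2)))%:E)%E.
Proof.
move=> r0 dg mw w0 wr; have mD := @measurable_disc R r.
have disc_cmod p : @disc R r p -> cmod (p.1 +i* p.2) < r.
  move=> h; rewrite -(@ltr_pXn2r _ 2) ?nnegrE ?cmod_ge0 ?(ltW r0) //.
  by rewrite cmod_sqr.
pose h := fun p : RR => (w p * cmod (g (p.1 +i* p.2)))%:E.
pose H := h \_ (@disc R r).
have mh : measurable_fun (@disc R r) h.
  apply/measurable_EFinP; apply: measurable_funM; first exact: measurable_funTS.
  apply: box_cont_measurable; first exact: disc_open.
  by move=> p /disc_cmod /dg /cdiff_continuous; exact: box_cont_cmod.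
have mH : measurable_fun setT H by apply/(measurable_restrictT _ mD).
have H0 p : (0 <= H p)%E.
  rewrite /H /patch; case: ifPn => // /set_mem /w0 wp.
  by rewrite lee_fin mulr_ge0 ?cmod_ge0.
rewrite [leRHS]integral_mkcond -/h -/H -(average_rot mH H0).
rewrite -ge0_integralZl //; last 2 first.
- by apply/measurable_EFinP; exact: measurable_funTS.
- by rewrite lee_fin cmod_ge0.
rewrite integral_mkcond; apply: ge0_le_integral => //.
- move=> p _; rewrite /patch; case: ifPn => // /set_mem /w0 wp.
  by rewrite -EFinM lee_fin mulr_ge0 ?cmod_ge0.
- apply/(measurable_restrictT _ mD)/measurable_EFinP; apply: measurable_funM.
    exact: measurable_cst.
  exact: measurable_funTS.
- rewrite (_ : (fun p => _) = fubini_F mu (rot_fun H)); last first.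
    by apply/funext => p; rewrite rot_funE.
  apply: measurable_fun_fubini_tonelli_F; first exact: measurable_rot_fun.
  by move=> p; rewrite /rot_fun; case: ifP.
move=> p _; rewrite /patch; case: ifPn => pD; last first.
  by apply: integral_ge0 => t _.
move/set_mem: (pD) => /disc_cmod pr; have wp := w0 _ (set_mem pD).
pose q t := g ((p.1 +i* p.2) * qexp t%:C).
have e t : H (plane_rot (cos (2 * pi * t)) (sin (2 * pi * t)) p) = (w p * cmod (q t))%:E.
  by rewrite /H /patch rot_disc ?cos2Dsin2 // pD /h wr ?cos2Dsin2 // rot_mulC /q qexp_real.
have cq : cont_on 0 1 (fun t => cmod (q t)) := cont_on_circle dg pr.
under eq_integral do rewrite e.
rewrite cont_on_EFin; last exact: cont_onZ.
rewrite cintZ // -EFinM lee_fin mulrC ler_wpM2l //.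
exact: circle_mean_le dg pr.
Qed.

End AreaMean.

(** * Decay towards the cusp *)

Section CuspDecay.
Variable R : realType.
Implicit Types (f : R[i] -> R[i]) (z w u : R[i]).

Lemma cdiff_near_bound f z : cdiff f z -> exists2 L : R, 0 <= L & cnear z (fun w =>
  cmod (f w - f z) <= L * cmod (w - z)).
Proof.
move=> [phi /contC_P /(_ 1 ltr01) h hf]; exists (cmod (phi z) + 1).
  by rewrite addr_ge0 ?cmod_ge0.
move: hf h; apply: cnearS2 => w -> h.
rewrite addrAC subrr add0r cmodM ler_wpM2r ?cmod_ge0 //.
have := cmodD (phi w - phi z) (phi z); rewrite subrK => /le_trans; apply.
by rewrite addrC lerD2l ltW.
Qed.

(** At 1 the function 1 - q has a zero of order one: the pole of [cusp_kernel] is no worse than the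
    zero of [f w - f z]. *)
Lemma qexp_near1 : exists2 d : R, 0 < d & forall h : R[i], cmod h < d ->
  cmod h <= cmod (1 - qexp h).
Proof.
have [d d0 hd] := @cexp_near0 R (1 / 2) ltac:(lra).
have p2 := @pi_ge2 R; have p0 : 0 < 2 * pi :> R by lra.
exists (d / (2 * pi)); first exact: divr_gt0.
move=> h; rewrite ltr_pdivlMr // mulrC => hh.
set v := (0 +i* (2 * pi)) * h.
have cv : cmod v = 2 * pi * cmod h.
  by rewrite cmodM /cmod /= expr0n add0r sqrtr_sqr ger0_norm // ltW.
rewrite cmodB /qexp -/v; have := hd v; rewrite cv => /(_ hh) H.
have := cmodD (cexp v - 1) (- (cexp v - 1 - v)).
rewrite cmodN opprB addrC subrK cv => H2.
have h0 := cmod_ge0 h; have : 2 * cmod h <= pi * cmod h by rewrite ler_wpM2r.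
have e1 : 1 / 2 * (2 * pi * cmod h) = pi * cmod h by field.
have e2 : 2 * pi * cmod h = 2 * (pi * cmod h) by ring.
rewrite e1 in H; rewrite e2 in H2.
by clear -H H2 h0; lra.
Qed.

(** Summing a geometric series, [cusp_kernel z w] is the sum of q^n over n >= 1, where q = e(z - w);
    averaging against it on a horizontal row below z reproduces a cusp form at z. *)
Definition cusp_kernel z w : R[i] := qexp (z - w) / (1 - qexp (z - w)).

Lemma cmod_qexpB z w : cmod (qexp (z - w)) = expR (- (2 * pi * (complex.Im z - complex.Im w))).
Proof. by rewrite cmod_qexp cImD cImN. Qed.

Lemma pi2_gt0 : 0 < 2 * pi :> R.
Proof. by rewrite mulr_gt0 // pi_gt0. Qed.

Lemma cusp_kernel_period z w : cusp_kernel z (w + 1) = cusp_kernel z w.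
Proof.
have -> : cusp_kernel z w = cusp_kernel (z - (w + 1) + 1) 0.
  by rewrite /cusp_kernel subr0 opprD addrA subrK.
by rewrite /cusp_kernel subr0 qexp_period.
Qed.

Lemma cusp_kernel_below z w : complex.Im w < complex.Im z ->
  cmod (cusp_kernel z w) <= expR (- (2 * pi * (complex.Im z - complex.Im w))) /
    (1 - expR (- (2 * pi * (complex.Im z - complex.Im w)))).
Proof.
move=> wz; have p0 := pi2_gt0.
have q1 : expR (- (2 * pi * (complex.Im z - complex.Im w))) < 1.
  by rewrite -[ltRHS]expR0 ltr_expR oppr_lt0 mulr_gt0 // subr_gt0.
rewrite cmodM cmodV cmod_qexpB ler_wpM2l ?expR_ge0 // lef_pV2 ?posrE ?subr_gt0 //.
  rewrite lerBlDr -cmod_qexpB; have := cmodD (1 - qexp (z - w)) (qexp (z - w)).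
  by rewrite subrK cmod1.
have := cmodD (1 - qexp (z - w)) (qexp (z - w)).
by rewrite subrK cmod1 cmod_qexpB; clear -q1; lra.
Qed.

(** q / (1 - q) = -1 + 1 / (1 - q), and q is large above z. *)
Lemma cusp_kernel_above z w (t : R) : 0 < t -> 1 + t <= expR (2 * pi * (complex.Im w - complex.Im z)) ->
  cmod (cusp_kernel z w + 1) <= t^-1 /\ cmod (cusp_kernel z w) <= 1 + t^-1.
Proof.
move=> t0 ht.
have e1 : 1 + t <= cmod (qexp (z - w)) by rewrite cmod_qexpB -mulrN opprB.
have e2 : t <= cmod (1 - qexp (z - w)).
  have := cmodD (qexp (z - w) - 1) 1; rewrite subrK cmod1 cmodB => h.
  by clear -e1 h; lra.
have n0 : 1 - qexp (z - w) != 0 by rewrite -cmod_gt0 (lt_le_trans t0).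
have h1 : cmod (cusp_kernel z w + 1) <= t^-1.
  have -> : cusp_kernel z w + 1 = (1 - qexp (z - w))^-1 by rewrite /cusp_kernel; field.
  by rewrite cmodV lef_pV2 ?posrE // (lt_le_trans t0).
split=> //; have := cmodD (cusp_kernel z w + 1) (- 1); rewrite addrK cmodN cmod1.
by clear -h1; lra.
Qed.

Lemma qexpB_neq1 z w : complex.Im w != complex.Im z -> 1 - qexp (z - w) != 0.
Proof.
move=> h; rewrite subr_eq0; apply/eqP => /(congr1 (@cmod R)).
rewrite cmod1 cmod_qexpB -[LHS]expR0 => /expR_inj /esym /eqP.
rewrite oppr_eq0 mulf_eq0 (gt_eqF pi2_gt0) /= subr_eq0 eq_sym.
exact/negP.
Qed.

Lemma cdiff_cusp_kernel z w : 1 - qexp (z - w) != 0 -> cdiff (cusp_kernel z) w.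
Proof.
move=> h; have dq : cdiff (fun w => qexp (z - w)) w.
  apply: (@cdiff_comp _ (@qexp R) (fun w => z - w)); last exact: cdiff_qexp.
  exact: (cdiffD (cdiff_cst z w) (cdiffN (cdiff_id w))).
apply: (cdiffM dq (cdiffV (f := fun w => 1 - qexp (z - w)) h _)).
exact: (cdiffD (cdiff_cst 1 w) (cdiffN dq)).
Qed.

Lemma qexp_row_neq1 (x y : R) : y != 0 \/ - (1 / 2) <= x <= 1 / 2 /\ x != 0 ->
  1 - qexp (x +i* y) != 0.
Proof.
move=> [y0|[/andP[x1 x2] x0]].
  have h0 : complex.Im (0 : R[i]) != complex.Im (x +i* y) by rewrite eq_sym.
  by have := qexpB_neq1 h0; rewrite subr0.
have p0 := @pi_gt0 R.
have [->|y0] := eqVneq y 0; last first.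
  have h0 : complex.Im (0 : R[i]) != complex.Im (x +i* y) by rewrite eq_sym.
  by have := qexpB_neq1 h0; rewrite subr0.
rewrite subr_eq0; apply/eqP; rewrite (qexp_real x) => -[c1 _].
have c2 : cos (2 * pi * `|x|) = cos 0.
  transitivity (cos (2 * pi * x)); last by rewrite -c1 cos0.
  case: (ler0P x) => _ //.
  by rewrite mulrN cosN.
have xl : `|x| <= 1 / 2 by rewrite ler_norml x1 x2.
have := @cos_inj R (2 * pi * `|x|) 0; rewrite !in_itv /= lexx (ltW p0) mulr_ge0 ?normr_ge0 ?(ltW pi2_gt0) //=.
have -> : 2 * pi * `|x| <= pi.
  have -> : 2 * pi * `|x| = pi * (2 * `|x|) by ring.
  by rewrite ler_piMr ?(ltW p0) //; clear -xl; lra.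
move=> /(_ isT isT c2) /eqP; rewrite mulf_eq0 (gt_eqF pi2_gt0) normr_eq0 /=.
exact/negP.
Qed.

(** Pushing the row down, away from z, makes the kernel small without changing its mean. *)
Lemma cusp_kernel_mean (u z : R[i]) (a Y : R) : Y < complex.Im z ->
  cint a (a + 1) (fun x => complex.Re (u * cusp_kernel z (x +i* Y))) = 0.
Proof.
move=> Yz; pose G w := u * cusp_kernel z w.
have dG w : complex.Im w < complex.Im z -> cdiff G w.
  move=> h; apply: (cdiffM (cdiff_cst u w)); apply: cdiff_cusp_kernel; apply: qexpB_neq1.
  by rewrite lt_eqF.
apply/eqP; rewrite -normr_eq0; apply/eqP/le_anti; rewrite normr_ge0 andbT.
apply/ler_addgt0Pl => e e0; rewrite addr0.
pose C := cmod u + 1; have C0 : 0 < C by rewrite /C; have := cmod_ge0 u; lra.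
have [||s0 s00 hs] := @expRN_small R 1 (Num.min (1 / 2) (e / (2 * C))); first by [].
  by rewrite lt_min divr_gt0 // divr_gt0 // mulr_gt0.
pose Y' := Num.min Y (complex.Im z - s0).
have Y'Y : Y' <= Y by rewrite ge_min lexx.
have Y'z : s0 <= complex.Im z - Y'.
  have : Y' <= complex.Im z - s0 by rewrite ge_min lexx orbT.
  by clear; lra.
have -> : cint a (a + 1) (fun x => complex.Re (u * cusp_kernel z (x +i* Y))) =
   cint a (a + 1) (fun x => complex.Re (G (x +i* Y'))).
  apply: (@row_mean_Re _ G a (Y' - 1) (complex.Im z)) => //.
  - by move=> w _; exact: dG.
  - by move=> w _ _; rewrite /G cusp_kernel_period.
  - by clear -Y'Y; lra.
  - by clear; lra.
  - exact: le_lt_trans Y'Y Yz.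
have a1 : a <= a + 1 by rewrite lerDl.
have -> : e = e * ((a + 1) - a) by ring.
apply: cint_bound => //.
  apply: (cont_row _).1 => x _; apply: cdiff_continuous; apply: dG => /=.
  exact: le_lt_trans Y'Y Yz.
move=> x _; apply: le_trans (le_Re_cmod _) _; rewrite cmodM.
have := hs _ Y'z; rewrite mul1r lt_min => /andP[q1 q2].
have := @cusp_kernel_below z (x +i* Y') (le_lt_trans Y'Y Yz) => /=.
set q := expR _ in q1 q2 * => hk.
have q0 : 0 < q by exact: expR_gt0.
have hk2 : cmod (cusp_kernel z (x +i* Y')) <= 2 * q.
  apply: le_trans hk _; rewrite ler_pdivrMr; last by clear -q1; lra.
  have : 0 <= q * (1 - 2 * q) by rewrite mulr_ge0 //; clear -q0 q1; lra.
  by clear; lra.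
apply: (@le_trans _ _ (C * (2 * q))).
  by apply: ler_pM => //; rewrite ?cmod_ge0 // /C; clear; lra.
have -> : C * (2 * q) = q * (2 * C) by ring.
by rewrite -ler_pdivlMr ?mulr_gt0 // ltW.
Qed.

(** Integrate [f w - f z] times the kernel over one period of a row. The singularity at [z] is
    removable, so the row may be moved from height [Y] far up into the cusp, where f vanishes and
    the kernel is close to -1: there the mean is close to [f z]. At height [Y] the contribution of
    the constant [f z] has mean 0 by [cusp_kernel_mean], and what remains is bounded by
    [cusp_kernel_below]. Only real parts are integrated, so a unit factor [u] first turns [f z] into
    a positive number. *)
Lemma cusp_decay f (Y B : R) :
  (forall w, 0 < complex.Im w -> cdiff f w) ->
  (forall w, 0 < complex.Im w -> f (w + 1) = f w) ->
  vanishes_at_cusp f -> 0 < Y -> (forall x, cmod (f (x +i* Y)) <= B) ->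
  forall z, Y < complex.Im z -> cmod (f z) <= B *
    (expR (- (2 * pi * (complex.Im z - Y))) / (1 - expR (- (2 * pi * (complex.Im z - Y))))).
Proof.
move=> df pf vf Y0 fB z Yz.
have B0 : 0 <= B := le_trans (cmod_ge0 _) (fB 0).
set Q := expR _ / _.
have Q0 : 0 <= Q.
  rewrite divr_ge0 ?expR_ge0 // subr_ge0 -[leRHS]expR0 ler_expR oppr_le0.
  by rewrite mulr_ge0 ?(ltW pi2_gt0) // subr_ge0 ltW.
have [->|fz] := eqVneq (f z) 0; first by rewrite cmod0 mulr_ge0.
pose C := cmod (f z); have C0 : 0 < C by rewrite cmod_gt0.
pose u := C%:C / f z.
have cu : cmod u = 1.
  by rewrite cmodM cmodV cmod_real gtr0_norm // mulfV // gt_eqF.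
have ufz : u * f z = C%:C by rewrite divfK.
clearbody u.
pose G w := u * ((f w - f z) * cusp_kernel z w).
pose x0 := complex.Re z; pose y0 := complex.Im z; pose a := x0 - 1 / 2.
have ez : z = x0 +i* y0 by rewrite /x0 /y0; case: (z).
have a1 : a + 1 = x0 + 1 / 2 by rewrite /a; field.
have dG w : 0 < complex.Im w -> 1 - qexp (z - w) != 0 -> cdiff G w.
  move=> w0 qw; apply: (cdiffM (cdiff_cst u w)).
  exact: (cdiffM (cdiffD (df w w0) (cdiff_cst (- f z) w)) (cdiff_cusp_kernel qw)).
have pG w : 0 < complex.Im w -> G (w + 1) = G w by move=> w0; rewrite /G pf // cusp_kernel_period.
have neq1 x y : a <= x <= a + 1 -> (x != x0) || (y != y0) -> 1 - qexp (z - (x +i* y)) != 0.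
  move=> /andP[h1 h2] h; rewrite ez.
  have -> : (x0 +i* y0) - (x +i* y) = (x0 - x) +i* (y0 - y) by [].
  apply: qexp_row_neq1; case/orP: h => h; last by left; rewrite subr_eq0 eq_sym.
  right; split; last by rewrite subr_eq0 eq_sym.
  by rewrite /a in h1; rewrite a1 in h2; apply/andP; split; clear -h1 h2; lra.
have [L L0 [d1 d10 hd1]] := cdiff_near_bound (df z (lt_trans Y0 Yz)).
have [d2 d20 hd2] := qexp_near1.
pose e0 := Num.min 1 (Num.min d1 d2).
have e00 : 0 < e0 by rewrite !lt_min ltr01 d10.
have bG w : w != (x0 +i* y0) -> cmod (w - (x0 +i* y0)) < e0 -> cmod (G w) <= L * expR (2 * pi).
  rewrite -ez => wz; rewrite !lt_min => /and3P[h1 h2 h3].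
  have m0 : 0 < cmod (z - w) by rewrite cmod_gt0 subr_eq0 eq_sym.
  have k1 := hd1 _ h2; rewrite cmodB in h3; have k2 := hd2 _ h3.
  have k3 : cmod (qexp (z - w)) <= expR (2 * pi).
    rewrite cmod_qexpB ler_expR -mulrN ler_piMr ?(ltW pi2_gt0) // opprB.
    have := le_Im_cmod (w - z); rewrite cImD cImN => /(le_trans (ler_norm _)) k4.
    exact: le_trans k4 (ltW h1).
  rewrite cmodM cu mul1r cmodM cmodM cmodV.
  rewrite (cmodB w z) in k1.
  apply: (@le_trans _ _ ((L * cmod (z - w)) * (expR (2 * pi) / cmod (z - w)))).
    apply: ler_pM; rewrite ?mulr_ge0 ?invr_ge0 ?cmod_ge0 //.
    apply: ler_pM; rewrite ?invr_ge0 ?cmod_ge0 //.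
    by rewrite lef_pV2 ?posrE // (lt_le_trans m0).
  by rewrite le_eqVlt; apply/orP; left; apply/eqP; field; rewrite gt_eqF.
pose J y := cint a (a + 1) (fun x => complex.Re (G (x +i* y))).
have a01 : a <= a + 1 by rewrite lerDl.
have JJ y3 : y0 < y3 -> J Y = J y3.
  move=> y03.
  have : rect_int G a (a + 1) Y y3 = 0.
    apply: (@goursat_puncture _ G a (a + 1) Y y3 x0 y0 (L * expR (2 * pi)) e0) => //.
    - by rewrite /a; clear; lra.
    - by rewrite a1; clear; lra.
    - move=> x y hx /andP[hy _] ne; apply: dG; first exact: lt_le_trans Y0 hy.
      exact: neq1.
  rewrite rect_int_period; first by move/eqP; rewrite subr_eq0 => /eqP.
    exact: ltW (lt_trans Yz y03).
  move=> y /andP[hy _]; rewrite -[in RHS]pG //; last exact: lt_le_trans Y0 hy.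
  by congr (G _); apply: ReIm_eq; rewrite /= ?addr0.
have top : C <= J Y.
  apply/ler_addgt0Pl => e ep.
  pose e' := Num.min 1 (e / (2 + C)).
  have e'0 : 0 < e' by rewrite lt_min ltr01 divr_gt0 // addr_gt0.
  have e'1 : e' <= 1 by rewrite ge_min lexx.
  have e'2 : e' * (2 + C) <= e by rewrite -ler_pdivlMr ?addr_gt0 // ge_min lexx orbT.
  have [M [_ hM]] := vf e' e'0.
  pose y3 := Num.max (M + 1) (y0 + e'^-1).
  have y3M : M < y3 by rewrite lt_max ltrDl ltr01.
  have y3y : e'^-1 <= y3 - y0.
    have : y0 + e'^-1 <= y3 by rewrite le_max lexx orbT.
    by clear; lra.
  have t0 : 0 < e'^-1 by rewrite invr_gt0.
  have y03 : y0 < y3 by clear -y3y t0; lra.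
  have ht : 1 + e'^-1 <= expR (2 * pi * (y3 - y0)).
    apply: le_trans (expR_ge1Dx _); rewrite lerD2l; apply: le_trans y3y _.
    rewrite ler_peMl ?subr_ge0 ?(ltW y03) //; have := @pi_ge2 R; lra.
  rewrite (JJ y3) //.
  have cJ : cont_on a (a + 1) (fun x => complex.Re (G (x +i* y3))).
    apply: (cont_row _).1 => x hx; apply: cdiff_continuous; apply: dG => /=.
      exact: lt_trans Y0 (lt_trans Yz y03).
    by apply: neq1 => //; rewrite (gt_eqF y03) orbT.
  rewrite -lerBlDl -[C - e]mulr1 -[X in _ * X](_ : a + 1 - a = 1); last by ring.
  rewrite -cint_cst //; apply: le_cint => //; first exact: cont_on_cst.
  move=> x hx.
  have [] := @cusp_kernel_above z (x +i* y3) _ t0 ht.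
  rewrite invrK => k1 k2; have k3 := hM y3 y3M x.
  have eG : G (x +i* y3) = u * f (x +i* y3) * cusp_kernel z (x +i* y3)
     - C%:C * (cusp_kernel z (x +i* y3) + 1) + C%:C by rewrite -ufz /G; ring.
  have b1 : `|complex.Re (u * f (x +i* y3) * cusp_kernel z (x +i* y3))| <= e' * 2.
    apply: le_trans (le_Re_cmod _) _; rewrite cmodM (cmodM u) cu mul1r.
    apply: ler_pM; [exact: cmod_ge0|exact: cmod_ge0|exact: ltW k3|].
    by apply: le_trans k2 _; clear -e'1; lra.
  have b2 : `|complex.Re (C%:C * (cusp_kernel z (x +i* y3) + 1))| <= C * e'.
    apply: le_trans (le_Re_cmod _) _; rewrite cmodM cmod_real gtr0_norm //.
    by rewrite ler_pM2l.
  rewrite eG cReD (cReD (u * f _ * _)) cReN -[complex.Re C%:C]/C.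
  move: b1 b2 e'2; rewrite !ler_norml => /andP[b1 _] /andP[_ b2].
  by rewrite mulrDr (mulrC e' C); clear -b1 b2; lra.
apply: le_trans top _.
pose H w := u * f w * cusp_kernel z w.
have inY x : 1 - qexp (z - (x +i* Y)) != 0 by apply: qexpB_neq1; rewrite /= lt_eqF.
have cH : cont_on a (a + 1) (fun x => complex.Re (H (x +i* Y))).
  apply: (@cont_row _ H Y a (a + 1) _).1 => x hx; apply: cdiff_continuous.
  exact: (cdiffM (cdiffM (cdiff_cst u _) (df (x +i* Y) Y0)) (cdiff_cusp_kernel (inY x))).
have cK : cont_on a (a + 1) (fun x => complex.Re (C%:C * cusp_kernel z (x +i* Y))).
  apply: (@cont_row _ (fun w => C%:C * cusp_kernel z w) Y a (a + 1) _).1 => x hx; apply: cdiff_continuous.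
  exact: (cdiffM (cdiff_cst C%:C _) (cdiff_cusp_kernel (inY x))).
have -> : J Y = cint a (a + 1) (fun x => complex.Re (H (x +i* Y))).
  rewrite -[RHS]subr0 -(@cusp_kernel_mean C%:C z a Y Yz) -cintB //.
  apply: eq_cint => x _; rewrite -cReN -cReD; congr complex.Re.
  by rewrite -ufz /G /H; ring.
apply: le_trans (ler_norm _) _.
have -> : B * Q = B * Q * ((a + 1) - a) by rewrite (_ : a + 1 - a = 1) ?mulr1 //; ring.
apply: cint_bound => // x _; apply: le_trans (le_Re_cmod _) _.
rewrite cmodM (cmodM u) cu mul1r; apply: ler_pM; rewrite ?cmod_ge0 //.
exact: (@cusp_kernel_below z (x +i* Y)).
Qed.

End CuspDecay.

(** * Unfolding over integer translates of the fundamental domain *)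

Section Unfolding.
Variable R : realType.
Local Notation mu := (@lebesgue_measure R).
Local Notation RR := (measurableTypeR R * measurableTypeR R)%type.
Local Notation mu2 := (mu \x mu)%E.

Section PeriodicFunction.
Variable th : R -> \bar R.
Hypothesis mth : measurable_fun setT th.
Hypothesis th0 : forall x, (0 <= th x)%E.
Hypothesis pth : forall x, th (x + 1) = th x.

Definition perint a b := (\int[mu]_(x in `[a, b[) th x)%E.

Lemma perint_cat a b c : a <= b -> b <= c -> perint a c = (perint a b + perint b c)%E.
Proof.
move=> ab bc; rewrite /perint (@itv_bndbnd_setU _ _ _ (BLeft b)) ?bnd_simp //.
rewrite ge0_integral_setU //.
- exact: measurable_funTS.
- by apply/disj_setPS => x [/=]; rewrite !in_itv /= => /andP[_ xb] /andP[]; rewrite leNgt xb.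
Qed.

Lemma perint_shift a b : perint (a + 1) (b + 1) = perint a b.
Proof.
have mt : measurable_fun setT (th \_ `[a + 1, b + 1[%classic).
  by apply/(measurable_restrictT _ (measurable_itv _)); exact: measurable_funTS.
have t0 x : (0 <= (th \_ `[(a + 1)%R, (b + 1)%R[%classic) x)%E by rewrite /patch; case: ifP.
rewrite /perint [LHS]integral_mkcond [RHS]integral_mkcond.
rewrite -(integral_line_shift 1 mt t0); apply: eq_integral => x _.
rewrite /patch pth; congr (if _ then _ else _).
apply/idP/idP => /set_mem h; apply/mem_set; move: h; rewrite /= !in_itv /=.
  by rewrite lerD2r ltrD2r.
by rewrite lerD2r ltrD2r.
Qed.

Lemma perint_unit a b : a <= b -> b <= a + 1 -> perint a (a + 1) = perint b (b + 1).
Proof.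
move=> ab ba; rewrite (perint_cat ab ba) (@perint_cat b (a + 1) (b + 1)) //.
  by rewrite perint_shift addeC.
by rewrite lerD2r.
Qed.

Lemma perint_shift_nat a n : perint (a + n%:R) (a + n%:R + 1) = perint a (a + 1).
Proof.
elim: n => [|n IH]; first by rewrite addr0.
by rewrite -natr1 addrA perint_shift.
Qed.

Lemma perint_any a b : perint a (a + 1) = perint b (b + 1).
Proof.
wlog ab : a b / a <= b.
  by move=> H; have [/H|/ltW /H] := leP a b.
pose n := Num.truncn (b - a).
have h0 : 0 <= b - a by rewrite subr_ge0.
have [h1 h2] : a + n%:R <= b /\ b <= a + n%:R + 1.
  have := truncn_itv h0; rewrite -/n -natr1 => /andP[? ?]; split; lra.
by rewrite -(perint_shift_nat a n) (perint_unit h1 h2).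
Qed.

Lemma perint_mul a b m : (perint a (a + m%:R)%R = m%:R%:E * perint b (b + 1)%R)%E.
Proof.
elim: m => [|m IH]; first by rewrite addr0 mul0e /perint set_itvco0 integral_set0.
have e : a + m.+1%:R = a + m%:R + 1 by rewrite -natr1 addrA.
rewrite e (@perint_cat a (a + m%:R)); last 2 first.
- by rewrite lerDl ler0n.
- by rewrite lerDl.
by rewrite IH (perint_any (a + m%:R) b) -natr1 EFinD ge0_muleDl ?mul1e // lee_fin ler0n.
Qed.

End PeriodicFunction.

Definition fund_set : set RR := [set p | fund_dom (p.1 +i* p.2)].

Lemma fund_setE (p : RR) : fund_set p <->
  [/\ 0 < p.2, 1 <= p.1 ^+ 2 + p.2 ^+ 2 & - (1 / 2) <= p.1 <= 1 / 2].
Proof.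
rewrite /fund_set /fund_dom /=; have -> : (1 <= cmod (p.1 +i* p.2)) = (1 <= p.1 ^+ 2 + p.2 ^+ 2).
  by rewrite -[in RHS](expr1n R 2) -(cmod_sqr (p.1 +i* p.2)) ler_pXn2r ?nnegrE ?cmod_ge0.
by split=> [[]|[]].
Qed.

Lemma upper_open : box_open [set p : RR | 0 < p.2].
Proof.
move=> p /= p0; exists p.2 => // q _; rewrite ltr_norml => /andP[+ _].
by clear; lra.
Qed.

Lemma measurable_upper : measurable [set p : RR | 0 < p.2].
Proof. exact: box_open_measurable upper_open. Qed.

Lemma fund_dom_Im_sqr (z : R[i]) : fund_dom z -> 3 / 4 <= complex.Im z ^+ 2.
Proof.
case: z => x y /(fund_setE (x, y)) [/= _ h /andP[xl xr]].
have : x ^+ 2 <= (1 / 2) ^+ 2.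
  by rewrite -(real_normK (num_real x)) ler_pXn2r ?nnegrE // ler_norml xl xr.
by move: h; lra.
Qed.

Lemma fund_dom_Im (z : R[i]) : fund_dom z -> 59 / 70 <= complex.Im z.
Proof.
move=> fz; have y34 := fund_dom_Im_sqr fz; have [y0 _ _] := fz.
rewrite -(@ler_pXn2r _ 2) ?nnegrE ?(ltW y0) //.
by apply: le_trans y34; lra.
Qed.

Lemma measurable_fund_set : measurable fund_set.
Proof.
have -> : fund_set = [set p | 0 < p.2] `&` (~` (@disc R 1) `&` (`[- (1 / 2), 1 / 2]%classic `*` setT)).
  apply/seteqP; split=> p.
    move=> /fund_setE [h1 h2 h3]; split=> //; split.
      by rewrite /disc /= expr1n; apply/negP; rewrite -leNgt.
    by split => //=; rewrite in_itv.
  move=> [h1 [h2 [h3 _]]]; apply/fund_setE; split => //.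
    by move/negP: h2; rewrite /= expr1n -leNgt.
apply: measurableI; first exact: measurable_upper.
apply: measurableI; first exact: measurableC (@measurable_disc R 1).
by apply: measurableX => //; exact: measurable_itv.
Qed.

Definition translates : set RR := [set p | exists n : int, fund_set (p.1 + n%:~R, p.2)].

Lemma measurable_translates : measurable translates.
Proof.
rewrite (_ : translates = \bigcup_(n : int) (fun p : RR => (p.1 + n%:~R, p.2) : RR) @^-1` fund_set).
  apply: countable_bigcupT_measurable; first exact: countableP.
  move=> n; rewrite -[_ @^-1` _]setTI.
  have h := (hshear_area_preserving (@measurable_cst _ _ _ _ setT (n%:~R : R))).1.
  exact: h measurable_fund_set.
by apply/seteqP; split=> [p [n h]|p [n _ h]]; exists n.
Qed.

Lemma translates_strip (p : RR) : translates p -> - (1 / 2) <= p.1 < - (1 / 2) + 1 -> fund_set p.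
Proof.
move=> [n /fund_setE /= [h1 h2 /andP[h3 h4]]] /andP[h5 h6].
have n1 : (-1 < n)%R by rewrite -(ltr_int R); clear -h3 h6; rewrite mulrN1z; lra.
have n2 : (n < 2)%R by rewrite -(ltr_int R); clear -h4 h5; lra.
have [n0|n0] : n = 0 \/ n = 1 by lia.
  by apply/fund_setE; rewrite n0 addr0 in h2; split => //; rewrite h5 /=; clear -h6; lra.
have e : p.1 = - (1 / 2) by rewrite n0 in h4; clear -h4 h5; lra.
apply/fund_setE; split => //; last by rewrite e lexx /=; lra.
by move: h2; rewrite n0 e; clear; lra.
Qed.

(** Tonelli reduces the count of the translates met by [A] to rows, where a periodic function has
    the same integral over every interval of length 1. *)
Lemma unfolding (Phi : RR -> \bar R) (A : set RR) (a : R) (m : nat) :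
  measurable_fun setT Phi -> (forall p, 0 <= Phi p)%E ->
  (forall p, Phi (p.1 + 1, p.2) = Phi p) -> measurable A ->
  (forall p, A p -> a <= p.1 < a + m%:R) -> (forall p, A p -> translates p) ->
  (\int[mu2]_(p in A) Phi p <= m%:R%:E * \int[mu2]_(p in fund_set) Phi p)%E.
Proof.
move=> mP P0 pP mA Aa At.
pose Th := Phi \_ translates.
have mT : measurable_fun setT Th.
  by apply/(measurable_restrictT _ measurable_translates); exact: measurable_funTS.
have T0 p : (0 <= Th p)%E by rewrite /Th /patch; case: ifP.
have pT p : Th (p.1 + 1, p.2) = Th p.
  rewrite /Th /patch pP; congr (if _ then _ else _).
  apply/idP/idP => /set_mem [n hn]; apply/mem_set.
    by exists (1 + n); move: hn; rewrite /= intrD addrA.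
  by exists (n - 1); move: hn; rewrite /= intrD addrACA mulrN1z subrr addr0.
pose strip b c : set RR := `[b, c[%classic `*` setT.
have mS b c : measurable (strip b c) by apply: measurableX => //; exact: measurable_itv.
have mTS b c : measurable_fun setT (Th \_ (strip b c)).
  by apply/(measurable_restrictT _ (mS b c)); exact: measurable_funTS.
have TS0 b c p : (0 <= (Th \_ (strip b c)) p)%E by rewrite /patch; case: ifP.
have stripG b c y : perint (fun x => Th (x, y)) b c = fubini_G mu (Th \_ (strip b c)) y.
  rewrite /fubini_G /perint [LHS]integral_mkcond.
  apply: eq_integral => x _; rewrite /patch; congr (if _ then _ else _).
  by apply/idP/idP => /set_mem h; apply/mem_set; move: h; rewrite /strip /=; [split|case].
have stripE b c : (\int[mu2]_(p in strip b c) Th p = \int[mu]_y perint (fun x => Th (x, y)) b c)%E.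
  rewrite integral_mkcond fubini_tonelli2 //.
  by apply: eq_integral => y _; rewrite stripG.
have m1 y : measurable_fun setT (fun x : measurableTypeR R => Th (x, y)).
  exact: (measurableT_comp mT (measurable_pair2 y)).
have le1 : (\int[mu2]_(p in A) Phi p <= \int[mu2]_(p in strip a (a + m%:R)%R) Th p)%E.
  rewrite (_ : (\int[mu2]_(p in A) Phi p = \int[mu2]_(p in A) Th p)%E); last first.
    by apply: eq_integral => p /set_mem /At h; rewrite /Th /patch mem_set.
  apply: ge0_subset_integral => //; first exact: measurable_funTS.
  by move=> p /Aa h; split => //=; rewrite in_itv.
apply: (le_trans le1); move: le1 => _.
rewrite stripE.
under eq_integral do rewrite (@perint_mul _ (m1 _) (fun x => T0 _) (fun x => pT (x, _)) a (- (1 / 2)) m).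
rewrite ge0_integralZl //; last 2 first.
- rewrite (_ : (fun y => _) = fubini_G mu (Th \_ (strip (- (1 / 2)) (- (1 / 2) + 1)))); last first.
    by apply/funext => y; rewrite stripG.
  exact: measurable_fun_fubini_tonelli_G.
- by move=> y _; apply: integral_ge0.
rewrite -stripE lee_wpmul2l //.
rewrite (_ : (\int[mu2]_(p in fund_set) Phi p = \int[mu2]_p (Phi \_ fund_set) p)%E); last exact: integral_mkcond.
rewrite integral_mkcond; apply: ge0_le_integral.
- exact: measurableT.
- by move=> p _; exact: TS0.
- exact: mTS.
- by apply/(measurable_restrictT _ measurable_fund_set); exact: measurable_funTS.
move=> p _; rewrite [leLHS]/patch; have [/set_mem [ps _]|_] := boolP (p \in strip _ _); last first.
  by rewrite /patch; case: ifP => _.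
rewrite [leLHS]/patch; have [/set_mem pt|_] := boolP (p \in translates); last first.
  by rewrite /patch; case: ifP => _.
rewrite /patch mem_set //; apply: translates_strip => //.
Qed.

End Unfolding.

(** * Heights and their local mean value inequality *)

Section LocalEstimates.
Variable R : realType.
Local Notation mu := (@lebesgue_measure R).
Local Notation RR := (measurableTypeR R * measurableTypeR R)%type.
Local Notation mu2 := (mu \x mu)%E.
Implicit Types (f : R[i] -> R[i]) (n : nat).

(** For f of weight 2k and n = 2k this function on the upper half-plane is invariant under the
    modular group. *)
Definition height f n (z : R[i]) : R := cmod (f z) ^+ 2 * complex.Im z ^+ n.

Lemma height_ge0 f n z : 0 < complex.Im z -> 0 <= height f n z.
Proof. by move=> z0; rewrite mulr_ge0 ?exprn_ge0 ?cmod_ge0 // ltW. Qed.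

Lemma bernoulli_le (s : R) n : 0 <= s <= 1 -> 1 - n%:R * s <= (1 - s) ^+ n.
Proof.
move=> /andP[s0 s1]; elim: n => [|n IH]; first by rewrite mul0r subr0 expr0.
rewrite exprS -natr1.
have h : 0 <= n%:R * s * s by rewrite !mulr_ge0.
apply: le_trans (_ : (1 - s) * (1 - n%:R * s) <= _); first by clear -h; lra.
by rewrite ler_wpM2l // subr_ge0.
Qed.

(** Around a point at height y0, y^n is the squared modulus of the holomorphic function
    (1 - i w / (2 y0))^n times a factor that is radial up to second order. *)
Lemma height_factor (y0 u v : R) n (rho : R) : 0 < y0 -> 0 < rho < 1 ->
  u ^+ 2 + v ^+ 2 < (rho * y0) ^+ 2 ->
  y0 ^+ n * ((1 - n%:R / (y0 * (2 - rho)) ^+ 2 * (u ^+ 2 + v ^+ 2)) *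
    cmod ((1 + v / (2 * y0)) +i* (- (u / (2 * y0)))) ^+ (2 * n)) <= (y0 + v) ^+ n.
Proof.
move=> y00 /andP[r0 r1] uv.
rewrite exprM cmod_sqr /=; set B := (1 + v / (2 * y0)) ^+ 2 + (- (u / (2 * y0))) ^+ 2.
have vlo : - (rho * y0) < v.
  have : v ^+ 2 < (rho * y0) ^+ 2 by apply: le_lt_trans uv; rewrite lerDr sqr_ge0.
  rewrite -(real_normK (num_real v)) ltr_pXn2r ?nnegrE ?mulr_ge0 ?(ltW r0) ?(ltW y00) //.
  by rewrite ltr_norml => /andP[].
have lb : 1 - rho / 2 <= 1 + v / (2 * y0).
  rewrite lerD2l -lerN2 opprK -mulNr ler_pdivrMr ?mulr_gt0 //.
  have -> : rho / 2 * (2 * y0) = rho * y0 by field.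
  by clear -vlo; lra.
have Blb : (2 - rho) ^+ 2 / 4 <= B.
  rewrite /B; apply: le_trans (_ : (1 + v / (2 * y0)) ^+ 2 <= _); last by rewrite lerDl sqr_ge0.
  have -> : (2 - rho) ^+ 2 / 4 = (1 - rho / 2) ^+ 2 by field.
  by rewrite ler_pXn2r ?nnegrE //; move: lb; clear -r1; lra.
have B0 : 0 < B by apply: lt_le_trans Blb; rewrite divr_gt0 // exprn_gt0 //; clear -r1; lra.
set q := u ^+ 2 + v ^+ 2 in uv *; pose s := q / (4 * y0 ^+ 2).
have eB : B * (1 - s / B) = B - s by rewrite mulrBr mulr1 [B * (s / B)]mulrC divfK // gt_eqF.
have eyv : y0 + v = y0 * (B * (1 - s / B)) by rewrite eB /B /s /q; field; rewrite gt_eqF.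
have q0 : 0 <= q by rewrite addr_ge0 ?sqr_ge0.
have s0 : 0 <= s by rewrite divr_ge0 // mulr_ge0 // sqr_ge0.
have d0 : 0 < (y0 * (2 - rho)) ^+ 2 by rewrite exprn_gt0 // mulr_gt0 //; clear -r1; lra.
have sB : s / B <= q / (y0 * (2 - rho)) ^+ 2.
  have p1 : 0 < 4 * y0 ^+ 2 * B by rewrite !mulr_gt0 ?exprn_gt0.
  rewrite /s -mulrA -invfM ler_wpM2l // lef_pV2 ?posrE //.
  have -> : 4 * y0 ^+ 2 * B = y0 ^+ 2 * (4 * B) by ring.
  by rewrite exprMn ler_wpM2l ?sqr_ge0 //; move: Blb; clear; lra.
have sB1 : s / B <= 1.
  apply: le_trans sB _; rewrite ler_pdivrMr // mul1r.
  apply: ltW; apply: lt_le_trans uv _; rewrite !exprMn mulrC ler_wpM2l ?sqr_ge0 //.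
  by rewrite ler_pXn2r ?nnegrE //; clear -r0 r1; lra.
rewrite eyv [in leRHS]exprMn ler_wpM2l ?exprn_ge0 ?(ltW y00) // [in leRHS]exprMn.
rewrite [leLHS]mulrC ler_wpM2l ?exprn_ge0 ?(ltW B0) //.
apply: le_trans (bernoulli_le n _); last by rewrite sB1 divr_ge0 // ltW.
rewrite lerD2l lerN2 [leRHS](_ : _ = n%:R * (q / (y0 * (2 - rho)) ^+ 2)); last by rewrite mulrAC mulrA.
by rewrite ler_wpM2l.
Qed.

Lemma measurable_height f n : (forall w, 0 < complex.Im w -> cdiff f w) ->
  measurable_fun [set p : RR | 0 < p.2] (fun p => height f n (p.1 +i* p.2)).
Proof.
move=> df; apply: measurable_funM.
  apply: measurable_funX; apply: box_cont_measurable; first exact: upper_open.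
  move=> p p0; apply: box_cont_cmod; apply: cdiff_continuous; exact: df.
apply: measurable_funX; apply: measurable_funTS; exact: measurable_snd.
Qed.

Lemma disc_upper (y0 rho : R) (p : RR) : 0 < y0 -> 0 < rho ->
  @disc R (rho * y0) p -> y0 * (1 - rho) < y0 + p.2 < y0 * (1 + rho) /\ - (rho * y0) < p.1 < rho * y0.
Proof.
move=> y00 r0 h.
have r : 0 <= rho * y0 by rewrite mulr_ge0 // ltW.
have h1 : `|p.1| < rho * y0.
  rewrite -(@ltr_pXn2r _ 2) ?nnegrE // real_normK ?num_real //.
  by apply: le_lt_trans h; rewrite lerDl sqr_ge0.
have h2 : `|p.2| < rho * y0.
  rewrite -(@ltr_pXn2r _ 2) ?nnegrE // real_normK ?num_real //.
  by apply: le_lt_trans h; rewrite lerDr sqr_ge0.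
move: h1 h2; rewrite !ltr_norml => -> /andP[h3 h4]; split => //.
by rewrite mulrBr mulrDr mulr1 (mulrC y0 rho); clear -h3 h4; apply/andP; split; lra.
Qed.

Lemma measurable_height_shift f n (x0 y0 rho : R) : (forall w, 0 < complex.Im w -> cdiff f w) ->
  0 < y0 -> 0 < rho < 1 -> measurable_fun (@disc R (rho * y0))
    (fun p => height f n ((x0 + p.1) +i* (y0 + p.2))).
Proof.
move=> df y00 /andP[r0 r1].
apply: (@measurable_comp _ _ _ _ _ _ [set p : RR | 0 < p.2]
  (fun p : RR => height f n (p.1 +i* p.2)) _ (fun p : RR => (x0 + p.1, y0 + p.2) : RR)).
- exact: measurable_upper.
- move=> _ [p hp <-] /=; have [/andP[h _] _] := disc_upper y00 r0 hp.
  by apply: lt_trans h; rewrite mulr_gt0 // subr_gt0.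
- exact: measurable_height.
- apply: measurable_funTS; apply/measurable_fun_pairP; split.
    by apply: measurable_funD; [exact: measurable_cst|exact: measurable_fst].
  by apply: measurable_funD; [exact: measurable_cst|exact: measurable_snd].
Qed.

(** The area mean value property applied to the holomorphic part of the height. *)
Lemma height_submean f n (x0 y0 rho : R) : (forall w, 0 < complex.Im w -> cdiff f w) ->
  0 < y0 -> 0 < rho < 1 -> n%:R * rho ^+ 2 <= (2 - rho) ^+ 2 ->
  ((height f n (x0 +i* y0) * (pi * (rho * y0) ^+ 2 * (1 - n%:R * rho ^+ 2 / (2 - rho) ^+ 2 / 2)))%:E <=
   \int[mu2]_(p in @disc R (rho * y0)) (height f n ((x0 + p.1) +i* (y0 + p.2)))%:E)%E.
Proof.
move=> df y00 hr nr; have /andP[r0 r1] := hr.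
have r20 : 0 < 2 - rho by clear -r1; lra.
pose c := n%:R / (y0 * (2 - rho)) ^+ 2.
have c0 : 0 <= c by rewrite divr_ge0 // sqr_ge0.
have ec : c * (rho * y0) ^+ 2 = n%:R * rho ^+ 2 / (2 - rho) ^+ 2.
  by rewrite /c; field; rewrite !gt_eqF.
have cr : c * (rho * y0) ^+ 2 <= 1 by rewrite ec ler_pdivrMr ?mul1r // exprn_gt0.
have ry : 0 < rho * y0 by rewrite mulr_gt0.
pose E (w : R[i]) : R[i] := 1 + (0 -i* (2 * y0)^-1) * w.
pose g w := (f (w + (x0 +i* y0)) * E w ^+ n) ^+ 2.
have inup w : cmod w < rho * y0 -> 0 < complex.Im (w + (x0 +i* y0)).
  move=> h; have := lt_trans (le_lt_trans (le_Im_cmod w) h) (_ : rho * y0 < y0).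
  rewrite gtr_pMl // r1 cImD /= => /(_ isT); rewrite ltr_norml => /andP[+ _].
  by clear; lra.
have dg w : cmod w < rho * y0 -> cdiff g w.
  move=> h; apply: cdiffX; apply: cdiffM.
    apply: (@cdiff_comp _ f (fun w => w + (x0 +i* y0))); last exact: df (inup _ h).
    exact: (cdiffD (cdiff_id w) (cdiff_cst (x0 +i* y0) w)).
  apply: cdiffX; exact: (cdiffD (cdiff_cst 1 w) (cdiffM (cdiff_cst (0 -i* (2 * y0)^-1) w) (cdiff_id w))).
have := @disc_mean R g (fun p => 1 - c * (p.1 ^+ 2 + p.2 ^+ 2)) (rho * y0) ry dg.
have wpos p : @disc R (rho * y0) p -> 0 <= 1 - c * (p.1 ^+ 2 + p.2 ^+ 2).
  by move=> h; rewrite subr_ge0; apply: le_trans cr; rewrite ler_wpM2l // ltW.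
move=> /(_ (@measurable_weight R c setT) wpos).
have wrot (a b : R) (p : RR) : a ^+ 2 + b ^+ 2 = 1 ->
   1 - c * ((plane_rot a b p).1 ^+ 2 + (plane_rot a b p).2 ^+ 2) = 1 - c * (p.1 ^+ 2 + p.2 ^+ 2).
  by move=> ab; rewrite rot_norm2.
move=> /(_ wrot); rewrite (disc_weight ry c0 cr).
have -> : cmod (g 0) = cmod (f (x0 +i* y0)) ^+ 2.
  by rewrite /g /E mulr0 addr0 expr1n mulr1 add0r cmodX.
rewrite -EFinM ec => H.
have yn0 : 0 <= y0 ^+ n by rewrite exprn_ge0 // ltW.
rewrite /height [complex.Im _]/= mulrAC -mulrA [leLHS](_ : _ = (y0 ^+ n)%:E * (cmod (f (x0 +i* y0)) ^+ 2 *
   (pi * (rho * y0) ^+ 2 * (1 - n%:R * rho ^+ 2 / (2 - rho) ^+ 2 / 2)))%:E)%E; last first.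
  by rewrite -EFinM; congr (_%:E); ring.
apply: le_trans (lee_wpmul2l _ H) _; first by rewrite lee_fin.
have mg : measurable_fun (@disc R (rho * y0)) (fun p : RR => cmod (g (p.1 +i* p.2))).
  apply: box_cont_measurable; first exact: disc_open.
  move=> p hp; apply: box_cont_cmod; apply: cdiff_continuous; apply: dg.
  by rewrite -(@ltr_pXn2r _ 2) ?nnegrE ?cmod_ge0 ?(ltW ry) // cmod_sqr.
have mwg : measurable_fun (@disc R (rho * y0)) (fun p : RR =>
    ((1 - c * (p.1 ^+ 2 + p.2 ^+ 2)) * cmod (g (p.1 +i* p.2)))%:E).
  by apply/measurable_EFinP; apply: measurable_funM => //; exact: measurable_weight.
have wg0 p : @disc R (rho * y0) p ->
    (0 <= ((1 - c * (p.1 ^+ 2 + p.2 ^+ 2)) * cmod (g (p.1 +i* p.2)))%:E)%E.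
  by move=> hp; rewrite lee_fin mulr_ge0 ?cmod_ge0 // wpos.
have yn0' : (0 <= (y0 ^+ n)%:E)%E by rewrite lee_fin.
rewrite -(ge0_integralZl mu2 (@measurable_disc R (rho * y0)) mwg wg0 yn0').
apply: ge0_le_integral.
- exact: measurable_disc.
- by move=> p hp; rewrite -EFinM lee_fin mulr_ge0 // mulr_ge0 ?cmod_ge0 // wpos.
- by apply: measurable_funeM.
- by apply/measurable_EFinP; exact: measurable_height_shift.
move=> p hp; rewrite -EFinM lee_fin /height [complex.Im _]/=.
have := height_factor n y00 hr hp; rewrite -/c => hf.
have eE : E (p.1 +i* p.2) = (1 + p.2 / (2 * y0)) +i* (- (p.1 / (2 * y0))).
  by apply: ReIm_eq; rewrite /E ?cReD ?cImD ?cReM ?cImM /=; field; rewrite gt_eqF.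
have -> : cmod (g (p.1 +i* p.2)) = cmod (f ((x0 + p.1) +i* (y0 + p.2))) ^+ 2 *
   cmod ((1 + p.2 / (2 * y0)) +i* (- (p.1 / (2 * y0)))) ^+ (2 * n).
  rewrite /g eE cmodX cmodM cmodX exprMn -exprM mulnC; congr (cmod (f _) ^+ 2 * _).
  by apply: ReIm_eq; rewrite /= addrC.
set A := cmod (f _) ^+ 2; have A0 : 0 <= A by rewrite sqr_ge0.
set K := cmod _ ^+ (2 * n) in hf *; set W := 1 - _ in hf *.
have -> : y0 ^+ n * (W * (A * K)) = A * (y0 ^+ n * (W * K)) by ring.
exact: ler_wpM2l hf.
Qed.

End LocalEstimates.

(** * Heights bounded by the Petersson norm *)

Section DiscBounds.
Variable R : realType.
Local Notation mu := (@lebesgue_measure R).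
Local Notation RR := (measurableTypeR R * measurableTypeR R)%type.
Local Notation mu2 := (mu \x mu)%E.
Variables (f : R[i] -> R[i]) (n : nat).
Hypothesis df : forall w, 0 < complex.Im w -> cdiff f w.
Hypothesis pf : forall w, 0 < complex.Im w -> f (w + 1) = f w.

Definition density (p : RR) : \bar R := (height f n (p.1 +i* p.2) / p.2 ^+ 2)%:E.

(** Extended by 0 to the lower half-plane, the Petersson integrand is measurable on the whole plane,
    as unfolding requires. *)
Definition upper_density := density \_ [set p : RR | 0 < p.2].

Lemma upper_density_ge0 p : (0 <= upper_density p)%E.
Proof.
rewrite /upper_density /patch; case: ifPn => // /set_mem /= p0.
by rewrite lee_fin divr_ge0 ?sqr_ge0 // height_ge0.
Qed.

Lemma measurable_upper_density : measurable_fun setT upper_density.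
Proof.
apply/(measurable_restrictT _ (@measurable_upper R))/measurable_EFinP.
apply: measurable_funM; first exact: measurable_height.
apply: box_cont_measurable; first exact: upper_open.
move=> p /= p0; apply: (@box_cont_fun2 R (fun y => (y ^+ 2)^-1) p).
have y0 : p.2 ^+ 2 != 0 :> R by rewrite gt_eqF // exprn_gt0.
exact: (@cvgV R _ (nbhs (p.2 : R^o)) _ (fun y : R => y ^+ 2) _ y0 (@cont_sqr R p.2)).
Qed.

Lemma upper_density_period (p : RR) : upper_density (p.1 + 1, p.2) = upper_density p.
Proof.
rewrite /upper_density /patch; have [p0|p0] := ltP 0 p.2; last first.
  by rewrite !memNset //=; apply/negP; rewrite -leNgt.
rewrite !mem_set //= /density /height /= -[in RHS]pf //.
by congr ((cmod (f _) ^+ 2 * _ / _)%:E); apply: ReIm_eq; rewrite /= ?addr0.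
Qed.

Lemma translates_high (p : RR) : 1 <= p.2 -> translates p.
Proof.
move=> p1; have p0 : 0 < p.2 by apply: lt_le_trans p1.
pose m := Num.floor (p.1 + 1 / 2); exists (- m); apply/fund_setE; split => //=.
  apply: le_trans (_ : p.2 ^+ 2 <= _); last by rewrite lerDr sqr_ge0.
  by rewrite -[leLHS](expr1n R 2) ler_pXn2r ?nnegrE // ltW.
have /andP[h1 h2] := floor_itv (p.1 + 1 / 2); rewrite -/m in h1 h2.
rewrite intrD in h2; rewrite mulrNz; apply/andP; split; lra.
Qed.

Variables (x0 y0 rho N : R).
Hypothesis y00 : 0 < y0.
Hypothesis hrho : 0 < rho < 1.
Hypothesis hN : (\int[mu2]_(p in @fund_set R) upper_density p = N%:E)%E.

(** On the disc y is less than y0 (1 + rho), which compares dx dy with dx dy / y^2; a disc of width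
    at most m meets each orbit of integer translations at most m times. *)
Lemma local_unfold (A : set RR) (m : nat) : measurable A -> A `<=` @disc R (rho * y0) ->
  (forall p, A p -> translates ((x0 + p.1, y0 + p.2) : RR)) -> 2 * (rho * y0) <= m%:R ->
  (\int[mu2]_(p in A) (height f n ((x0 + p.1) +i* (y0 + p.2)))%:E <=
   ((y0 * (1 + rho)) ^+ 2 * (m%:R * N))%:E)%E.
Proof.
move=> mA Ad At hm; have /andP[r0 r1] := hrho.
pose sh (p : RR) : RR := (p.1 + x0, p.2 + y0).
pose ush (p : RR) : RR := (p.1 - x0, p.2 - y0).
pose A' : set RR := ush @^-1` A.
have mA' : measurable A'.
  rewrite -[A']setTI; exact: ((shift_area_preserving (- x0) (- y0)).1 measurableT _ mA).
pose H (q : RR) : \bar R := (height f n (q.1 +i* q.2))%:E.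
have A'p q : A' q -> [/\ y0 * (1 - rho) < q.2, q.2 < y0 * (1 + rho) & x0 - rho * y0 < q.1 < x0 + rho * y0].
  move=> /Ad /(disc_upper y00 r0) /=; rewrite subrKC => -[/andP[-> ->] /andP[h1 h2]].
  by split => //; apply/andP; split; lra.
have A'0 q : A' q -> 0 < q.2.
  by move=> /A'p [h _ _]; apply: lt_trans h; rewrite mulr_gt0 // subr_gt0.
have mH : measurable_fun A' H.
  apply/measurable_EFinP; apply: measurable_funS (measurable_height n df) => //.
  exact: measurable_upper.
have mHA : measurable_fun setT (H \_ A') by apply/(measurable_restrictT _ mA').
have HA0 q : (0 <= (H \_ A') q)%E.
  rewrite /patch; case: ifPn => // /set_mem /A'0 q0.
  by rewrite lee_fin height_ge0.
have e1 : (\int[mu2]_(p in A) (height f n ((x0 + p.1) +i* (y0 + p.2)))%:E =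
   \int[mu2]_(q in A') H q)%E.
  rewrite integral_mkcond [RHS]integral_mkcond -((shift_area_preserving x0 y0).2 _ mHA HA0).
  apply: eq_integral => p _; rewrite /patch /H /= (addrC x0) (addrC y0).
  congr (if _ then _ else _); apply/idP/idP => /set_mem h; apply/mem_set.
    by rewrite /A' /preimage /ush /= !addrK -surjective_pairing.
  by move: h; rewrite /A' /preimage /ush /= !addrK -surjective_pairing.
rewrite e1; pose K := (y0 * (1 + rho)) ^+ 2.
have K0 : 0 <= K by exact: sqr_ge0.
have mU := measurable_upper_density.
have le1 : (\int[mu2]_(q in A') H q <= \int[mu2]_(q in A') (K%:E * upper_density q))%E.
  apply: ge0_le_integral => //.
  - by move=> q /A'0 q0; rewrite lee_fin height_ge0.
  - by apply: measurable_funeM; exact: measurable_funTS.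
  move=> q Aq; have q0 := A'0 _ Aq; have [_ h2 _] := A'p _ Aq.
  rewrite /upper_density /patch mem_set // /density -EFinM lee_fin.
  rewrite mulrCA ler_peMr ?height_ge0 // ler_pdivlMr ?exprn_gt0 // mul1r.
  by rewrite /K ler_pXn2r ?nnegrE ?(ltW q0) ?(ltW h2) // mulr_ge0 ?ltW // addr_gt0.
have K0' : (0 <= K%:E)%E by rewrite lee_fin.
have mUA : measurable_fun A' upper_density := measurable_funTS mU.
apply: (le_trans le1).
rewrite (ge0_integralZl mu2 mA' mUA (fun q _ => upper_density_ge0 q) K0').
rewrite -/K [leRHS](EFinM K) lee_wpmul2l //.
rewrite (EFinM m%:R) -hN.
apply: (@unfolding _ upper_density A' (x0 - rho * y0)) => //.
- exact: upper_density_ge0.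
- exact: upper_density_period.
- move=> q /A'p [_ _ /andP[h1 h2]]; rewrite (ltW h1) /=.
  by apply: lt_le_trans h2 _; lra.
- by move=> q /At; rewrite /= !subrKC -surjective_pairing.
Qed.

Hypothesis hn : n%:R * rho ^+ 2 <= (2 - rho) ^+ 2.

(** If the disc lies above height 1, all of it is covered by translates of the fundamental domain. *)
Lemma interior_bound (m : nat) : 1 <= y0 * (1 - rho) -> 2 * (rho * y0) <= m%:R ->
  height f n (x0 +i* y0) * (pi * rho ^+ 2 * (1 - n%:R * rho ^+ 2 / (2 - rho) ^+ 2 / 2))
    <= (1 + rho) ^+ 2 * (m%:R * N).
Proof.
move=> hy hm; have /andP[r0 r1] := hrho.
have sub := height_submean x0 df y00 hrho hn.
have := le_trans sub (@local_unfold _ m (@measurable_disc R _) (fun p h => h) _ hm).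
have tr p : @disc R (rho * y0) p -> translates ((x0 + p.1, y0 + p.2) : RR).
  move=> /(disc_upper y00 r0) [/andP[h _] _]; apply: translates_high => /=.
  by apply: ltW; apply: le_lt_trans h.
move=> /(_ tr); rewrite lee_fin.
have -> : height f n (x0 +i* y0) *
  (pi * (rho * y0) ^+ 2 * (1 - n%:R * rho ^+ 2 / (2 - rho) ^+ 2 / 2)) = y0 ^+ 2 *
  (height f n (x0 +i* y0) * (pi * rho ^+ 2 * (1 - n%:R * rho ^+ 2 / (2 - rho) ^+ 2 / 2))) by ring.
have -> : (y0 * (1 + rho)) ^+ 2 * (m%:R * N) = y0 ^+ 2 * ((1 + rho) ^+ 2 * (m%:R * N)) by ring.
by rewrite ler_pM2l // exprn_gt0.
Qed.

(** The third of the plane within 60 degrees of the upward vertical. *)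
Definition up_sector : set RR := [set p | 0 <= p.2 /\ p.1 ^+ 2 <= 3 * p.2 ^+ 2].

Lemma measurable_up_sector : measurable up_sector.
Proof.
have -> : up_sector = ~` [set p | p.2 < 0] `&` ~` [set p | 3 * p.2 ^+ 2 < p.1 ^+ 2].
  apply/seteqP; split=> p [h1 h2]; split.
  - by apply/negP; rewrite -leNgt.
  - by apply/negP; rewrite -leNgt.
  - by move/negP: h1; rewrite -leNgt.
  - by move/negP: h2; rewrite -leNgt.
apply: measurableI; apply: measurableC; apply: box_open_measurable.
  move=> p /= p0; exists (- p.2); rewrite ?oppr_gt0 // => q _; rewrite ltr_norml => /andP[_].
  by lra.
move=> p /= h.
have cc : box_cont (fun q : RR => q.1 ^+ 2 + (- 3) * q.2 ^+ 2) p.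
  apply: (@box_contD R (fun q => q.1 ^+ 2) (fun q => - 3 * q.2 ^+ 2)).
    exact: (@box_cont_fun R (fun x => x ^+ 2) p (@cont_sqr R p.1)).
  apply: (@box_cont_fun2 R (fun x => - 3 * x ^+ 2) p).
  by apply: cvgM; [exact: cvg_cst|exact: cont_sqr].
have [|d d0 hd] := cc (p.1 ^+ 2 + (- 3) * p.2 ^+ 2); first by lra.
exists d => // q q1 q2; have := hd q q1 q2; rewrite ltr_norml => /andP[+ _].
by lra.
Qed.

(** Rotations by a third of a turn are isometries, and three of them spread the sector over the
    whole disc. *)
Lemma sector_third (r : R) : 0 < r ->
  (mu2 (@disc R r `\` up_sector) <= (2 / 3 * (pi * r ^+ 2))%:E)%E.
Proof.
move=> r0; have mD := @measurable_disc R r; have mS := measurable_up_sector.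
pose S := @disc R r `&` up_sector; have mS' : measurable S by exact: measurableI.
have areaD : mu2 (@disc R r) = (pi * r ^+ 2)%:E.
  have := @disc_weight R 0 r r0 (lexx 0); rewrite mul0r => /(_ ler01).
  rewrite mul0r subr0 mulr1 => <-.
  under eq_integral do rewrite mul0r subr0.
  by rewrite integral_cst // mul1e.
pose c : R := - (1 / 2); pose s : R := Num.sqrt 3 / 2.
have s3 : Num.sqrt 3 ^+ 2 = 3 :> R by rewrite sqr_sqrtr.
have cs : c ^+ 2 + s ^+ 2 = 1 by rewrite /c /s exprMn s3; field.
have cs' : c ^+ 2 + (- s) ^+ 2 = 1 by rewrite (sqrrN s).
pose T1 := plane_rot c s; pose T2 := plane_rot c (- s).
have mpre T : area_preserving T -> measurable (T @^-1` S).
  by move=> [mT _]; rewrite -[_ @^-1` _]setTI; exact: mT measurableT _ mS'.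
have spre T : area_preserving T -> mu2 (T @^-1` S) = mu2 S.
  move=> pT.
  have mI : measurable_fun setT (fun p : RR => (\1_S p)%:E : \bar R).
    by apply/measurable_EFinP; exact: measurable_indic.
  have I0 (p : RR) : (0 <= (\1_S p)%:E :> \bar R)%E by rewrite lee_fin.
  have h := pT.2 _ mI I0.
  have := integral_indic mu2 measurableT (mpre T pT).
  have := integral_indic mu2 measurableT mS'.
  by rewrite !setIT -h => <- <-.
have p1 : area_preserving T1 := rot_area_preserving cs.
have p2 : area_preserving T2 := rot_area_preserving cs'.
have cover : @disc R r `<=` S `|` (T1 @^-1` S `|` T2 @^-1` S).
  move=> p hp; pose t : R := Num.sqrt 3.
  have t0 : 0 <= t by exact: sqrtr_ge0.
  have third (a b : R) : a ^+ 2 + b ^+ 2 = 1 -> 0 <= (plane_rot a b p).2 ->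
      p.1 ^+ 2 + p.2 ^+ 2 <= 4 * (plane_rot a b p).2 ^+ 2 -> S (plane_rot a b p).
    move=> ab v0 hv; split; first by rewrite /disc /= rot_norm2.
    by split => //; have := rot_norm2 p ab; move: hv; set q := plane_rot a b p => hv e; lra.
  have far (u v : R) : 0 <= u -> ~ (0 <= v /\ u ^+ 2 <= 3 * v ^+ 2) ->
      0 <= u * (t / 2) + v * c /\ u ^+ 2 + v ^+ 2 <= 4 * (u * (t / 2) + v * c) ^+ 2.
    move=> u0 nS.
    have e4 : 4 * (u * (t / 2) + v * c) ^+ 2 = 3 * u ^+ 2 + v ^+ 2 - 2 * (t * u * v).
      transitivity (t ^+ 2 * u ^+ 2 + v ^+ 2 - 2 * (t * u * v)); first by rewrite /c; field.
      by rewrite /t s3.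
    rewrite e4 /c; have tu : 0 <= t * u by exact: mulr_ge0.
    have [v0|v0] := ltP v 0.
      have : t * u * v <= 0 by rewrite mulr_ge0_le0 // ltW.
      by have := sqr_ge0 u; move=> h1 h2; split; lra.
    have uv : 3 * v ^+ 2 < u ^+ 2 by rewrite ltNge; apply/negP => h; apply: nS.
    have tv : t * v <= u.
      rewrite -(@ler_pXn2r _ 2) ?nnegrE ?mulr_ge0 // exprMn /t s3; exact: ltW.
    have h1 : 3 * v <= t * u.
      have -> : 3 * v = t * (t * v) by rewrite mulrA -expr2 /t s3.
      by rewrite ler_wpM2l.
    have h2 : t * u * v <= u ^+ 2.
      by rewrite mulrAC expr2 ler_wpM2r.
    by split; lra.
  have [up|nup] := pselect (up_sector p); first by left.
  right; have [u0|u0] := leP 0 p.1.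
    have [h1 h2] := far _ _ u0 nup; left; exact: third.
  have nup' : ~ (0 <= p.2 /\ (- p.1) ^+ 2 <= 3 * p.2 ^+ 2) by rewrite sqrrN.
  have [|h1 h2] := far (- p.1) p.2 _ nup'; first by rewrite oppr_ge0 ltW.
  by right; apply: third => //=; rewrite mulrN -mulNr -?[p.1 ^+ 2]sqrrN.
have areaS : (mu2 (@disc R r) <= mu2 S + (mu2 S + mu2 S))%E.
  apply: (@le_trans _ _ (mu2 (S `|` (T1 @^-1` S `|` T2 @^-1` S)))).
    by apply: le_measure; rewrite ?inE //; apply: measurableU => //; apply: measurableU; exact: mpre.
  apply: le_trans (measureU2 _ _ _) _ => //; first by apply: measurableU; exact: mpre.
  rewrite leeD2l // -{1}(spre _ p1) -(spre _ p2).
  by apply: measureU2; exact: mpre.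
have mDS : measurable (@disc R r `\` up_sector) by exact: measurableD.
have split_area : mu2 (@disc R r) = (mu2 (@disc R r `\` up_sector) + mu2 S)%E.
  by rewrite (measureDI mu2 mD mS).
have leS : (mu2 S <= (pi * r ^+ 2)%:E)%E.
  by rewrite -areaD; apply: le_measure; rewrite ?inE //; exact: subIsetl.
have leDS : (mu2 (@disc R r `\` up_sector) <= (pi * r ^+ 2)%:E)%E.
  by rewrite -areaD; apply: le_measure; rewrite ?inE //; exact: subDsetl.
have finS : mu2 S \is a fin_num by rewrite ge0_fin_numE // (le_lt_trans leS) ?ltry.
have finDS : mu2 (@disc R r `\` up_sector) \is a fin_num.
  by rewrite ge0_fin_numE // (le_lt_trans leDS) ?ltry.
move: areaS split_area; rewrite areaD -(fineK finS) -(fineK finDS).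
set a := fine _; set b := fine _; rewrite -!EFinD !lee_fin => h1 [] h2.
by lra.
Qed.


(** The circular arcs that bound the translates from below have slope at most tan 30 degrees over
    the strip, so a point moving up inside the sector cannot cross them. *)
Lemma sector_translates (p : RR) : fund_dom (x0 +i* y0) -> @disc R (rho * y0) p ->
  rho * y0 <= 1 / 2 -> up_sector p -> translates ((x0 + p.1, y0 + p.2) : RR).
Proof.
move=> hz hp hr [v0 uv]; have /andP[r0 r1] := hrho.
have /fund_setE [/= _ z1 /andP[xl xr]] : @fund_set R (x0, y0) by [].
have [/andP[_ _] /andP[u1 u2]] := disc_upper y00 r0 hp.
have y34 : 3 / 4 <= y0 ^+ 2 := fund_dom_Im_sqr hz.
(* the sector rises at an angle of at least 30 degrees, steeper than the unit circle over |x| <= 1/2 *)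
have slope : `|p.1| / 2 <= y0 * p.2.
  rewrite -(@ler_pXn2r _ 2) ?nnegrE ?mulr_ge0 ?(ltW y00) //.
  rewrite !exprMn real_normK ?num_real //.
  have h1 : 3 / 4 * p.2 ^+ 2 <= y0 ^+ 2 * p.2 ^+ 2 by rewrite ler_wpM2r ?sqr_ge0.
  by apply: le_trans h1; lra.
have y0v : 0 < y0 + p.2 by apply: ltr_wpDr.
have ev : (y0 + p.2) ^+ 2 = y0 ^+ 2 + 2 * (y0 * p.2) + p.2 ^+ 2 by ring.
have sv := sqr_ge0 p.2.
move: slope u1 u2; set u := p.1; set v := p.2 in v0 ev sv y0v *.
set S := y0 * v in ev *; rewrite ler_pdivrMr // ler_norml => /andP[s1 s2] u1 u2.
have u2' := sqr_ge0 u.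
have [xg|xl'] := ltP (1 / 2) (x0 + u).
  exists (-1); apply/fund_setE; rewrite /= mulrN1z; split => //; last by apply/andP; split; lra.
  have := sqr_ge0 (x0 + u - 1 / 2); rewrite ev.
  have -> : (x0 + u - 1) ^+ 2 = (x0 + u - 1 / 2) ^+ 2 + 1 / 4 - (x0 + u - 1 / 2) by field.
  by lra.
have [xg|xg] := ltP (x0 + u) (- (1 / 2)).
  exists 1; apply/fund_setE; rewrite /=; split => //; last by apply/andP; split; lra.
  have := sqr_ge0 (x0 + u + 1 / 2); rewrite ev.
  have -> : (x0 + u + 1) ^+ 2 = (x0 + u + 1 / 2) ^+ 2 + 1 / 4 + (x0 + u + 1 / 2) by field.
  by lra.
exists 0; apply/fund_setE; rewrite /= addr0; split => //; last by apply/andP; split; lra.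
have x0u : - (2 * S) <= 2 * (x0 * u).
  have : `|x0 * u| <= S.
    rewrite normrM; apply: le_trans (_ : 1 / 2 * `|u| <= _).
      by rewrite ler_wpM2r // ler_norml xl xr.
    have : `|u| <= 2 * S by rewrite ler_norml; apply/andP; split; lra.
    by lra.
  by rewrite ler_norml => /andP[]; lra.
rewrite ev sqrrD; lra.
Qed.

(** At a boundary point of the fundamental domain only the upward sector need meet translates of
    the domain; on the other two thirds of the disc the height is compared with its maximum. *)
Lemma corner_bound M : fund_dom (x0 +i* y0) -> rho * y0 <= 1 / 2 ->
  M = height f n (x0 +i* y0) ->
  (forall p, @disc R (rho * y0) p -> height f n ((x0 + p.1) +i* (y0 + p.2)) <= M) ->
  M * (pi * rho ^+ 2 * (1 / 3 - n%:R * rho ^+ 2 / (2 - rho) ^+ 2 / 2)) <= (1 + rho) ^+ 2 * N.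
Proof.
move=> hz hr eM hM; have /andP[r0 r1] := hrho.
have ry : 0 < rho * y0 by rewrite mulr_gt0.
have M0 : 0 <= M by rewrite eM height_ge0.
have mD := @measurable_disc R (rho * y0); have mS := measurable_up_sector.
have mDS : measurable (@disc R (rho * y0) `\` up_sector) by exact: measurableD.
have mSD : measurable (@disc R (rho * y0) `&` up_sector) by exact: measurableI.
pose H (p : RR) : \bar R := (height f n ((x0 + p.1) +i* (y0 + p.2)))%:E.
have up p : @disc R (rho * y0) p -> 0 < y0 + p.2.
  by move=> /(disc_upper y00 r0) [/andP[h _] _]; apply: lt_trans h; rewrite mulr_gt0 // subr_gt0.
have mH : measurable_fun (@disc R (rho * y0)) H.
  by apply/measurable_EFinP; exact: measurable_height_shift.
have H0 p : @disc R (rho * y0) p -> (0 <= H p)%E.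
  by move=> /up hp; rewrite lee_fin height_ge0.
have sub := height_submean x0 df y00 hrho hn.
have i1 : (\int[mu2]_(p in @disc R (rho * y0) `&` up_sector) H p <=
    ((y0 * (1 + rho)) ^+ 2 * (1%:R * N))%:E)%E.
  apply: (@local_unfold _ 1%N mSD); first exact: subIsetl.
    by move=> p [hp sp]; exact: sector_translates.
  by lra.
have i2 : (\int[mu2]_(p in @disc R (rho * y0) `\` up_sector) H p <=
    (M * (2 / 3 * (pi * (rho * y0) ^+ 2)))%:E)%E.
  have le2 : (\int[mu2]_(p in @disc R (rho * y0) `\` up_sector) H p <=
      \int[mu2]_(p in @disc R (rho * y0) `\` up_sector) cst M%:E p)%E.
    apply: ge0_le_integral => //.
    - by move=> p [hp _]; exact: H0.
    - by apply: measurable_funS mH => //; exact: subDsetl.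
    - by move=> p [hp _]; rewrite lee_fin; exact: hM.
  apply: (le_trans le2); rewrite integral_cst // EFinM lee_wpmul2l ?lee_fin //.
  exact: sector_third.
have e3 : (\int[mu2]_(p in @disc R (rho * y0)) H p =
    \int[mu2]_(p in @disc R (rho * y0) `&` up_sector) H p +
    \int[mu2]_(p in @disc R (rho * y0) `\` up_sector) H p)%E.
  rewrite -ge0_integral_setU //.
  - by rewrite setUIDK.
  - by rewrite setUIDK.
  - by rewrite setUIDK.
  - by apply/disj_setPS => p [[_ h1] [_ h2]].
have := le_trans sub; rewrite e3 => /(_ _ (leeD i1 i2)).
rewrite -EFinD lee_fin -eM.
set tau := n%:R * _ / _.
have -> : M * (pi * (rho * y0) ^+ 2 * (1 - tau / 2)) =
  y0 ^+ 2 * (M * (pi * rho ^+ 2 * (1 / 3 - tau / 2))) + M * (2 / 3 * (pi * (rho * y0) ^+ 2)).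
  by field.
rewrite lerD2r.
have -> : (y0 * (1 + rho)) ^+ 2 * (1%:R * N) = y0 ^+ 2 * ((1 + rho) ^+ 2 * N) by ring.
by rewrite ler_pM2l // exprn_gt0.
Qed.

End DiscBounds.

(** * The maximal height over a strip *)

Section StripMaximum.
Variable R : realType.
Variables (f : R[i] -> R[i]) (n : nat).
Hypothesis df : forall w, 0 < complex.Im w -> cdiff f w.
Hypothesis hT : forall (m : int) z, 0 < complex.Im z -> height f n (z + m%:~R) = height f n z.
Hypothesis hS : forall z, 0 < complex.Im z -> height f n (- z^-1) = height f n z.

Lemma Im_inv (x y : R) : complex.Im (- (x +i* y)^-1) = y / (x ^+ 2 + y ^+ 2).
Proof. by rewrite cImN /= opprK. Qed.

Lemma Re_inv (x y : R) : complex.Re (- (x +i* y)^-1) = - (x / (x ^+ 2 + y ^+ 2)).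
Proof. by rewrite cReN. Qed.

Lemma intC (m : int) : (m%:~R : R[i]) = m%:~R%:C.
Proof. by rewrite rmorph_int. Qed.

Lemma shiftC (x y : R) (m : int) : (x +i* y) + m%:~R = (x + m%:~R) +i* y.
Proof. by rewrite intC; apply: ReIm_eq; rewrite /= ?addr0. Qed.

Lemma reduce_shift (x : R) : exists m : int, - (1 / 2) <= x + m%:~R <= 1 / 2.
Proof.
exists (- Num.floor (x + 1 / 2)).
have /andP[h1 h2] := floor_itv (x + 1 / 2).
rewrite intrD in h2; rewrite mulrNz; apply/andP; split; lra.
Qed.

(** Below the unit circle an inversion followed by a translation already reaches the fundamental
    domain when the height is at least 3/4. *)
Lemma inversion_reaches_fund_dom (x y : R) : 3 / 4 <= y -> - (1 / 2) <= x <= 1 / 2 -> x ^+ 2 + y ^+ 2 < 1 ->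
  exists2 w : R[i], fund_dom w & complex.Im w <= 4 / 3 /\ height f n w = height f n (x +i* y).
Proof.
move=> y34 /andP[xl xr] q1; set q := x ^+ 2 + y ^+ 2 in q1.
have y0 : 0 < y by lra.
have q0 : 0 < q by rewrite /q; apply: ltr_wpDl; rewrite ?sqr_ge0 // exprn_gt0.
have [m /andP[hm1 hm2]] := reduce_shift (- (x / q)).
have i0 : 0 < complex.Im (- (x +i* y)^-1) by rewrite Im_inv divr_gt0.
exists (- (x +i* y)^-1 + m%:~R); last first.
  split; last by rewrite hT // hS.
  rewrite cImD Im_inv intC /= addr0 -/q ler_pdivrMr //.
  apply: le_trans (_ : 4 / 3 * y ^+ 2 <= _); last by rewrite /q; have := sqr_ge0 x; lra.
  have : 3 / 4 * y <= y * y by rewrite ler_wpM2r // ltW.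
  by rewrite expr2; lra.
have e : - (x +i* y)^-1 + m%:~R = (- (x / q) + m%:~R) +i* (y / q).
  by rewrite -shiftC; congr (_ + _); apply: ReIm_eq; rewrite ?Re_inv ?Im_inv.
rewrite e; apply/(@fund_setE R (- (x / q) + m%:~R, y / q)); split => /=.
- exact: divr_gt0.
- have eq : x ^+ 2 + y ^+ 2 = q by [].
  have q916 : 9 / 16 <= q.
    have : (3 / 4) ^+ 2 <= y ^+ 2 by rewrite ler_pXn2r ?nnegrE // ltW.
    by have := sqr_ge0 x; rewrite -eq; lra.
  clearbody q; pose M : R := m%:~R.
  have -> : (- (x / q) + m%:~R) ^+ 2 + (y / q) ^+ 2 = (1 - 2 * (M * x) + M ^+ 2 * q) / q.
    transitivity ((x ^+ 2 + y ^+ 2) / q ^+ 2 - 2 * M * (x / q) + M ^+ 2).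
      by rewrite /M; field; rewrite gt_eqF.
    by rewrite eq; field; rewrite gt_eqF.
  rewrite ler_pdivlMr // mul1r.
  have [m0|m0] := eqVneq m 0; first by rewrite /M m0 mul0r expr0n /= mul0r mulr0; lra.
  pose a := `|M|; have a1 : 1 <= a.
    by rewrite /a /M -intr_norm ler1z -gtz0_ge1 normr_gt0.
  have h1 : M * x <= a * (1 / 2).
    by apply: le_trans (ler_norm _) _; rewrite normrM ler_wpM2l // ler_norml xl xr.
  have h2 : (a ^+ 2 - 1) * (9 / 16) <= (a ^+ 2 - 1) * q.
    by rewrite ler_wpM2l // subr_ge0 expr_ge1 // (le_trans ler01).
  have h3 : a * 1 <= a * a by rewrite ler_wpM2l // (le_trans ler01).
  have h4 : 0 <= (a - 1) * ((a + 1) * (9 / 16) - 1) by rewrite mulr_ge0 //; lra.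
  have -> : M ^+ 2 = a ^+ 2 by rewrite /a real_normK // num_real.
  by move: h2 h4; rewrite expr2; lra.
- by rewrite hm1 hm2.
Qed.

(** By translation invariance the maximum over the strip is one over a compact rectangle; if it lies
    below the unit circle, inversion and a translation move it into the fundamental domain without
    changing the height. *)
Lemma strip_max (Y1 : R) : 4 / 3 <= Y1 -> exists z0 : R[i],
  [/\ fund_dom z0, complex.Im z0 <= Y1 &
      forall z, 3 / 4 <= complex.Im z <= Y1 -> height f n z <= height f n z0].
Proof.
move=> hY.
pose K : set (R^o * R^o) := `[- (1 / 2), 1 / 2]%classic `*` `[3 / 4, Y1]%classic.
have K0 : K !=set0 by exists (0, 1); split; rewrite /= in_itv /=; apply/andP; split; lra.
have cK : compact K by apply: compact_setX; exact: segment_compact.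
have hc : {within K, continuous (fun p : R^o * R^o => height f n (p.1 +i* p.2) : R^o)}.
  apply: continuous_in_subspaceT => -[x y] /set_mem [_ /=]; rewrite in_itv /= => /andP[y1 _].
  have y0 : 0 < y by lra.
  have c1 : {for (x, y), continuous (fun p : R^o * R^o => f (p.1 +i* p.2) : R[i]^o)}.
    have c0 : ccont f (x +i* y) by apply: cdiff_continuous; exact: df.
    exact: (@continuous_comp _ _ _ (fun p : R^o * R^o => (p.1 +i* p.2) : R[i]^o)
      (f : R[i]^o -> R[i]^o) (x, y) (@continuous_mkC R (x, y)) c0).
  have c2 : {for (x, y), continuous (fun p : R^o * R^o => cmod (f (p.1 +i* p.2)) : R^o)}.
    exact: (@continuous_comp _ _ _ _ (@cmod R : R[i]^o -> R^o) (x, y) c1 (@continuous_cmod R _)).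
  have c3 : {for (x, y), continuous (fun p : R^o * R^o => cmod (f (p.1 +i* p.2)) ^+ 2 : R^o)}.
    exact: (@continuous_comp _ _ _ _ (fun t : R^o => t ^+ 2 : R^o) (x, y) c2 (@cont_sqr R _)).
  have c4 : {for (x, y), continuous (fun p : R^o * R^o => p.2 ^+ n : R^o)}.
    exact: (@continuous_comp _ _ _ (fun p : R^o * R^o => p.2) (fun t : R^o => t ^+ n : R^o) (x, y) cvg_snd (@exprn_continuous _ n _)).
  exact: (@cvgM R _ (nbhs ((x, y) : R^o * R^o)) _ _ _ _ _ c3 c4).
have [[x y] /set_mem [/= xK yK] max] := compact_EVT_max K0 cK hc.
rewrite !in_itv /= in xK yK; have /andP[y1 y2] := yK.
have all z : 3 / 4 <= complex.Im z <= Y1 -> height f n z <= height f n (x +i* y).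
  case: z => u v /= hv; have /andP[v1 v2] := hv.
  have [m hm] := reduce_shift u.
  rewrite -(hT m) /=; last by lra.
  rewrite shiftC; apply: (max (u + m%:~R, v)); apply/mem_set.
  by split; rewrite /= in_itv.
have [q1|q1] := ltP (x ^+ 2 + y ^+ 2) 1.
  have [w Fw [w1 w2]] := inversion_reaches_fund_dom y1 xK q1.
  exists w; split => //; first exact: le_trans hY.
  by move=> z /all; rewrite w2.
exists (x +i* y); split => //; apply/(@fund_setE R (x, y)); split => //=.
by lra.
Qed.

End StripMaximum.

(** * Cusp forms under translation and inversion *)

Section CuspForms.
Variable R : realType.
Implicit Types (f g : R[i] -> R[i]) (k : nat).

(** The consequences of being a cusp form that the estimates use; unlike modularity under the whole
    group they only involve the two generators. *)
Definition cusp_like k f := [/\ forall z, 0 < complex.Im z -> cdiff f z,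
  forall (m : int) z, 0 < complex.Im z -> f (z + m%:~R) = f z,
  forall z, 0 < complex.Im z -> f (- z^-1) = z ^+ (2 * k) * f z &
  vanishes_at_cusp f].

Definition mx2 (a b c d : int) : 'M[int]_2 :=
  \matrix_(i < 2, j < 2) if i == 0 then (if j == 0 then a else b) else (if j == 0 then c else d).

Lemma det_mx2 a b c d : \det (mx2 a b c d) = a * d - b * c.
Proof.
rewrite (expand_det_row _ ord0) !big_ord_recl big_ord0 /cofactor !det_mx11 !mxE /=.
by rewrite /bump /= !addn0 expr0 mul1r expr1 mulN1r mulrN addr0.
Qed.

Lemma cusp_form_like k f : cusp_form k f -> cusp_like k f.
Proof.
move=> [hol mod van]; split => //.
- by move=> z z0; apply: derivable_cdiff; exact: hol.
- move=> m z z0; have := mod (mx2 1 m 0 1) z _ z0; rewrite det_mx2 mulr1 mulr0 subr0 => /(_ erefl).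
  rewrite /moebius /automorphy_denom !mxE /= !mulr0z !mulr1z mul0r add0r mul1r.
  by rewrite divr1 expr1n mul1r.
- move=> z z0; have := mod (mx2 0 (-1) 1 0) z _ z0; rewrite det_mx2 mul0r mulN1r sub0r opprK => /(_ erefl).
  rewrite /moebius /automorphy_denom !mxE /= !mulr0z !mulrN1z mul0r add0r mul1r addr0.
  by rewrite mulN1r.
Qed.

Lemma cusp_like0 k : cusp_like k (fun=> 0).
Proof.
split.
- by move=> z _; exact: cdiff_cst.
- by [].
- by move=> z _; rewrite mulr0.
- by move=> e e0; apply: nearW => y x; rewrite cmod0.
Qed.

Lemma vanishes_at_cuspD f g : vanishes_at_cusp f -> vanishes_at_cusp g ->
  vanishes_at_cusp (fun z => f z + g z).
Proof.
move=> vf vg e e0; have e2 : 0 < e / 2 by rewrite divr_gt0.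
apply: filterS2 (vf _ e2) (vg _ e2) => y hf hg x.
by apply: le_lt_trans (cmodD _ _) _; rewrite [e]splitr ltrD.
Qed.

Lemma vanishes_at_cuspZ (c : R[i]) f : vanishes_at_cusp f -> vanishes_at_cusp (fun z => c * f z).
Proof.
move=> vf e e0; pose C := cmod c + 1.
have C0 : 0 < C by rewrite ltr_wpDl ?cmod_ge0.
apply: filterS (vf _ (divr_gt0 e0 C0)) => y hf x.
rewrite cmodM; apply: le_lt_trans (_ : C * cmod (f (x +i* y)) < _).
  by rewrite ler_wpM2r ?cmod_ge0 // lerDl.
by rewrite mulrC -ltr_pdivlMr.
Qed.

Lemma cusp_likeD k f g : cusp_like k f -> cusp_like k g -> cusp_like k (fun z => f z + g z).
Proof.
move=> [f1 f2 f3 f4] [g1 g2 g3 g4]; split.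
- by move=> z z0; exact: (cdiffD (f1 z z0) (g1 z z0)).
- by move=> m z z0; rewrite f2 // g2.
- by move=> z z0; rewrite f3 // g3 // mulrDr.
- exact: vanishes_at_cuspD.
Qed.

Lemma cusp_likeZ k (c : R[i]) f : cusp_like k f -> cusp_like k (fun z => c * f z).
Proof.
move=> [f1 f2 f3 f4]; split.
- by move=> z z0; exact: (cdiffM (cdiff_cst c z) (f1 z z0)).
- by move=> m z z0; rewrite f2.
- by move=> z z0; rewrite f3 // mulrCA.
- exact: vanishes_at_cuspZ.
Qed.

Lemma cusp_like_sum k (I : Type) (s : seq I) (F : I -> R[i] -> R[i]) :
  (forall i, cusp_like k (F i)) -> cusp_like k (fun z => \sum_(i <- s) F i z).
Proof.
move=> hF; elim: s => [|i s IH].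
  rewrite (_ : (fun z => _) = (fun=> 0)); first exact: cusp_like0.
  by apply/funext => z; rewrite big_nil.
rewrite (_ : (fun z => _) = (fun z => F i z + \sum_(i <- s) F i z)).
  exact: cusp_likeD.
by apply/funext => z; rewrite big_cons.
Qed.

Lemma cusp_like_shift1 k f z : cusp_like k f -> 0 < complex.Im z -> f (z + 1) = f z.
Proof. by move=> [_ f2 _ _] z0; have := f2 1 z z0; rewrite mulr1z. Qed.

Lemma cusp_like_height_shift k f (m : int) z : cusp_like k f -> 0 < complex.Im z ->
  height f (2 * k) (z + m%:~R) = height f (2 * k) z.
Proof.
by move=> [_ f2 _ _] z0; rewrite /height f2 // cImD intC /= addr0.
Qed.

Lemma cusp_like_height_inv k f z : cusp_like k f -> 0 < complex.Im z ->
  height f (2 * k) (- z^-1) = height f (2 * k) z.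
Proof.
move=> [_ _ f3 _]; case: z => x y /= y0; rewrite /height f3 // Im_inv /=.
have q0 : 0 < x ^+ 2 + y ^+ 2 by apply: ltr_wpDl; rewrite ?sqr_ge0 // exprn_gt0.
rewrite cmodM cmodX exprMn exprAC (cmod_sqr (x +i* y)) /= expr_div_n.
by rewrite mulrAC mulrC mulrACA; field; rewrite expf_neq0 // gt_eqF.
Qed.

End CuspForms.

(** * The reproducing form at a point *)

Section Extremal.
Variable R : realType.
Local Notation mu := (@lebesgue_measure R).
Local Notation RR := (measurableTypeR R * measurableTypeR R)%type.
Local Notation mu2 := (mu \x mu)%E.
Local Notation D := (@fund_set R).

Definition fund_integrable (a : RR -> R) := mu2.-integrable D (EFin \o a).
Definition fund_integral (a : RR -> R) : R := (\int[mu2]_(p in D) a p)%R.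

Lemma fund_integrableD a b : fund_integrable a -> fund_integrable b ->
  fund_integrable (fun p => a p + b p) /\ fund_integral (fun p => a p + b p) = fund_integral a + fund_integral b.
Proof.
move=> ia ib; split; last by apply: RintegralD => //; exact: measurable_fund_set.
have := @integrableD _ _ _ mu2 D (@measurable_fund_set R) _ _ ia ib.
by rewrite /fund_integrable; apply: eq_integrable => //; exact: measurable_fund_set.
Qed.

Lemma fund_integrableZ (k : R) a : fund_integrable a -> fund_integrable (fun p => k * a p) /\ fund_integral (fun p => k * a p) = k * fund_integral a.
Proof.
move=> ia; split; last by apply: RintegralZl => //; exact: measurable_fund_set.
have := @integrableZl _ _ _ mu2 D (@measurable_fund_set R) k _ ia.
by rewrite /fund_integrable; apply: eq_integrable => //; exact: measurable_fund_set.
Qed.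

Lemma fund_integrable_sum (I : Type) (s : seq I) (a : I -> RR -> R) : (forall i, fund_integrable (a i)) ->
  fund_integrable (fun p => \sum_(i <- s) a i p) /\ fund_integral (fun p => \sum_(i <- s) a i p) = \sum_(i <- s) fund_integral (a i).
Proof.
move=> ia; elim: s => [|i s [IH1 IH2]].
  have -> : (fun p => \sum_(i <- [::]) a i p) = (fun=> 0 * 0).
    by apply/funext => p; rewrite big_nil mul0r.
  have i0 : fund_integrable (fun=> 0).
    by rewrite /fund_integrable (_ : _ \o _ = cst 0%E) //; exact: integrable0.
  by have [h1 h2] := fund_integrableZ 0 i0; split; [exact: h1 | rewrite big_nil; apply: etrans h2 _; exact: mul0r].
have -> : (fun p => \sum_(j <- i :: s) a j p) = (fun p => a i p + \sum_(j <- s) a j p).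
  by apply/funext => p; rewrite big_cons.
by rewrite big_cons; have [h1 h2] := fund_integrableD (ia i) IH1; rewrite h2 IH2.
Qed.

Lemma measurable_ReIm f : (forall w, 0 < complex.Im w -> cdiff f w) ->
  measurable_fun D (fun p : RR => complex.Re (f (p.1 +i* p.2))) /\
  measurable_fun D (fun p : RR => complex.Im (f (p.1 +i* p.2))).
Proof.
move=> df.
have sub : D `<=` [set p : RR | 0 < p.2] by move=> p /fund_setE [].
have oU := @upper_open R.
have bc (p : RR) : 0 < p.2 -> forall e, 0 < e -> exists2 d, 0 < d & forall q : RR,
    `|q.1 - p.1| < d -> `|q.2 - p.2| < d -> cmod (f (q.1 +i* q.2) - f (p.1 +i* p.2)) < e.
  move=> p0 e e0; have /contC_P h : ccont f (p.1 +i* p.2) by apply: cdiff_continuous; exact: df.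
  have [d d0 hd] := h e e0; exists (d / 2); first by rewrite divr_gt0.
  move=> q q1 q2; apply: hd.
  have := cmod_le_ReIm ((q.1 +i* q.2) - (p.1 +i* p.2)) => /= /le_lt_trans; apply.
  by rewrite [d]splitr ltrD.
split; apply: (measurable_funS (@measurable_upper R) sub); apply: box_cont_measurable => // p p0 e e0;
  have [d d0 hd] := bc p p0 e e0; exists d => // q q1 q2; apply: le_lt_trans (hd q q1 q2).
  by rewrite -cReN -cReD le_Re_cmod.
by rewrite -cImN -cImD le_Im_cmod.
Qed.

Lemma measurable_pow n : measurable_fun D (fun p : RR => p.2 ^+ n / p.2 ^+ 2).
Proof.
have sub : D `<=` [set p : RR | 0 < p.2] by move=> p /fund_setE [].
apply: (measurable_funS (@measurable_upper R) sub); apply: box_cont_measurable; first exact: upper_open.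
move=> p /= p0; apply: (@box_cont_fun2 R (fun y => y ^+ n / y ^+ 2) p).
have y0 : p.2 ^+ 2 != 0 :> R by rewrite gt_eqF // exprn_gt0.
apply: (@cvgM R _ (nbhs (p.2 : R^o)) _ (fun y : R => y ^+ n) (fun y : R => (y ^+ 2)^-1)).
  exact: (@exprn_continuous _ n p.2).
exact: (@cvgV R _ (nbhs (p.2 : R^o)) _ (fun y : R => y ^+ 2) _ y0 (@cont_sqr R p.2)).
Qed.

Definition petersson_integrand (f g : R[i] -> R[i]) n (p : RR) : R[i] :=
  f (p.1 +i* p.2) * (g (p.1 +i* p.2))^* * (p.2 ^+ n)%:C.

Lemma petersson_integrand_diag f n p : complex.Re (petersson_integrand f f n p) / p.2 ^+ 2 = height f n (p.1 +i* p.2) / p.2 ^+ 2.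
Proof.
rewrite /petersson_integrand /height cReM /= mulr0 subr0 (cmod_sqr (f _)).
by case: (f _) => a b /=; rewrite mulrN opprK -!expr2.
Qed.

Lemma fund_density f n p : D p -> upper_density f n p = (height f n (p.1 +i* p.2) / p.2 ^+ 2)%:E.
Proof.
by move=> /fund_setE [p0 _ _]; rewrite /upper_density /patch mem_set.
Qed.

(** A function whose Lebesgue integral is infinite is given the real integral 0, so the value 1
    forces integrability. *)
Lemma fund_integrable_height f n : (forall w, 0 < complex.Im w -> cdiff f w) ->
  fund_integral (fun p => height f n (p.1 +i* p.2) / p.2 ^+ 2) = 1 ->
  fund_integrable (fun p => height f n (p.1 +i* p.2) / p.2 ^+ 2).
Proof.
move=> df h1; apply/integrableP; split.
  apply/measurable_EFinP.
  rewrite (_ : (fun p : RR => _) = (fun p => cmod (f (p.1 +i* p.2)) ^+ 2 * (p.2 ^+ n / p.2 ^+ 2))).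
    apply: measurable_funM; last exact: measurable_pow.
    have [m1 m2] := measurable_ReIm df.
    rewrite (_ : (fun p : RR => _) = (fun p => complex.Re (f (p.1 +i* p.2)) ^+ 2 + complex.Im (f (p.1 +i* p.2)) ^+ 2)).
      by apply: measurable_funD; exact: measurable_funX.
    by apply/funext => p; rewrite cmod_sqr.
  by apply/funext => p; rewrite /height mulrA.
have -> : (\int[mu2]_(p in D) `|(EFin \o (fun p : RR => (height f n (p.1 +i* p.2) / p.2 ^+ 2)%R)) p| =
   \int[mu2]_(p in D) ((height f n (p.1 +i* p.2) / p.2 ^+ 2)%R)%:E)%E.
  apply: eq_integral => p /set_mem /fund_setE [p0 _ _] /=.
  by rewrite ger0_norm // divr_ge0 ?sqr_ge0 // height_ge0.
move: h1; rewrite /fund_integral /Rintegral; case: (integral _ _ _) => [r|/esym /eqP|/esym/eqP] //=.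
- by move=> _; rewrite ltry.
- by rewrite oner_eq0.
Qed.

(** The real and imaginary parts of f times the conjugate of g are dominated by the sum of the two
    squared moduli. *)
Lemma fund_integrable_petersson f g n : (forall w, 0 < complex.Im w -> cdiff f w) ->
  (forall w, 0 < complex.Im w -> cdiff g w) ->
  fund_integrable (fun p => height f n (p.1 +i* p.2) / p.2 ^+ 2) ->
  fund_integrable (fun p => height g n (p.1 +i* p.2) / p.2 ^+ 2) ->
  fund_integrable (fun p => complex.Re (petersson_integrand f g n p) / p.2 ^+ 2) /\
  fund_integrable (fun p => complex.Im (petersson_integrand f g n p) / p.2 ^+ 2).
Proof.
move=> df dg hf hg; have [s _] := fund_integrableD hf hg.
have [mf1 mf2] := measurable_ReIm df; have [mg1 mg2] := measurable_ReIm dg.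
have mp := measurable_pow n.
have bound (a b c d y z : R) : 0 <= z -> z = y ->
   `|(a * c + b * d) * y| <= (a ^+ 2 + b ^+ 2) * z + (c ^+ 2 + d ^+ 2) * z.
  move=> z0 <-; rewrite -mulrDl normrM (ger0_norm z0) ler_wpM2r //.
  have := sqr_ge0 (a - c); have := sqr_ge0 (b - d); have := sqr_ge0 (a + c); have := sqr_ge0 (b + d).
  have := sqr_ge0 a; have := sqr_ge0 b; have := sqr_ge0 c; have := sqr_ge0 d.
  rewrite !sqrrB !sqrrD; set ac := a * c; set bd := b * d.
  by rewrite ler_norml => *; apply/andP; split; lra.
have pos p : D p -> 0 <= p.2 ^+ n / p.2 ^+ 2 :> R.
  by move=> /fund_setE [p0 _ _]; rewrite divr_ge0 ?sqr_ge0 // exprn_ge0 // ltW.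
have hE h p : height h n (p.1 +i* p.2) / p.2 ^+ 2 =
   (complex.Re (h (p.1 +i* p.2)) ^+ 2 + complex.Im (h (p.1 +i* p.2)) ^+ 2) * (p.2 ^+ n / p.2 ^+ 2).
  by rewrite /height cmod_sqr mulrA.
have eR p : complex.Re (petersson_integrand f g n p) / p.2 ^+ 2 = (complex.Re (f (p.1 +i* p.2)) * complex.Re (g (p.1 +i* p.2))
   + complex.Im (f (p.1 +i* p.2)) * complex.Im (g (p.1 +i* p.2))) * (p.2 ^+ n / p.2 ^+ 2).
  rewrite /petersson_integrand cReM /= mulr0 subr0 cReM mulrA; congr (_ * _ / _).
  by case: (g _) => a b /=; rewrite mulrN opprK.
have eI p : complex.Im (petersson_integrand f g n p) / p.2 ^+ 2 = (complex.Im (f (p.1 +i* p.2)) * complex.Re (g (p.1 +i* p.2))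
   + (- complex.Re (f (p.1 +i* p.2))) * complex.Im (g (p.1 +i* p.2))) * (p.2 ^+ n / p.2 ^+ 2).
  rewrite /petersson_integrand cImM /= mulr0 add0r cImM mulrA; congr (_ * _ / _).
  by case: (g _) => a b /=; rewrite mulrN addrC mulNr.
have mD := @measurable_fund_set R.
split; apply: (le_integrable mD _ _ s).
- apply/measurable_EFinP; rewrite (funext eR).
  by apply: measurable_funM => //; apply: measurable_funD; apply: measurable_funM.
- move=> p pD /=; rewrite lee_fin eR [leRHS]ger0_norm !hE; first by exact: bound (pos p pD) erefl.
  by rewrite -mulrDl mulr_ge0 ?pos // !addr_ge0 ?sqr_ge0.
- apply/measurable_EFinP; rewrite (funext eI).
  apply: measurable_funM => //; apply: measurable_funD; apply: measurable_funM => //.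
  exact: measurable_funN.
- move=> p pD /=; rewrite lee_fin eI [leRHS]ger0_norm !hE; last first.
    by rewrite -mulrDl mulr_ge0 ?pos // !addr_ge0 ?sqr_ge0.
  apply: le_trans (bound _ _ _ _ _ _ (pos p pD) erefl) _.
  by rewrite sqrrN (addrC (complex.Im _ ^+ 2)).
Qed.

Lemma petersson_parts k f g : petersson k f g =
  fund_integral (fun p => complex.Re (petersson_integrand f g (2 * k) p) / p.2 ^+ 2) +i*
  fund_integral (fun p => complex.Im (petersson_integrand f g (2 * k) p) / p.2 ^+ 2).
Proof. by []. Qed.

(** F = sum_j conj (f_j z1) f_j. Expanding the squared modulus of F and integrating, orthonormality
    leaves the diagonal terms. *)
Lemma reproducing_form k d (f : 'I_d -> R[i] -> R[i]) z1 : orthonormal_basis_cusp_forms k f ->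
  0 < complex.Im z1 -> exists F, [/\ cusp_like k F, F z1 = (\sum_j cmod (f j z1) ^+ 2)%:C &
   (\int[mu2]_(p in D) upper_density F (2 * k) p = (\sum_j cmod (f j z1) ^+ 2)%:E)%E].
Proof.
move=> [cf on _] z10; pose c j := f j z1.
exists (fun z => \sum_(j <- index_enum 'I_d) (c j)^* * f j z).
have hf j : cusp_like k (f j) by exact: cusp_form_like.
split.
- by apply: cusp_like_sum => j; apply: cusp_likeZ.
- rewrite rmorph_sum /=; apply: eq_bigr => j _; rewrite /c mulrC.
  by case: (f j z1) => a b; apply/eqP; rewrite eq_complex cmod_sqr /=; apply/andP; split; apply/eqP; ring.
have df j w : 0 < complex.Im w -> cdiff (f j) w by have [h _ _ _] := hf j; exact: h.
pose al i j := (c i)^* * c j.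
have td i j : fund_integral (fun p => complex.Re (petersson_integrand (f i) (f j) (2 * k) p) / p.2 ^+ 2) = (i == j)%:R /\
   fund_integral (fun p => complex.Im (petersson_integrand (f i) (f j) (2 * k) p) / p.2 ^+ 2) = 0.
  have parts (a b : R) (z : R[i]) : a +i* b = z -> a = complex.Re z /\ b = complex.Im z by move=> <-.
  have := on i j; rewrite petersson_parts => /parts[-> ->].
  by case: (i == j).
have ih j : fund_integrable (fun p => height (f j) (2 * k) (p.1 +i* p.2) / p.2 ^+ 2).
  apply: (fund_integrable_height (df j)); have [h _] := td j j; rewrite eqxx in h.
  by apply: etrans h; congr fund_integral; apply/funext => p; rewrite petersson_integrand_diag.
have ir i j := fund_integrable_petersson (df i) (df j) (ih i) (ih j).
pose T i j p := complex.Re (al i j) * (complex.Re (petersson_integrand (f i) (f j) (2 * k) p) / p.2 ^+ 2)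
  + (- complex.Im (al i j)) * (complex.Im (petersson_integrand (f i) (f j) (2 * k) p) / p.2 ^+ 2).
have hT i j : fund_integrable (T i j) /\ fund_integral (T i j) = complex.Re (al i j) * (i == j)%:R.
  have [i1 i2] := ir i j; have [t1 t2] := td i j.
  have [j1 e1] := fund_integrableZ (complex.Re (al i j)) i1; have [j2 e2] := fund_integrableZ (- complex.Im (al i j)) i2.
  have [j3 e3] := fund_integrableD j1 j2; split; first exact: j3.
  by apply: etrans e3 _; rewrite e1 e2 t1 t2 mulr0 addr0.
pose T2 i p := \sum_(j <- index_enum 'I_d) T i j p.
have hT2 i : fund_integrable (T2 i) /\ fund_integral (T2 i) = cmod (c i) ^+ 2.
  have [h1 h2] := fund_integrable_sum (index_enum 'I_d) (fun j => (hT i j).1); split; first exact: h1.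
  apply: etrans h2 _; rewrite (bigD1 i) //= big1 ?addr0; last first.
    by move=> j ji; rewrite (hT i j).2 eq_sym (negbTE ji) mulr0.
  rewrite (hT i i).2 eqxx mulr1 /al cmod_sqr.
  by case: (c i) => a b /=; ring.
have [h1 h2] := fund_integrable_sum (index_enum 'I_d) (fun j => (hT2 j).1).
set S := (fun p => _) in h1 h2.
have cj (a b : R[i]) : (a^* * b)^* = a * b^*.
  case: a b => [a1 a2] [b1 b2]; apply/eqP; rewrite eq_complex /=.
  by apply/andP; split; apply/eqP; ring.
transitivity (\int[mu2]_(p in D) (S p)%:E)%E.
  apply: eq_integral => p /set_mem pD; rewrite fund_density //; congr EFin.
  rewrite -petersson_integrand_diag /S /T2 /T /al /petersson_integrand.
  set w := p.1 +i* p.2; set y := (p.2 ^+ (2 * k))%:C.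
  rewrite rmorph_sum mulr_suml mulr_suml.
  rewrite (raddf_sum (@complex.Re R)) mulr_suml; apply: eq_bigr => i _.
  rewrite mulr_sumr mulr_suml raddf_sum mulr_suml; apply: eq_bigr => j _.
  have -> : (c i)^* * f i w * ((c j)^* * f j w)^* * y = ((c i)^* * c j) * (f i w * (f j w)^* * y).
    by rewrite cj; ring.
  apply: etrans (congr1 (fun t => t / p.2 ^+ 2) (cReM _ _)) _.
  by rewrite mulrBl mulNr !mulrA.
rewrite -[LHS]fineK; last exact: (integrable_fin_num (@measurable_fund_set R) h1).
by congr EFin; apply: etrans h2 _; apply: eq_bigr => j _; exact: (hT2 j).2.
Qed.

(** At the reproducing form the value and the squared norm are the same number s, so the hypothesis
    reads s^2 y^(2k) <= C s. *)
Lemma S2k_le_reproducing k d (f : 'I_d -> R[i] -> R[i]) z1 C : orthonormal_basis_cusp_forms k f ->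
  0 < complex.Im z1 -> 0 <= C ->
  (forall F N, cusp_like k F -> 0 <= N ->
     (\int[mu2]_(p in D) upper_density F (2 * k) p = N%:E)%E ->
     height F (2 * k) z1 <= C * N) ->
  S2k k f z1 <= C.
Proof.
move=> onb z10 C0 hC; have [F [cF Fz1 FN]] := reproducing_form onb z10.
rewrite /S2k -mulr_suml; set s := \sum_j _ in Fz1 FN *.
have s0 : 0 <= s by apply: sumr_ge0 => j _; exact: sqr_ge0.
have := hC F s cF s0 FN; rewrite /height Fz1 cmod_real (ger0_norm s0).
move: s0; rewrite le_eqVlt => /predU1P[<- _|s0]; first by rewrite mul0r.
by rewrite expr2 -mulrA mulrC ler_pM2r.
Qed.

End Extremal.

(** * Pointwise bounds in the different ranges of height *)

Section RangeBounds.
Variable R : realType.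
Local Notation mu := (@lebesgue_measure R).
Local Notation mu2 := (mu \x mu)%E.
Variables (F : R[i] -> R[i]) (k : nat) (N : R).
Hypothesis cF : cusp_like k F.
Hypothesis N0 : 0 <= N.
Hypothesis hN : (\int[mu2]_(p in @fund_set R) upper_density F (2 * k) p = N%:E)%E.
Local Notation n := (2 * k)%N.
Local Notation ht := (height F n).

Let df w : 0 < complex.Im w -> cdiff F w.
Proof. by have [h _ _ _] := cF; exact: h. Qed.

Let pf w : 0 < complex.Im w -> F (w + 1) = F w.
Proof. exact: cusp_like_shift1 cF. Qed.

(** The maximum of the height over the strip is attained at a point of the fundamental domain, for
    which [interior_bound] or, below 10/9, [corner_bound] holds. In the first case discs have radius
    at most 3/2, so three translates suffice, and 1/3 (1 - t/2) >= 1/3 - t/2. *)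
Lemma strip_bound rho z : 0 < rho <= 1 / 10 -> n%:R * rho ^+ 2 <= (2 - rho) ^+ 2 ->
  3 / 4 <= complex.Im z <= 15 ->
  ht z * (pi * rho ^+ 2 * (1 / 3 - n%:R * rho ^+ 2 / (2 - rho) ^+ 2 / 2)) <= (1 + rho) ^+ 2 * N.
Proof.
move=> /andP[r0 r1] hn zI; have hr : 0 < rho < 1 by rewrite r0 /=; lra.
have h415 : 4 / 3 <= 15 :> R by lra.
have [z0 [fz0 z015 hmax]] := @strip_max R F n df (fun m z => cusp_like_height_shift m cF)
  (fun z => cusp_like_height_inv cF) _ h415.
set t := n%:R * rho ^+ 2 / (2 - rho) ^+ 2; have t1 : 0 <= t <= 1.
  have q0 : 0 < (2 - rho) ^+ 2 by rewrite exprn_gt0 //; lra.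
  rewrite /t ler_pdivrMr // mul1r hn andbT divr_ge0 //; last exact: ltW.
  by rewrite mulr_ge0 ?ler0n ?sqr_ge0.
have /andP[t0 t1'] := t1.
have p0 : 0 < pi * rho ^+ 2 by rewrite mulr_gt0 ?pi_gt0 // exprn_gt0.
have [y0 x0] : 0 < complex.Im z0 /\ True by case: fz0.
have M0 : 0 <= ht z0 by exact: height_ge0.
suff H : ht z0 * (pi * rho ^+ 2 * (1 / 3 - t / 2)) <= (1 + rho) ^+ 2 * N.
  have [c0|c0] := leP 0 (1 / 3 - t / 2).
    by apply: le_trans H; rewrite ler_wpM2r ?hmax // mulr_ge0 // ltW.
  apply: le_trans (_ : 0 <= _); last by rewrite mulr_ge0 ?sqr_ge0.
  rewrite mulr_ge0_le0 //; first by apply: height_ge0; case/andP: zI => h _; apply: lt_le_trans h; lra.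
  by rewrite mulr_ge0_le0 // ltW.
have [hy|hy] := leP 1 (complex.Im z0 * (1 - rho)).
  have h3 : 2 * (rho * complex.Im z0) <= 3%:R.
    have : rho * complex.Im z0 <= 1 / 10 * 15 by apply: ler_pM => //; exact: ltW.
    lra.
  have := @interior_bound R F n df pf (complex.Re z0) _ rho N y0 hr hN hn 3 hy h3.
  have -> : complex.Re z0 +i* complex.Im z0 = z0 by case: (z0).
  rewrite -/t => hI.
  have -> : (1 + rho) ^+ 2 * N = (1 + rho) ^+ 2 * (3%:R * N) / 3 by field.
  rewrite ler_pdivlMr //; apply: le_trans hI; rewrite -[leLHS]mulrA ler_wpM2l // -[leLHS]mulrA ler_pM2l //.
  by lra.
have hy' : complex.Im z0 < 10 / 9.
  have : complex.Im z0 * (9 / 10) <= complex.Im z0 * (1 - rho).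
    by rewrite ler_pM2l //; lra.
  by lra.
have ry : rho * complex.Im z0 <= 1 / 10 * (10 / 9) by apply: ler_pM; rewrite // ltW.
have E0 : complex.Re z0 +i* complex.Im z0 = z0 by case: (z0).
apply: (@corner_bound R F n df pf (complex.Re z0) _ rho N y0 hr hN hn); rewrite ?E0 //.
  by lra.
move=> p /(disc_upper y0 r0) [/andP[h1 h2] _]; apply: hmax => /=.
have lo := fund_dom_Im fz0.
have l1 : 59 / 70 * (9 / 10) <= complex.Im z0 * (1 - rho) by apply: ler_pM => //; lra.
have l2 : complex.Im z0 * (1 + rho) <= 10 / 9 * (11 / 10) by apply: ler_pM; [exact: ltW | lra | exact: ltW | lra].
by apply/andP; split; lra.
Qed.

Lemma disc_bound rho z (m : nat) : 0 < rho < 1 -> n%:R * rho ^+ 2 <= (2 - rho) ^+ 2 ->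
  1 <= complex.Im z * (1 - rho) -> 2 * (rho * complex.Im z) <= m%:R ->
  ht z * (pi * rho ^+ 2 * (1 - n%:R * rho ^+ 2 / (2 - rho) ^+ 2 / 2)) <= (1 + rho) ^+ 2 * (m%:R * N).
Proof.
move=> hr hn hy hm; have z0 : 0 < complex.Im z.
  have /andP[_ r1] := hr; rewrite -(@pmulr_lgt0 _ (1 - rho)) ?subr_gt0 //.
  by apply: lt_le_trans hy; exact: ltr01.
have := @interior_bound R F n df pf (complex.Re z) _ rho N z0 hr hN hn m hy hm.
by have -> : complex.Re z +i* complex.Im z = z by case: (z).
Qed.

Lemma expR_four_ge : 16 <= expR (4 : R).
Proof.
have -> : (4 : R) = 4%:R * 1 by rewrite mulr1.
rewrite expRM_natl; have : 2 ^+ 4 <= expR (1 : R) ^+ 4.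
  rewrite ler_pXn2r ?nnegrE ?expR_ge0 //.
  by apply: le_trans (expR_ge1Dx 1); lra.
by apply: le_trans; rewrite -natrX.
Qed.

(** Since 2 k <= 4 pi Y2, the growth of y^(2k) above the row is at most that of exp (4 pi (y - Y2)),
    which [cusp_decay] compensates. The factor 256/225 = (16/15)^2 bounds 1 / (1 - E)^2, where E =
    exp (-2 pi (y - Y2)) <= 1/16. *)
Lemma bound_above_row Y2 M z : 0 < Y2 -> k%:R <= 4 * Y2 -> Y2 + 1 <= complex.Im z ->
  (forall x, ht (x +i* Y2) <= M) -> ht z <= M * (256 / 225).
Proof.
move=> Y20 kY hz hM; have zY : Y2 < complex.Im z by apply: lt_le_trans hz; rewrite ltrDl.
have Yn : 0 < Y2 ^+ n by rewrite exprn_gt0.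
have M0 : 0 <= M by apply: le_trans (hM 0); exact: height_ge0.
pose B := Num.sqrt (M / Y2 ^+ n).
have hB x : cmod (F (x +i* Y2)) <= B.
  rewrite -(ger0_norm (cmod_ge0 _)) -sqrtr_sqr ler_wsqrtr // ler_pdivlMr //; exact: hM.
have := @cusp_decay R F Y2 B df pf _ Y20 hB z zY; set E := expR _ => H.
have {}H := H ltac:(by have [_ _ _ h] := cF).
set s := complex.Im z - Y2 in E H.
have s1 : 1 <= s by rewrite /s lerBrDl.
have E0 : 0 < E by exact: expR_gt0.
have E16 : E <= 1 / 16.
  rewrite /E expRN -[leRHS]invrK lef_pV2 ?posrE ?expR_gt0 ?invr_gt0 //.
  rewrite div1r invrK; apply: le_trans expR_four_ge _; rewrite ler_expR.
  have -> : (4 : R) = 2 * 2 * 1 by rewrite mulr1 -natrM.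
  by apply: ler_pM => //; rewrite ler_pM2l // pi_ge2.
have sq : ht z <= M / Y2 ^+ n * (E / (1 - E)) ^+ 2 * complex.Im z ^+ n.
  have zn : 0 <= complex.Im z ^+ n by rewrite exprn_ge0 // ltW // (lt_trans Y20).
  rewrite /height ler_wpM2r //.
  have -> : M / Y2 ^+ n = B ^+ 2 by rewrite sqr_sqrtr // divr_ge0 // ltW.
  by rewrite -exprMn ler_pXn2r ?nnegrE ?cmod_ge0 // mulr_ge0 ?sqrtr_ge0 // divr_ge0; lra.
have pw : (complex.Im z / Y2) ^+ n * E ^+ 2 <= 1.
  have h1 : complex.Im z / Y2 <= expR (s / Y2).
    have -> : complex.Im z / Y2 = 1 + s / Y2 by rewrite /s; field; rewrite gt_eqF.
    exact: expR_ge1Dx.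
  apply: le_trans (_ : expR (s / Y2) ^+ n * E ^+ 2 <= 1).
    rewrite ler_wpM2r ?sqr_ge0 // lerXn2r ?nnegrE ?expR_ge0 // divr_ge0 ?(ltW Y20) //.
    by rewrite ltW // (lt_trans Y20).
  rewrite /E -!expRM_natl -expRD -[leRHS]expR0 ler_expR natrM.
  have -> : 2 * k%:R * (s / Y2) + 2 * - (2 * pi * s) = (s / Y2 * 2) * (k%:R - 2 * (pi * Y2)).
    by field; rewrite gt_eqF.
  have s0 : 0 <= s by apply: le_trans s1; exact: ler01.
  apply: mulr_ge0_le0; first by rewrite mulr_ge0 // divr_ge0 // ltW.
  have : 2 * Y2 <= pi * Y2 by rewrite ler_pM2r // pi_ge2.
  by lra.
apply: le_trans sq _.
have -> : M / Y2 ^+ n * (E / (1 - E)) ^+ 2 * complex.Im z ^+ n =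
   M * ((complex.Im z / Y2) ^+ n * E ^+ 2 * (1 - E)^-1 ^+ 2).
  by rewrite !expr_div_n !exprVn; ring.
rewrite ler_wpM2l //; have -> : 256 / 225 = 1 * (16 / 15) ^+ 2 :> R by field.
have E1 : 0 < 1 - E by lra.
apply: ler_pM; [| exact: sqr_ge0 | exact: pw |].
  by rewrite mulr_ge0 ?sqr_ge0 // exprn_ge0 // divr_ge0 ?(ltW Y20) // ltW // (lt_trans Y20).
rewrite lerXn2r ?nnegrE ?invr_ge0 ?(ltW E1) //.
rewrite -[leRHS]invrK invf_div lef_pV2 ?posrE //.
by lra.
Qed.

End RangeBounds.

(** * Numerical comparison *)

Lemma pi_le4 (R : realType) : pi <= 4 :> R.
Proof. by have := @pihalf_lt2 R; lra. Qed.

(** [x] is the weight parameter k and [g] stands for 1.014^(2-k), for which Bernoulli's inequality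
    is enough. *)
Lemma small_weight_numeric (R : realType) (x g : R) : 2 <= x <= 57 -> 1 - (x - 2) * (7 / 507) <= g ->
  121 * (256 / 225) <= (1 / 3 - x / 361) * ((2 * x - 1) * (31 / 4 + 144 * g)).
Proof.
move=> /andP[x2 x57] hg; set t := x - 2 in hg.
have t0 : 0 <= t by rewrite /t; lra.
have t55 : t <= 55 by rewrite /t; lra.
(* a concave quadratic lies above the chord through its end values, here rounded down *)
have h1 : 491 / 500 + 17 / 50 * t <= (1 / 3 - x / 361) * (2 * x - 1).
  have : 0 <= t * (55 - t) by rewrite mulr_ge0 //; lra.
  by rewrite /t; lra.
have h2 : 607 / 4 - 2 * t <= 31 / 4 + 144 * g by lra.
rewrite [leRHS]mulrA; apply: le_trans (_ : (491 / 500 + 17 / 50 * t) * (607 / 4 - 2 * t) <= _).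
  have : 0 <= t * (55 - t) by rewrite mulr_ge0 // subr_ge0.
  by clear -t0 t55; lra.
apply: ler_pM; [| | exact: h1 | exact: h2].
  by clear -t0; lra.
by clear -t55; lra.
Qed.

Lemma expR_five_fourths_ge (R : realType) : 3 <= expR (5 / 4 : R).
Proof.
have -> : 5 / 4 = 8%:R * (5 / 32) :> R by field.
rewrite expRM_natl; pose a : R := 1 + 5 / 32.
have a2 : 133 / 100 <= a ^+ 2 by rewrite /a expr2; lra.
have a4 : 176 / 100 <= a ^+ 2 ^+ 2.
  by apply: le_trans (_ : (133 / 100) ^+ 2 <= _); [lra | rewrite lerXn2r ?nnegrE //; lra].
have a8 : 3 <= a ^+ 2 ^+ 2 ^+ 2.
  by apply: le_trans (_ : (176 / 100) ^+ 2 <= _); [lra | rewrite lerXn2r ?nnegrE //; lra].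
apply: (le_trans a8); rewrite -!exprM.
by rewrite lerXn2r ?nnegrE ?expR_ge0 ?expR_ge1Dx // /a; lra.
Qed.

Lemma expR_sqrt_pi_ge (R : realType) : 3 / 2 <= expR (5 / 4) / Num.sqrt pi :> R.
Proof.
have sp : 0 < Num.sqrt pi :> R by rewrite sqrtr_gt0 pi_gt0.
have s2 : Num.sqrt pi <= 2 :> R.
  rewrite -(@ler_pXn2r _ 2) ?nnegrE ?sqrtr_ge0 // sqr_sqrtr ?pi_ge0 //.
  by apply: le_trans (@pi_le4 R) _; lra.
rewrite ler_pdivlMr //; apply: le_trans (expR_five_fourths_ge R); lra.
Qed.

(** Prepares [strip_bound] and [disc_bound]: for rho up to 1/10 the factors (2 - rho)^2 and (1 +
    rho)^2 are replaced by constants. *)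
Lemma radius_of_square (R : realType) (q : R) : 0 < q <= 1 / 100 -> exists rho : R,
  [/\ 0 < rho, rho <= 1 / 10, rho ^+ 2 = q, 361 / 100 <= (2 - rho) ^+ 2 &
      (1 + rho) ^+ 2 <= 121 / 100].
Proof.
move=> /andP[q0 q1]; have r0 : 0 < Num.sqrt q by rewrite sqrtr_gt0.
have rr : Num.sqrt q ^+ 2 = q by rewrite sqr_sqrtr // ltW.
have r1 : Num.sqrt q <= 1 / 10 by rewrite -(@ler_pXn2r _ 2) ?nnegrE ?(ltW r0) // rr; lra.
exists (Num.sqrt q); split => //.
  apply: le_trans (_ : (19 / 10) ^+ 2 <= _); first by lra.
  by rewrite lerXn2r ?nnegrE //; lra.
apply: le_trans (_ : (11 / 10) ^+ 2 <= _); last by lra.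
by rewrite lerXn2r ?nnegrE //; lra.
Qed.

Section FinalBounds.
Variable R : realType.
Local Notation mu := (@lebesgue_measure R).
Local Notation mu2 := (mu \x mu)%E.
Variables (k : nat).
Local Notation n := (2 * k)%N.
Local Notation x := (k%:R : R).

Definition low_region_bound : R := 31 * (2 * x - 1) / (4 * pi)
          + 72 * (2 * x - 1) * (1014 / 1000) ^ (- (k%:Z - 2)).

Definition cusp_region_bound : R := (2 * x - 1) / (4 * pi)
          + 3 * (2 * x - 1) / (2 * pi)
            * (4 ^ (- k%:Z + 4) * (x / (2 * pi)) ^+ 4
               + Num.sqrt x * expR (5 / 4) / Num.sqrt pi).

Lemma power_ge : (2 <= k)%N -> 1 - (x - 2) * (7 / 507) <= (1014 / 1000) ^ (- (k%:Z - 2)) :> R.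
Proof.
move=> k2; have -> : - (k%:Z - 2) = - ((k - 2)%N%:Z) by rewrite -subzn.
rewrite -exprnN -exprVn; have -> : x - 2 = (k - 2)%:R by rewrite natrB.
have -> : (1014 / 1000)^-1 = 1 - 7 / 507 :> R by field.
by apply: bernoulli_le; apply/andP; split; lra.
Qed.

Lemma power_ge0 (m : int) : 0 <= (1014 / 1000) ^ m :> R.
Proof. exact: exprz_ge0 (divr_ge0 (ler0n R 1014) (ler0n R 1000)). Qed.

Lemma low_region_bound_ge : (2 <= k)%N ->
  (2 * x - 1) * (31 / 4 + 144 * (1014 / 1000) ^ (- (k%:Z - 2))) <= pi * low_region_bound.
Proof.
move=> k2; rewrite /low_region_bound; have := power_ge0 (- (k%:Z - 2)).
move: (_ ^ (- (k%:Z - 2))) => g g0.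
have x2 : 2 <= x by rewrite ler_nat.
have -> : pi * (31 * (2 * x - 1) / (4 * pi) + 72 * (2 * x - 1) * g) =
   (2 * x - 1) * (31 / 4 + 72 * (pi * g)).
  by have := @pi_gt0 R; move: (pi : R) => p p0; field; rewrite gt_eqF.
rewrite ler_wpM2l //; first by lra.
have : 2 * g <= pi * g by rewrite ler_wpM2r // pi_ge2.
lra.
Qed.

Lemma cusp_region_bound_ge : (26 <= k)%N ->
  (2 * x - 1) * (1 + 9 * Num.sqrt x) / 4 <= pi * cusp_region_bound.
Proof.
move=> k26; rewrite /cusp_region_bound -(mulrA (Num.sqrt x)).
set u := _ * _ ^+ 4; set s := Num.sqrt x; set v := _ / Num.sqrt pi.
have x26 : 26 <= x by rewrite ler_nat.
have u0 : 0 <= u.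
  by rewrite mulr_ge0 ?exprz_ge0 // exprn_ge0 // divr_ge0 ?ler0n // mulr_ge0 // pi_ge0.
have sv : s * (3 / 2) <= s * v by rewrite ler_wpM2l ?sqrtr_ge0 // expR_sqrt_pi_ge.
have -> : pi * ((2 * x - 1) / (4 * pi) + 3 * (2 * x - 1) / (2 * pi) * (u + s * v)) =
   (2 * x - 1) * (1 / 4 + 3 / 2 * (u + s * v)).
  by have := @pi_gt0 R; move: (pi : R) => p p0; field; rewrite gt_eqF.
rewrite -mulrA ler_wpM2l //; first by lra.
lra.
Qed.

Lemma low_region_bound_ge0 : (2 <= k)%N -> 0 <= low_region_bound.
Proof.
move=> k2; have x2 : 2 <= x by rewrite ler_nat.
have x1 : 0 <= 2 * x - 1 by lra.
rewrite -(pmulr_rge0 _ (@pi_gt0 R)); apply: le_trans (low_region_bound_ge k2).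
have := power_ge0 (- (k%:Z - 2)); move: (_ ^ (- (k%:Z - 2))) => g g0.
by apply: mulr_ge0 => //; lra.
Qed.

Lemma cusp_region_bound_ge0 : (26 <= k)%N -> 0 <= cusp_region_bound.
Proof.
move=> k26; have x26 : 26 <= x by rewrite ler_nat.
rewrite -(pmulr_rge0 _ (@pi_gt0 R)); apply: le_trans (cusp_region_bound_ge k26).
have s0 := sqrtr_ge0 x.
by apply: divr_ge0 => //; apply: mulr_ge0; lra.
Qed.

Variables (F : R[i] -> R[i]) (N : R).
Hypothesis cF : cusp_like k F.
Hypothesis N0 : 0 <= N.
Hypothesis hN : (\int[mu2]_(p in @fund_set R) upper_density F (2 * k) p = N%:E)%E.
Local Notation ht := (height F n).

(** The radius is 1/10. The factor 225/256 is reserved for [bound_above_row]. *)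
Lemma strip_bound_small_weight z : (2 <= k <= 57)%N -> 3 / 4 <= complex.Im z <= 15 ->
  ht z <= low_region_bound * N * (225 / 256).
Proof.
move=> /andP[k2 k57] zI; have x2 : 2 <= x by rewrite ler_nat.
have x57 : x <= 57 by rewrite ler_nat.
have r1 : 0 < (1 / 10 : R) <= 1 / 10 by apply/andP; split; lra.
have r2 : n%:R * (1 / 10) ^+ 2 <= (2 - 1 / 10) ^+ 2 :> R by rewrite natrM; lra.
have := strip_bound cF N0 hN r1 r2 zI.
set c := 1 / 3 - x / 361.
have -> : pi * (1 / 10) ^+ 2 * (1 / 3 - n%:R * (1 / 10) ^+ 2 / (2 - 1 / 10) ^+ 2 / 2) = pi * c / 100.
  by rewrite /c natrM; field.
have c0 : 0 < c by rewrite /c; lra.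
have p0 := @pi_gt0 R; have pc0 : 0 < pi * c by rewrite mulr_gt0.
move=> h; have {}h : ht z * (pi * c) <= 121 * N by move: h; lra.
have hb : 121 * (256 / 225) <= c * (pi * low_region_bound).
  apply: le_trans (small_weight_numeric (_ : 2 <= x <= 57) (power_ge k2)) _; first by rewrite x2.
  by rewrite -/c ler_pM2l // low_region_bound_ge.
rewrite -(ler_pM2r pc0); apply: le_trans h _.
have := ler_wpM2r N0 hb; lra.
Qed.

(** Here rho^2 = 29 / (50 k), so that 2 k rho^2 does not depend on k, and rho <= 1/10 as soon as k
    >= 58. The first term of the bound is enough. *)
Lemma strip_bound_large_weight z : (58 <= k)%N -> 3 / 4 <= complex.Im z <= 15 -> ht z <= low_region_bound * N.
Proof.
move=> k58 zI; have x58 : 58 <= x by rewrite ler_nat.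
have x0 : 0 < x by lra.
have q01 : 0 < 29 / (50 * x) <= 1 / 100.
  by rewrite divr_gt0 ?mulr_gt0 //= ler_pdivrMr ?mulr_gt0 //; lra.
have [rho [r0 r1 rr l u]] := radius_of_square q01.
have e : n%:R * rho ^+ 2 = 29 / 25 by rewrite natrM rr; field; rewrite gt_eqF.
have h1 : 0 < rho <= 1 / 10 by rewrite r0.
have h2 : n%:R * rho ^+ 2 <= (2 - rho) ^+ 2 by rewrite e; lra.
have := strip_bound cF N0 hN h1 h2 zI; rewrite e.
have l' : 29 / 25 / (2 - rho) ^+ 2 <= 116 / 361.
  by rewrite ler_pdivrMr; lra.
set c := 1 / 3 - _; have c0 : 17 / 100 <= c by rewrite /c; lra.
have z0 : 0 < complex.Im z by case/andP: zI => h _; apply: lt_le_trans h; lra.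
have M0 := height_ge0 F n z0.
have p0 := @pi_gt0 R.
rewrite rr => h; have hz : ht z * pi <= 62 / 5 * x * N.
  have s1 : ht z * (pi * (29 / (50 * x)) * (17 / 100)) <= 121 / 100 * N.
    apply: le_trans (le_trans h (ler_wpM2r N0 u)); rewrite ler_wpM2l // ler_wpM2l //.
    by rewrite mulr_ge0 // ltW.
  have -> : ht z * pi = ht z * (pi * (29 / (50 * x)) * (17 / 100)) * (x * (5000 / 493)).
    by field; rewrite gt_eqF.
  have x5 : 0 <= x * (5000 / 493) by exact: mulr_ge0 (ler0n R k) (divr_ge0 (ler0n R _) (ler0n R _)).
  apply: le_trans (ler_wpM2r x5 s1) _.
  have : 0 <= x * N by rewrite mulr_ge0 // ler0n.
  lra.
rewrite -(ler_pM2r p0); apply: le_trans hz _.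
rewrite [leRHS]mulrAC (mulrC low_region_bound) ler_wpM2r //.
have k2 : (2 <= k)%N by apply: leq_trans k58.
apply: le_trans (low_region_bound_ge k2).
have := power_ge0 (- (k%:Z - 2)); move: (_ ^ (- (k%:Z - 2))) => g g0.
apply: le_trans (_ : (2 * x - 1) * (31 / 4) <= _); first by lra.
by rewrite ler_wpM2l //; lra.
Qed.

(** Here rho^2 = 13 / (50 k). A disc of radius rho y with y <= k/4 + 1 meets about sqrt k / 4
    translates, which is where the order k sqrt k comes from. *)
Lemma middle_bound_large_weight z : (26 <= k)%N -> 4 <= complex.Im z <= x / 4 + 1 ->
  ht z <= cusp_region_bound * N * (225 / 256).
Proof.
move=> k26 /andP[z4 zx]; have x26 : 26 <= x by rewrite ler_nat.
have x0 : 0 < x by lra.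
have q01 : 0 < 13 / (50 * x) <= 1 / 100.
  by rewrite divr_gt0 ?mulr_gt0 //= ler_pdivrMr ?mulr_gt0 //; lra.
have [rho [r0 r1 rr l u]] := radius_of_square q01.
have e : n%:R * rho ^+ 2 = 13 / 25 by rewrite natrM rr; field; rewrite gt_eqF.
have h1 : 0 < rho < 1 by rewrite r0; lra.
have h2 : n%:R * rho ^+ 2 <= (2 - rho) ^+ 2 by rewrite e; lra.
have z0 : 0 < complex.Im z by lra.
have h3 : 1 <= complex.Im z * (1 - rho).
  apply: le_trans (_ : 4 * (9 / 10) <= _); first by lra.
  by apply: ler_pM => //; lra.
pose w := 2 * (rho * complex.Im z).
have w0 : 0 <= w by rewrite /w !mulr_ge0 // ltW.
pose m := (Num.truncn w).+1.
have /andP[w1 w2] := truncn_itv w0.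
have h4 : w <= m%:R by rewrite ltW.
pose s := Num.sqrt x; have s0 : 0 <= s by exact: sqrtr_ge0.
have ss : s ^+ 2 = x by rewrite sqr_sqrtr // ltW.
have rx : rho * x <= 51 / 100 * s.
  have b0 : 0 <= 51 / 100 * s by lra.
  have a0 : 0 <= rho * x by rewrite mulr_ge0 // ltW.
  rewrite -(@ler_pXn2r _ 2) ?nnegrE //.
  rewrite !exprMn rr ss; have -> : 13 / (50 * x) * x ^+ 2 = 13 / 50 * x by field; rewrite gt_eqF.
  by lra.
have mb : m%:R <= 51 / 200 * s + 6 / 5.
  have -> : m%:R = (Num.truncn w)%:R + 1 :> R by rewrite /m -natr1.
  have : rho * complex.Im z <= rho * (x / 4 + 1) by rewrite ler_pM2l.
  rewrite /w in w1; lra.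
have := disc_bound cF hN h1 h2 h3 h4; rewrite e.
have l' : 13 / 25 / (2 - rho) ^+ 2 <= 52 / 361.
  by rewrite ler_pdivrMr; lra.
set c := 1 - _; have c0 : 23 / 25 <= c by rewrite /c; lra.
have M0 := height_ge0 F n z0.
have p0 := @pi_gt0 R.
have mN : m%:R * N <= (51 / 200 * s + 6 / 5) * N by rewrite ler_wpM2r.
rewrite rr => h; have hz : ht z * pi <= 51 / 10 * x * ((51 / 200 * s + 6 / 5) * N).
  have s1 : ht z * (pi * (13 / (50 * x)) * (23 / 25)) <= 121 / 100 * ((51 / 200 * s + 6 / 5) * N).
    apply: le_trans (_ : (1 + rho) ^+ 2 * (m%:R * N) <= _); last first.
      by apply: ler_pM; rewrite ?sqr_ge0 ?mulr_ge0.
    apply: le_trans h; rewrite ler_wpM2l // ler_wpM2l //.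
    by rewrite mulr_ge0 // ltW.
  have -> : ht z * pi = ht z * (pi * (13 / (50 * x)) * (23 / 25)) * (x * (1250 / 299)).
    by field; rewrite gt_eqF.
  have x5 : 0 <= x * (1250 / 299) by exact: mulr_ge0 (ler0n R k) (divr_ge0 (ler0n R _) (ler0n R _)).
  apply: le_trans (ler_wpM2r x5 s1) _.
  have : 0 <= x * ((51 / 200 * s + 6 / 5) * N) by rewrite !mulr_ge0 ?ler0n //; lra.
  lra.
rewrite -(ler_pM2r p0); apply: le_trans hz _.
have -> : cusp_region_bound * N * (225 / 256) * pi = pi * cusp_region_bound * (225 / 256) * N by ring.
rewrite mulrA ler_wpM2r //.
apply: le_trans (ler_wpM2r _ (cusp_region_bound_ge k26)); last by lra.
have s5 : 5 <= s by rewrite -(@ler_pXn2r _ 2) ?nnegrE // ss; lra.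
have xs : 5 * x <= x * s by rewrite mulrC ler_wpM2l // ltW.
have sx : 26 * s <= x * s by rewrite ler_wpM2r.
rewrite -/s; lra.
Qed.

End FinalBounds.

(** * The three bounds *)

(** Points of the closure lie within 1/20 of the domain, all of whose points have y >= 59/70. *)
Lemma trunc_strip (R : realType) (Y : R) z : Y <= 5 -> fund_dom_trunc Y z -> 3 / 4 <= complex.Im z <= 15.
Proof.
move=> Y5 cz.
have [w [[fw wn] wz]] : ((@fund_dom R `\` cusp_nbhd Y) `&` [set w | cmod (w - z) < 1 / 20]) !=set0.
  by apply: cz; apply/nbhsC_P; exists (1 / 20); [lra | move=> w].
have wY : complex.Im w < Y by rewrite ltNge; apply/negP => h; apply: wn; split => //; case: fw.
have := le_lt_trans (le_Im_cmod _) wz; rewrite cImD cImN ltr_norml => /andP[h1 h2].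
have lo := fund_dom_Im fw.
by apply/andP; split; lra.
Qed.

Lemma cutoff_bounds (R : realType) : 4 <= (16 / Num.sqrt 15 : R) <= 5.
Proof.
have p15 : 0 < 15 :> R by lra.
have s0 : 0 < Num.sqrt 15 :> R by rewrite sqrtr_gt0.
have ss : Num.sqrt 15 ^+ 2 = 15 :> R by rewrite sqr_sqrtr // ltW.
rewrite ler_pdivlMr // ler_pdivrMr //; apply/andP; split.
  have : Num.sqrt 15 <= 4 :> R by rewrite -(@ler_pXn2r _ 2) ?nnegrE ?(ltW s0) // ss; lra.
  lra.
have : 16 / 5 <= Num.sqrt 15 :> R.
  by rewrite -(@ler_pXn2r _ 2) ?nnegrE ?(ltW s0) // ss; lra.
lra.
Qed.

Theorem theoremC (R : realType) (k d : nat) (f : 'I_d -> R[i] -> R[i])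
    (hf : orthonormal_basis_cusp_forms k f) (Y : R)
    (hY : Y = 16 / Num.sqrt 15) :
  [/\ (2 <= k)%N -> forall z : R[i], fund_dom_trunc Y z ->
        S2k k f z <=
          31 * (2 * k%:R - 1) / (4 * pi)
          + 72 * (2 * k%:R - 1) * (1014 / 1000) ^ (- (k%:Z - 2)),
      (2 <= k <= 25)%N -> forall z : R[i], cusp_nbhd Y z ->
        S2k k f z <=
          31 * (2 * k%:R - 1) / (4 * pi)
          + 72 * (2 * k%:R - 1) * (1014 / 1000) ^ (- (k%:Z - 2))
    & (26 <= k)%N -> forall z : R[i], cusp_nbhd Y z ->
        S2k k f z <=
          (2 * k%:R - 1) / (4 * pi)
          + 3 * (2 * k%:R - 1) / (2 * pi)
            * (4 ^ (- k%:Z + 4) * (k%:R / (2 * pi)) ^+ 4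
               + Num.sqrt k%:R * expR (5 / 4) / Num.sqrt pi)].
Proof.
have /andP[Y4 Y5] : 4 <= Y <= 5 by rewrite hY cutoff_bounds.
split.
- move=> k2 z /(trunc_strip Y5) zI.
  have z0 : 0 < complex.Im z by case/andP: zI => h _; apply: lt_le_trans h; lra.
  apply: (S2k_le_reproducing hf z0 (low_region_bound_ge0 R k2)) => F N cF N0 hN.
  have b0 : 0 <= low_region_bound R k * N by rewrite mulr_ge0 ?low_region_bound_ge0.
  have [k57|k58] := leqP k 57; last by have := strip_bound_large_weight cF N0 hN k58 zI. 
  have := strip_bound_small_weight cF N0 hN (_ : (2 <= k <= 57)%N) zI; rewrite k2 => /(_ k57) h.
  by clear -h b0; lra.
- move=> /andP[k2 k25] z [_ Yz].
  have z0 : 0 < complex.Im z by lra.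
  apply: (S2k_le_reproducing hf z0 (low_region_bound_ge0 R k2)) => F N cF N0 hN.
  have b0 : 0 <= low_region_bound R k * N by rewrite mulr_ge0 ?low_region_bound_ge0.
  have k57 : (2 <= k <= 57)%N by rewrite k2 (leq_trans k25).
  have low w : 3 / 4 <= complex.Im w <= 15 -> height F (2 * k) w <= low_region_bound R k * N * (225 / 256).
    exact: strip_bound_small_weight.
  have [z15|z15] := leP (complex.Im z) 15.
    have zI : 3 / 4 <= complex.Im z <= 15 by apply/andP; split; lra.
    by have := low z zI; clear -b0; lra.
  have k28 : k%:R <= 4 * 7 :> R by rewrite -natrM ler_nat (leq_trans k25).
(* the row at height 7 satisfies k <= 25 <= 4 * 7 *)
  have := @bound_above_row R F k cF 7 (low_region_bound R k * N * (225 / 256)) z _ k28 _ _.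
  have -> : low_region_bound R k * N * (225 / 256) * (256 / 225) = low_region_bound R k * N by field.
  apply; [lra | lra |].
  by move=> x; apply: low => /=; apply/andP; split; lra.
- move=> k26 z [_ Yz].
  have z0 : 0 < complex.Im z by lra.
  apply: (S2k_le_reproducing hf z0 (cusp_region_bound_ge0 R k26)) => F N cF N0 hN.
  have b0 : 0 <= cusp_region_bound R k * N by rewrite mulr_ge0 ?cusp_region_bound_ge0.
  have x26 : 26 <= k%:R :> R by rewrite ler_nat.
  have mid w : 4 <= complex.Im w <= k%:R / 4 + 1 -> height F (2 * k) w <= cusp_region_bound R k * N * (225 / 256).
    exact: middle_bound_large_weight.
  have [zk|zk] := leP (complex.Im z) (k%:R / 4 + 1).
    have zI : 4 <= complex.Im z <= k%:R / 4 + 1 by apply/andP; split; lra.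
    by have := mid z zI; clear -b0; lra.
(* the lowest row to which the decay estimate applies *)
  have := @bound_above_row R F k cF (k%:R / 4) (cusp_region_bound R k * N * (225 / 256)) z _ _ _ _.
  have -> : cusp_region_bound R k * N * (225 / 256) * (256 / 225) = cusp_region_bound R k * N by field.
  apply; [lra | lra | exact: ltW |].
  by move=> x; apply: mid => /=; apply/andP; split; lra.
Qed.
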